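(* Assume that $s$ is sufficiently large ($s \ge 11$ will do). Given any $A>0$, there exists $\theta_0$ such that $\|\theta_0\|_{H^s} \le 1$, but the corresponding solution $\theta(x,t)$ of the conservative surface quasi-geostrophic equation $$\partial_t \theta = (u\cdot\nabla)\theta, \qquad u = \nabla^\perp(-\Delta)^{-1/2}\theta, \qquad \theta(x,0)=\theta_0(x), \qquad x\in\mathbb{T}^2,$$ satisfies $$\limsup_{t\to\infty} \|\theta(\cdot,t)\|_{H^s} \ge A.$$
   Context: $\mathbb{T}^2 = \mathbb{R}^2/(2\pi\mathbb{Z})^2$ is the two-dimensional torus (equivalently, one works with periodic initial data on $\mathbb{R}^2$), and $\hat\theta_k$, $k\in\mathbb{Z}^2$, denote Fourier coefficients. $H^s = H^s(\mathbb{T}^2)$ is the usual scale of Sobolev spaces. The unknown $\theta=\theta(x,t)$ is a real-valued scalar function, and ''the corresponding solution'' is the solution of the equation with initial datum $\theta_0$. The operator $(-\Delta)^{-1/2}$ is the Fourier multiplier with symbol $1/|k|$ for $k\neq 0$, with the zero mode sent to zero, and $\nabla^\perp = (\partial_{x_2}, -\partial_{x_1})$. With these conventions, on the Fourier side and for mean-zero $\theta$, the equation reads $$\frac{d}{dt}\hat\theta_k = \frac12\sum_{l+m=k}(l\wedge m)\left(\frac1{|l|}-\frac1{|m|}\right)\hat\theta_l\hat\theta_m,\qquad l\wedge m = l_1m_2-l_2m_1.$$ *)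

(* Defs.v *)
From HB Require Import structures.
From mathcomp Require Import all_boot all_order all_algebra.
From mathcomp Require Import complex.
From mathcomp Require Import all_classical all_reals all_analysis.
Import Order.TTheory GRing.Theory Num.Theory.
Import numFieldNormedType.Exports.

Set Implicit Arguments.
Unset Strict Implicit.
Unset Printing Implicit Defensive.

Local Open Scope classical_set_scope.
Local Open Scope ring_scope.

Section SQG.
Context {R : realType}.

(* Functions on the torus R^2 / (2 pi Z)^2 are (2 pi Z)^2-periodic functions
   on R * R. *)
Definition periodic2 (f : R * R -> R) : Prop :=
  forall x, f (x.1 + pi *+ 2, x.2) = f x /\ f (x.1, x.2 + pi *+ 2) = f x.

Definition torus_cell : set (R * R) := `[0, pi *+ 2] `*` `[0, pi *+ 2].

Definition lebesgue2 := (@lebesgue_measure R \x @lebesgue_measure R)%E.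

Definition phase (k : int * int) (x : R * R) : R :=
  k.1%:~R * x.1 + k.2%:~R * x.2.

(* (2 pi)^-2 times the integral of f(x) e^{-i k.x} over one period cell. *)
Definition fourier_coef (f : R * R -> R) (k : int * int) : R[i] :=
  Complex
    (((pi *+ 2) ^+ 2)^-1 *
       \int[lebesgue2]_(x in torus_cell) (f x * cos (phase k x)))
    (- (((pi *+ 2) ^+ 2)^-1 *
       \int[lebesgue2]_(x in torus_cell) (f x * sin (phase k x)))).

Definition sqnormk (k : int * int) : R := k.1%:~R ^+ 2 + k.2%:~R ^+ 2.

Definition normk (k : int * int) : R := Num.sqrt (sqnormk k).

Definition Hs_norm (s : R) (f : R * R -> R) : \bar R :=
  ((\esum_(k in [set: int * int])
      ((1 + sqnormk k) `^ s * Normc.normc (fourier_coef f k) ^+ 2)%R%:E)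
     `^ 2^-1)%E.

(* Square integrability is required separately because the integrals in
   [fourier_coef] take a default value on non-integrable functions. *)
Definition Hs (s : R) (f : R * R -> R) : Prop :=
  [/\ periodic2 f,
      measurable_fun setT f,
      lebesgue2.-integrable torus_cell (fun x => ((f x) ^+ 2)%:E) &
      (Hs_norm s f < +oo)%E].

Definition partial1 (f : R * R -> R) (x : R * R) : R :=
  derive1 (fun y : R => f (y, x.2)) x.1.

Definition partial2 (f : R * R -> R) (x : R * R) : R :=
  derive1 (fun y : R => f (x.1, y)) x.2.

Definition C1 (f : R * R -> R) : Prop :=
  [/\ continuous f,
      forall x, derivable (fun y : R => f (y, x.2)) x.1 1,
      forall x, derivable (fun y : R => f (x.1, y)) x.2 1,
      continuous (partial1 f) &
      continuous (partial2 f)].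

Definition grad (f : R * R -> R) (x : R * R) : R * R :=
  (partial1 f x, partial2 f x).

Definition grad_perp (f : R * R -> R) (x : R * R) : R * R :=
  (partial2 f x, - partial1 f x).

Definition dot (v w : R * R) : R := v.1 * w.1 + v.2 * w.2.

(* g = m(D) f, for a real multiplier m; a continuous periodic g is determined
   by its Fourier coefficients. *)
Definition fourier_multiplier (m : int * int -> R) (f g : R * R -> R) : Prop :=
  [/\ periodic2 g, continuous g &
      forall k, fourier_coef g k = Complex (m k) 0 * fourier_coef f k].

Definition inv_sqrt_laplacian_symbol (k : int * int) : R :=
  if k == (0, 0) then 0 else (normk k)^-1.

(* psi = (- Delta)^{-1/2} f *)
Definition is_inv_sqrt_laplacian (f psi : R * R -> R) : Prop :=
  fourier_multiplier inv_sqrt_laplacian_symbol f psi.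

Definition lifespan (T : \bar R) : set R := [set t | 0 <= t /\ (t%:E < T)%E].

(* theta is a classical solution on [0, T) in the class C([0, T); H^s), where
   T may be +oo.  The values theta t for t outside [0, T) are irrelevant.  For
   s > 2 the H^s norm controls the C^1 norm; the C^1 requirements only select
   the continuous representatives of theta(t) and of its stream function. *)
Record sqg_solution (s : R) (theta0 : R * R -> R) (T : \bar R)
    (theta : R -> R * R -> R) : Prop := SQGSolution {
  sqg_initial : theta 0 = theta0;
  sqg_Hs : forall t, lifespan T t -> Hs s (theta t);
  sqg_C1 : forall t, lifespan T t -> C1 (theta t);
  sqg_Hs_continuous : forall t0, lifespan T t0 ->
    Hs_norm s (fun x => theta t x - theta t0 x)
      @[t --> within (lifespan T) (nbhs t0)] --> 0%E;
  sqg_equation : forall t, 0 < t -> lifespan T t ->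
    exists psi, [/\ is_inv_sqrt_laplacian (theta t) psi, C1 psi &
      forall x, is_derive t 1 (fun tau : R => theta tau x)
                  (dot (grad_perp psi x) (grad (theta t) x))]
}.

End SQG.

(* Main.v *)
Require Import Defs.
From HB Require Import structures.
From mathcomp Require Import all_boot all_order all_algebra.
From mathcomp Require Import complex.
From mathcomp Require Import all_classical all_reals all_analysis.
From mathcomp Require Import measurable_realfun.
From mathcomp Require Import ring lra zify.
Import Order.TTheory GRing.Theory Num.Theory.
Import numFieldNormedType.Exports.

(** The equation transports [theta] by a divergence-free field and conserves
    [mean (theta (-Delta)^(-1/2) theta)] as well as every mean [mean (F theta)].
    Hence it conserves the energy [\sum_k (1 - 1/|k|) |theta_k|^2], whose weight
    vanishes only for [|k| = 1]. The datum is a shear flow [2 al0 cos x1] plus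
    the perturbation [4 tau cos x1 cos 2 x2], with [tau = nu^11] and [nu] small.
    It is even and invariant under [x2 |-> x2 + pi], and so is the solution
    ([flow_sym]); thus only the modes [+-(1, 0)] have weight zero. The mass in
    the other modes is therefore comparable to [tau^2] for all times: the
    solution stays close to the shear flow but never closer than it was at first
    ([flow_perturbed], [vv_mass], [energy_tail]).

    Suppose that the [H^s] norm stays below [A] from some time on. Interpolating
    between the smallness in [l2] and eleven bounded derivatives, the
    perturbation is small in every norm that matters ([vv_interp]), so the
    linearisation at the shear flow governs the motion. In the unknowns
    [phi k = (1 - 1/|k|) theta_k] it is a difference operator along the lines
    [k.2 = const] ([al_transport]). The virial
    [\sum (k.1 + 1/2) / k.2 * phi k * phi (k + e1)] has as derivative a positive
    quadratic form, a telescoping flux and a remainder quadratic in the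
    perturbation ([virial_identity], [virial_split]). The form is at least of
    order [nu^26] and the remainder at most of order [nu^27] ([growth_sum],
    [rem_virial]), so the virial grows linearly; but it is bounded by the norm
    ([norm_unbounded]).

    The form sees only the modes with [k.2 <> 0], so it must be excluded that
    the energy of the perturbation leaves for the shear modes [(n, 0)]. This is
    where the conservation of [mean (F theta)] enters for general polynomials
    [F]: to first order it forbids any change in the direction of functions of
    the shear flow. Taking for [F'] the combination of Chebyshev polynomials that
    reproduces the shear modes of the solution bounds these modes themselves
    ([zmodes_small]). That the growth argument applies from every time on is what
    gives an upper limit, and not only a supremum, at least [A].

    A local solution is a power series in time whose coefficients are
    trigonometric polynomials. The coefficient of [t^n] has degree [2 (n + 1)],
    so the derivative lost in the nonlinearity costs a factor of order [n], which
    the integration in time returns; the series converges with all derivatives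
    ([tcoef_decay], [lsol_solution]).

    The analysis is done with sums over finite boxes of frequencies and explicit
    rates. It rests on the uniqueness of Fourier coefficients of continuous
    functions, proved with powers of a trigonometric polynomial that peaks at a
    point ([fourier_uniq]). *)

Set Implicit Arguments.
Unset Strict Implicit.
Unset Printing Implicit Defensive.

Local Open Scope classical_set_scope.
Local Open Scope ring_scope.

(** * Mean values over the period cell *)

Section Mean.
Context {R : realType}.
Local Notation X := (R * R)%type.
Implicit Types f g : X -> R.

(** The product sigma-algebra is generated by rectangles: an open set is a
    countable union of boxes with rational data. *)
Lemma open_measurable2 (U : set X) : open U -> measurable U.
Proof.
move=> oU.
pose bx (p : rat * rat * nat) : set X :=
  `](ratr p.1.1 - p.2.+1%:R^-1), (ratr p.1.1 + p.2.+1%:R^-1)[ `*`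
  `](ratr p.1.2 - p.2.+1%:R^-1), (ratr p.1.2 + p.2.+1%:R^-1)[.
have -> : U = \bigcup_(p in [set p | bx p `<=` U]) bx p.
  apply/seteqP; split => [x Ux|x [p /= pU]]; last exact: pU.
  have /nbhs_ballP[e /= e0 xeU] : nbhs x U by exact: open_nbhs_nbhs.
  have [n ne] : exists n : nat, n.+1%:R^-1 < e / 2.
    have e20 : 0 < e / 2 by rewrite divr_gt0.
    have [N _ /(_ N (leqnn _))] := near_infty_natSinv_lt (PosNum e20).
    by exists N.
  pose d : R := n.+1%:R^-1.
  have d0 : 0 < d by rewrite invr_gt0.
  have dx (y : R) : y - d < y + d by lra.
  have [/= a] := rat_in_itvoo (dx x.1).
  have [/= b] := rat_in_itvoo (dx x.2).
  rewrite !in_itv/= => /andP[b1 b2] /andP[a1 a2].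
  exists (a, b, n) => /=.
  - move=> y [/=]; rewrite !in_itv/= -/d => /andP[y1 y2] /andP[y3 y4].
    apply: xeU; rewrite /ball/= /prod_ball/= /ball/=.
    by rewrite -/d in ne; split; rewrite ltr_norml; lra.
  - by rewrite /bx/= -/d; split => /=; rewrite in_itv/=; apply/andP; split; lra.
have mbx p : measurable (bx p) by apply: measurableX.
pose F (n : nat) := if (unpickle n : option (rat * rat * nat)) is Some p then
  (if `[< bx p `<=` U >] then bx p else set0) else set0.
have -> : \bigcup_(p in [set p | bx p `<=` U]) bx p = \bigcup_n F n.
  apply/seteqP; split => [x [p pU xp]|x [n _]].
    exists (pickle p); first exact: I.
    by rewrite /F pickleK (asboolT pU).
  rewrite /F; case: (unpickle n) => [p|]; last by [].
  by case: asboolP => [pU xp|_ []]; exists p.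
apply: bigcupT_measurable => n; rewrite /F.
case: (unpickle n) => [p|]; last exact: measurable0.
by case: asboolP => _; [exact: mbx|exact: measurable0].
Qed.

Lemma continuous_measurable2 f : continuous f -> measurable_fun setT f.
Proof.
move=> /continuousP cf; apply: (measurability _ (measurable_realfun.RGenOpens.measurableE R)).
move=> _ [_ [a [b ->] <-]]; rewrite setTI; apply: open_measurable2.
exact/cf/interval_open.
Qed.

Lemma cell_measurable : measurable (@torus_cell R).
Proof. by apply: measurableX. Qed.

Lemma cell_compact : compact (@torus_cell R).
Proof. by apply: compact_setX; apply: segment_compact. Qed.

Lemma twopi_gt0 : 0 < pi *+ 2 :> R.
Proof. by rewrite pmulrn_lgt0// pi_gt0. Qed.

Lemma cell_measure : @lebesgue2 R torus_cell = ((pi *+ 2) ^+ 2)%:E.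
Proof.
rewrite /lebesgue2 /torus_cell product_measure1E//= lebesgue_measure_itv/=.
by rewrite lte_fin twopi_gt0 oppr0 adde0 -EFinM expr2.
Qed.

Lemma continuous_cell_bounded f : continuous f ->
  exists2 M : R, 0 <= M & forall x, torus_cell x -> `|f x| <= M.
Proof.
move=> cf.
have : compact (f @` (@torus_cell R)).
  apply: continuous_compact; last exact: cell_compact.
  exact: continuous_subspaceT.
move=> /compact_bounded[M [_ HM]]; exists (`|M| + 1) => [|x cx].
  by rewrite addr_ge0.
apply: HM; first by rewrite (le_lt_trans (ler_norm _))// ltrDl.
by exists x.
Qed.

Lemma continuous_cell_integrable f : continuous f ->
  (@lebesgue2 R).-integrable torus_cell (EFin \o f).
Proof.
move=> cf; apply: measurable_bounded_integrable.
- exact: cell_measurable.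
- by have : (@lebesgue2 R torus_cell < +oo)%E by rewrite cell_measure ltry.
- by apply: measurable_funTS; exact: continuous_measurable2.
have [M M0 HM] := continuous_cell_bounded cf.
exists M; split; first exact: num_real.
by move=> B MB x cx; apply: le_trans (HM _ cx) _; exact: ltW.
Qed.

(** Normalised as the integrals in [fourier_coef]. *)
Definition mean f : R :=
  ((pi *+ 2) ^+ 2)^-1 * \int[lebesgue2]_(x in torus_cell) f x.

Let c0 : 0 < ((pi *+ 2) ^+ 2)^-1 :> R.
Proof. by rewrite invr_gt0 exprn_gt0// twopi_gt0. Qed.

Lemma mean_cst (r : R) : mean (fun=> r) = r.
Proof.
rewrite /mean Rintegral_cst; last exact: cell_measurable.
by rewrite [fine _](congr1 fine cell_measure)/= mulrCA mulVf ?mulr1// gt_eqF// exprn_gt0// twopi_gt0.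
Qed.

Lemma meanD f g : continuous f -> continuous g ->
  mean (fun x => f x + g x) = mean f + mean g.
Proof.
move=> cf cg; rewrite /mean -mulrDr RintegralD//.
- exact: cell_measurable.
- exact: continuous_cell_integrable.
- exact: continuous_cell_integrable.
Qed.

Lemma meanZ r f : continuous f -> mean (fun x => r * f x) = r * mean f.
Proof.
move=> cf; rewrite /mean RintegralZl; first exact: mulrCA.
- exact: cell_measurable.
- exact: continuous_cell_integrable.
Qed.

Lemma meanN f : continuous f -> mean (fun x => - f x) = - mean f.
Proof.
by move=> cf; rewrite -[RHS]mulN1r -meanZ//; congr mean; apply/funext => x; rewrite mulN1r.
Qed.

Lemma meanB f g : continuous f -> continuous g ->
  mean (fun x => f x - g x) = mean f - mean g.
Proof.
move=> cf cg; rewrite meanD// ?meanN//.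
by move=> x; apply: continuousN; exact: cg.
Qed.

Lemma mean_le f g : continuous f -> continuous g ->
  (forall x, torus_cell x -> f x <= g x) -> mean f <= mean g.
Proof.
move=> cf cg fg; rewrite /mean ler_pM2l//; apply: le_Rintegral => //.
- exact: cell_measurable.
- exact: continuous_cell_integrable.
- exact: continuous_cell_integrable.
Qed.

Lemma mean_ge0 f : (forall x, 0 <= f x) -> 0 <= mean f.
Proof. by move=> f0; apply: mulr_ge0; [exact: ltW|exact: Rintegral_ge0]. Qed.

Lemma mean_norm_le f (M : R) : continuous f -> (forall x, `|f x| <= M) ->
  `|mean f| <= M.
Proof.
move=> cf fM; rewrite ler_norml.
have cc (r : R) : continuous (fun _ : X => r) by move=> x; exact: cvg_cst.
apply/andP; split.
  rewrite -[leLHS]mean_cst; apply: mean_le => // x _.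
  by have := fM x; rewrite ler_norml => /andP[].
rewrite -[leRHS]mean_cst; apply: mean_le => // x _.
by have := fM x; rewrite ler_norml => /andP[].
Qed.

Lemma mean_sum (I : Type) (s : seq I) (F : I -> X -> R) :
  (forall i, continuous (F i)) ->
  mean (fun x => \sum_(i <- s) F i x) = \sum_(i <- s) mean (F i)
  /\ continuous (fun x => \sum_(i <- s) F i x).
Proof.
move=> cF; elim: s => [|i s [IH cs]].
  under eq_fun do rewrite big_nil; rewrite big_nil mean_cst; split => //.
  by move=> x; exact: cvg_cst.
under eq_fun do rewrite big_cons; rewrite big_cons meanD// IH; split => //.
by move=> x; apply: continuousD; [exact: cF|exact: cs].
Qed.

(** The contribution of a square on which [f] is at least [c]. *)
Lemma mean_box_ge f (c r : R) (y : X) : continuous f -> 0 <= c -> 0 < r ->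
  0 <= y.1 - r -> y.1 + r <= pi *+ 2 -> 0 <= y.2 - r -> y.2 + r <= pi *+ 2 ->
  (forall x, torus_cell x -> 0 <= f x) ->
  (forall x, `|x.1 - y.1| <= r -> `|x.2 - y.2| <= r -> c <= f x) ->
  c * ((pi *+ 2) ^+ 2)^-1 * (2 * r) ^+ 2 <= mean f.
Proof.
move=> cf cge0 r0 h1 h2 h3 h4 f0 fc.
pose B : set X := `[y.1 - r, y.1 + r] `*` `[y.2 - r, y.2 + r].
have mB : measurable B by apply: measurableX.
have Bc : B `<=` torus_cell.
  move=> x [/=]; rewrite !in_itv/= => /andP[a1 a2] /andP[a3 a4].
  by split => /=; rewrite in_itv/=; apply/andP; split; lra.
have mB2 : @lebesgue2 R B = ((2 * r) ^+ 2)%:E.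
  rewrite /lebesgue2 /B product_measure1E//= !lebesgue_measure_itv/= !lte_fin.
  have -> : y.1 - r < y.1 + r by lra.
  have -> : y.2 - r < y.2 + r by lra.
  by rewrite -!EFinB -EFinM; congr EFin; ring.
rewrite /mean mulrAC [leLHS]mulrC ler_pM2l//.
have iB g : continuous g -> (@lebesgue2 R).-integrable B (EFin \o g).
  move=> cg; have := continuous_cell_integrable cg.
  by apply: integrableS => //; exact: cell_measurable.
apply: (@le_trans _ _ (\int[lebesgue2]_(x in B) f x)).
  have -> : c * (2 * r) ^+ 2 = \int[@lebesgue2 R]_(x in B) c.
    by rewrite Rintegral_cst// [fine _](congr1 fine mB2).
  apply: le_Rintegral => //; [|exact: iB|].
    by apply: iB => x; exact: cvg_cst.
  move=> x [/=]; rewrite !in_itv/= => /andP[a1 a2] /andP[a3 a4].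
  by apply: fc; rewrite ler_norml; lra.
apply: fine_le.
- by apply: integrable_fin_num => //; exact: iB.
- by apply: integrable_fin_num; [exact: cell_measurable|exact: continuous_cell_integrable].
- apply: ge0_subset_integral => //; first exact: cell_measurable.
    by apply/measurable_EFinP; apply: measurable_funTS; exact: continuous_measurable2.
Qed.

Lemma pair_continuousl (y : R) : continuous (fun x : R => (x, y)).
Proof.
move=> x.
exact: (cvg_pair (f := id) (g := fun=> y) (F := nbhs x) cvg_id (cvg_cst y)).
Qed.

Lemma pair_continuousr (x : R) : continuous (fun y : R => (x, y)).
Proof.
move=> y.
exact: (cvg_pair (f := fun=> x) (g := id) (F := nbhs y) (cvg_cst x) cvg_id).
Qed.

Lemma integral_derive_period (u u' : R -> R) :
  (forall y : R, is_derive y 1 u (u' y)) -> continuous u' -> u (pi *+ 2) = u 0 ->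
  (\int[lebesgue_measure]_(x in `[0%R, (pi *+ 2)%R]) (u' x)%:E = 0)%E.
Proof.
move=> du cu' up; rewrite (@continuous_FTC2 _ u' u)//.
- by rewrite up -EFinB subrr.
- exact: twopi_gt0.
- exact: continuous_subspaceT.
- have cu x : {for x, continuous u}.
    by apply: differentiable_continuous; apply/derivable1_diffP; case: (du x).
  split => //.
  + by apply: cvg_at_right_filter; exact: cu.
  + by apply: cvg_at_left_filter; exact: cu.
- by move=> x _; rewrite derive1E; case: (du x).
Qed.

Lemma integrable_restrict_cell g : continuous g ->
  (@lebesgue2 R).-integrable setT (EFin \o (g \_ torus_cell)).
Proof.
move=> cg; rewrite -restrict_EFin; apply/integrable_restrict => //.
  exact: cell_measurable.
by rewrite setTI; exact: continuous_cell_integrable.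
Qed.

(** Fubini, integrating first in the variable of the derivative. *)
Lemma mean_derive1 f g : (forall x, f (x.1 + pi *+ 2, x.2) = f x) ->
  (forall x : X, is_derive x.1 1 (fun y : R => f (y, x.2)) (g x)) -> continuous g ->
  mean g = 0.
Proof.
move=> fp df cg; rewrite /mean /Rintegral.
rewrite integral_mkcond restrict_EFin /lebesgue2.
rewrite -integral21_prod_meas1; last exact: integrable_restrict_cell.
rewrite /fubini_G integral0_eq ?mulr0// => y _.
have [yc|yc] := pselect (y \in `[0, pi *+ 2]); last first.
  apply: integral0_eq => x _ /=; rewrite patchE memNset//.
  by move=> [/= _]; rewrite -/(y \in _).
transitivity (\int[@lebesgue_measure R]_(x in `[0%R, (pi *+ 2)%R]) (g (x, y))%:E)%E.
  rewrite [RHS]integral_mkcond; apply: eq_integral => x _ /=.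
  rewrite !patchE; case: ifPn => xc; case: ifPn => xc' //.
  - by move: xc; rewrite inE => -[/= xc _]; rewrite mem_set in xc'.
  - by move: xc'; rewrite inE => xc'; rewrite mem_set in xc.
apply: (@integral_derive_period (fun z => f (z, y))).
- by move=> z; exact: (df (z, y)).
- by move=> z; apply: (@continuous_comp _ _ _ (fun x : R => (x, y)) g);
    [exact: pair_continuousl|exact: cg].
- by have := fp (0, y); rewrite /= add0r.
Qed.

Lemma mean_derive2 f g : (forall x, f (x.1, x.2 + pi *+ 2) = f x) ->
  (forall x : X, is_derive x.2 1 (fun y : R => f (x.1, y)) (g x)) -> continuous g ->
  mean g = 0.
Proof.
move=> fp df cg; rewrite /mean /Rintegral.
rewrite integral_mkcond restrict_EFin /lebesgue2.
rewrite -integral12_prod_meas1; last exact: integrable_restrict_cell.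
rewrite /fubini_F integral0_eq ?mulr0// => y _.
have [yc|yc] := pselect (y \in `[0, pi *+ 2]); last first.
  apply: integral0_eq => x _ /=; rewrite patchE memNset//.
  by move=> [/= +]; rewrite -/(y \in _).
transitivity (\int[@lebesgue_measure R]_(x in `[0%R, (pi *+ 2)%R]) (g (y, x))%:E)%E.
  rewrite [RHS]integral_mkcond; apply: eq_integral => x _ /=.
  rewrite !patchE; case: ifPn => xc; case: ifPn => xc' //.
  - by move: xc; rewrite inE => -[/= _ xc]; rewrite mem_set in xc'.
  - by move: xc'; rewrite inE => xc'; rewrite mem_set in xc.
apply: (@integral_derive_period (fun z => f (y, z))).
- by move=> z; exact: (df (y, z)).
- by move=> z; apply: (@continuous_comp _ _ _ (fun x : R => (y, x)) g);
    [exact: pair_continuousr|exact: cg].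
- by have := fp (y, 0); rewrite /= add0r.
Qed.

End Mean.

(** * Continuity of explicit functions *)

Section Ct.
Context {R : realType} {T : topologicalType}.
Implicit Types f g : T -> R.

Lemma ctC (r : R) : continuous (fun _ : T => r).
Proof. by move=> x; exact: cvg_cst. Qed.
Lemma ctD f g : continuous f -> continuous g -> continuous (fun x => f x + g x).
Proof. by move=> cf cg x; apply: continuousD; [exact: cf|exact: cg]. Qed.
Lemma ctN f : continuous f -> continuous (fun x => - f x).
Proof. by move=> cf x; apply: continuousN; exact: cf. Qed.
Lemma ctM f g : continuous f -> continuous g -> continuous (fun x => f x * g x).
Proof. by move=> cf cg x; apply: continuousM; [exact: cf|exact: cg]. Qed.
Lemma ctX f n : continuous f -> continuous (fun x => f x ^+ n).
Proof.
move=> cf; elim: n => [|n IH]; first exact: ctC.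
by under eq_fun do rewrite exprS; exact: ctM.
Qed.
Lemma ct_sum (I : Type) (s : seq I) (F : I -> T -> R) :
  (forall i, continuous (F i)) -> continuous (fun x => \sum_(i <- s) F i x).
Proof.
move=> cF; elim: s => [|i s IH].
  by under eq_fun do rewrite big_nil; exact: ctC.
by under eq_fun do rewrite big_cons; exact: ctD.
Qed.
Lemma ct_cos f : continuous f -> continuous (fun x => cos (f x)).
Proof. by move=> cf x; apply: (@continuous_comp _ _ _ f cos); [exact: cf|exact: continuous_cos]. Qed.
Lemma ct_sin f : continuous f -> continuous (fun x => sin (f x)).
Proof. by move=> cf x; apply: (@continuous_comp _ _ _ f sin); [exact: cf|exact: continuous_sin]. Qed.
End Ct.

Lemma ct_fst {R : realType} : continuous (fun x : R * R => x.1).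
Proof. by move=> x; exact: cvg_fst. Qed.
Lemma ct_snd {R : realType} : continuous (fun x : R * R => x.2).
Proof. by move=> x; exact: cvg_snd. Qed.

Lemma ct_phase {R : realType} k : continuous (@phase R k).
Proof.
by rewrite /phase; apply: ctD; apply: ctM; (try exact: ctC); [exact: ct_fst|exact: ct_snd].
Qed.

(** A syntactic marker, so that the tactic below is driven by the head symbol
    of the function and never by unification up to conversion. *)
Definition cont {R : realType} {T : topologicalType} (f : T -> R) : Prop :=
  continuous f.

Ltac ct_step :=
  lazymatch goal with
  | |- cont (fun _ => ?r) => exact: (@ctC _ _ r)
  | |- cont (fun x => @GRing.add _ (@?f x) (@?g x)) => apply: (@ctD _ _ f g)
  | |- cont (fun x => @GRing.mul _ (@?f x) (@?g x)) => apply: (@ctM _ _ f g)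
  | |- cont (fun x => @GRing.opp _ (@?f x)) => apply: (@ctN _ _ f)
  | |- cont (fun x => @GRing.exp _ (@?f x) ?n) => apply: (@ctX _ _ f n)
  | |- cont (fun x => cos (@?f x)) => apply: (@ct_cos _ _ f)
  | |- cont (fun x => sin (@?f x)) => apply: (@ct_sin _ _ f)
  | |- cont (fun x => phase ?k x) => exact: (@ct_phase _ k)
  | |- cont (fun x => fst x) => exact: ct_fst
  | |- cont (fun x => snd x) => exact: ct_snd
  | |- cont (fun x => \sum_(i <- ?s) (@?F x i)) =>
      apply: (@ct_sum _ _ _ s (fun i x => F x i)) => ?
  end.

Ltac ct_mark := lazymatch goal with
  | |- cont _ => idtac
  | |- forall x, continuous_at x ?f => change (cont f)
  end.

Ltac ct_hyp :=
  try (lazymatch goal with |- cont (fun x => ?h x) => change (cont h) end);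
  match goal with
  | H : forall x, continuous_at x ?f |- cont ?f => exact H
  end.

Ltac ct_leaf := ct_hyp.

Ltac ct := repeat (ct_mark; cbv beta; first [ct_step | solve [ct_leaf]]).

(** * Finite sums and boxes of frequencies *)

Section Seqs.
Context {R : realType}.

Lemma perm_sub_cat (T : eqType) (s t : seq T) : uniq s -> uniq t ->
  {subset s <= t} -> perm_eq t (s ++ [seq x <- t | x \notin s]).
Proof.
move=> us ut st; apply: uniq_perm => //.
  rewrite cat_uniq us filter_uniq// andbT; apply/hasPn => x.
  by rewrite mem_filter => /andP[].
move=> x; rewrite mem_cat mem_filter.
by case: (boolP (x \in s)) => //= /st ->.
Qed.

Lemma sumr_sub (T : eqType) (s t : seq T) (F : T -> R) :
  uniq s -> uniq t -> {subset s <= t} -> (forall k, 0 <= F k) ->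
  \sum_(k <- s) F k <= \sum_(k <- t) F k.
Proof.
move=> us ut st F0; rewrite [leRHS](perm_big _ (perm_sub_cat us ut st))/= big_cat/=.
by rewrite lerDl sumr_ge0.
Qed.

Lemma sumr_norm_diff (T : eqType) (s t : seq T) (F G : T -> R) :
  uniq s -> uniq t -> {subset s <= t} -> (forall k, `|F k| <= G k) ->
  `|\sum_(k <- t) F k - \sum_(k <- s) F k| <= \sum_(k <- t) G k - \sum_(k <- s) G k.
Proof.
move=> us ut st FG.
have E (H : T -> R) : \sum_(k <- t) H k - \sum_(k <- s) H k =
    \sum_(k <- [seq x <- t | x \notin s]) H k.
  rewrite [X in X - _](perm_big _ (perm_sub_cat us ut st))/= big_cat/=.
  by rewrite addrAC subrr add0r.
rewrite !E.
by rewrite (le_trans (ler_norm_sum _ _ _))// ler_sum.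
Qed.

(** The sum of the squares of [x F - y G] is nonnegative; take [x = C] and [y =
    A], with the notations of the proof. *)
Lemma sum_cauchy (T : Type) (s : seq T) (F G : T -> R) :
  (\sum_(k <- s) F k * G k) ^+ 2 <=
  (\sum_(k <- s) F k ^+ 2) * (\sum_(k <- s) G k ^+ 2).
Proof.
set A := \sum_(k <- s) F k ^+ 2; set B := \sum_(k <- s) G k ^+ 2.
set C := \sum_(k <- s) F k * G k.
have H (x y : R) : 0 <= x ^+ 2 * A + y ^+ 2 * B - 2 * x * y * C.
  have -> : x ^+ 2 * A + y ^+ 2 * B - 2 * x * y * C =
      \sum_(k <- s) (x * F k - y * G k) ^+ 2.
    rewrite !mulr_sumr -big_split/= -sumrB; apply: eq_bigr => k _; ring.
  by rewrite sumr_ge0// => k _; rewrite sqr_ge0.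
have A0 : 0 <= A by rewrite sumr_ge0// => k _; rewrite sqr_ge0.
have B0 : 0 <= B by rewrite sumr_ge0// => k _; rewrite sqr_ge0.
have [A00|A00] := eqVneq A 0.
  have [B00|B00] := eqVneq B 0.
    by have := H 1 1; have := H 1 (-1); rewrite A00 B00 => ? ?; have -> : C = 0 by lra.
  have := H B C; rewrite A00 mulr0 add0r mul0r.
  have -> : C ^+ 2 * B - 2 * B * C * C = - (B * C ^+ 2) by ring.
  by rewrite oppr_ge0 pmulr_rle0// lt_neqAle eq_sym B00.
have := H C A.
have -> : C ^+ 2 * A + A ^+ 2 * B - 2 * C * A * C = A * (A * B - C ^+ 2) by ring.
by rewrite pmulr_rge0 ?subr_ge0// lt_neqAle eq_sym A00.
Qed.

End Seqs.

(** All sums over frequencies run over these squares, so that no summability has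
    to be discussed. *)
Definition box (K : nat) : seq (int * int) :=
  [seq (i%:Z - K%:Z, j%:Z - K%:Z) | i <- iota 0 K.*2.+1, j <- iota 0 K.*2.+1].

Lemma mem_box K k : (k \in box K) = (absz k.1 <= K)%N && (absz k.2 <= K)%N.
Proof.
case: k => a b /=; apply/allpairsP/idP => [[[i j] /= [+ + [-> ->]]]|/andP[ha hb]].
  by rewrite !in_cons !mem_iota; lia.
by exists (absz (a + K%:Z), absz (b + K%:Z)) => /=; rewrite !in_cons !mem_iota; split; [lia|lia|];
  congr pair; lia.
Qed.

Lemma box_uniq K : uniq (box K).
Proof.
apply: allpairs_uniq; [exact: iota_uniq|exact: iota_uniq|].
by move=> [a b] [c d] _ _ /= [h1 h2]; congr pair; lia.
Qed.

Lemma box_sub K L : (K <= L)%N -> {subset box K <= box L}.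
Proof. by move=> KL k; rewrite !mem_box; lia. Qed.

Lemma box_opp (R : realType) K (F : int * int -> R) :
  \sum_(k <- box K) F (- k) = \sum_(k <- box K) F k.
Proof.
rewrite -(big_map (fun k : int * int => - k) predT F); apply: perm_big.
apply: uniq_perm; [|exact: box_uniq|].
  by rewrite map_inj_uniq ?box_uniq//; exact: oppr_inj.
move=> k; apply/mapP/idP => [[l lb ->]|kb].
  by move: lb; rewrite !mem_box/=; lia.
by exists (- k); rewrite ?opprK//; move: kb; rewrite !mem_box/=; lia.
Qed.

(** * Trigonometric coefficients and polynomials *)

Section Trig.
Context {R : realType}.
Local Notation X := (R * R)%type.
Local Notation Z2 := (int * int)%type.
Implicit Types (f g : X -> R) (k l : Z2).

Definition cs k (x : X) : R := cos (phase k x).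
Definition sn k (x : X) : R := sin (phase k x).

Lemma ct_cs k : continuous (cs k). Proof. by rewrite /cs; ct. Qed.
Lemma ct_sn k : continuous (sn k). Proof. by rewrite /sn; ct. Qed.

Lemma phaseD k l x : phase (k + l) x = phase k x + phase l x :> R.
Proof. by rewrite /phase/= !intrD; ring. Qed.
Lemma phaseN k x : phase (- k) x = - phase k x :> R.
Proof. by rewrite /phase/= !intrN; ring. Qed.
Lemma csN k x : cs (- k) x = cs k x. Proof. by rewrite /cs phaseN cosN. Qed.
Lemma snN k x : sn (- k) x = - sn k x. Proof. by rewrite /sn phaseN sinN. Qed.

Lemma cs_le1 k x : `|cs k x| <= 1. Proof. exact: cos_max. Qed.
Lemma sn_le1 k x : `|sn k x| <= 1. Proof. exact: sin_max. Qed.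

Lemma periodic_int (u : R -> R) (T : R) : (forall a, u (a + T) = u a) ->
  forall (m : int) a, u (a + m%:~R * T) = u a.
Proof.
move=> uT; have H (n : nat) a : u (a + n%:R * T) = u a.
  elim: n a => [|n IH] a; first by rewrite mul0r addr0.
  by rewrite -natr1 mulrDl mul1r addrA uT IH.
case=> n a; first exact: H.
by rewrite -(H n.+1) NegzE intrN mulNr subrK.
Qed.

Lemma cs_periodic k : periodic2 (cs k).
Proof.
move=> x; rewrite /cs /phase/=; split.
  rewrite mulrDr addrAC; apply: periodic_int; exact: cosD2pi.
rewrite mulrDr addrA; apply: periodic_int; exact: cosD2pi.
Qed.

Lemma sn_periodic k : periodic2 (sn k).
Proof.
move=> x; rewrite /sn /phase/=; split.
  rewrite mulrDr addrAC; apply: periodic_int; exact: sinD2pi.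
rewrite mulrDr addrA; apply: periodic_int; exact: sinD2pi.
Qed.

Lemma is_derive_cs1 k (x : X) :
  is_derive x.1 1 (fun y : R => cs k (y, x.2)) (- k.1%:~R * sn k x).
Proof.
rewrite /cs /sn /phase/=; apply: is_derive_eq.
by rewrite /GRing.scale/=; ring.
Qed.
Lemma is_derive_cs2 k (x : X) :
  is_derive x.2 1 (fun y : R => cs k (x.1, y)) (- k.2%:~R * sn k x).
Proof.
rewrite /cs /sn /phase/=; apply: is_derive_eq.
by rewrite /GRing.scale/=; ring.
Qed.
Lemma is_derive_sn1 k (x : X) :
  is_derive x.1 1 (fun y : R => sn k (y, x.2)) (k.1%:~R * cs k x).
Proof.
rewrite /cs /sn /phase/=; apply: is_derive_eq.
by rewrite /GRing.scale/=; ring.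
Qed.
Lemma is_derive_sn2 k (x : X) :
  is_derive x.2 1 (fun y : R => sn k (x.1, y)) (k.2%:~R * cs k x).
Proof.
rewrite /cs /sn /phase/=; apply: is_derive_eq.
by rewrite /GRing.scale/=; ring.
Qed.

Lemma mean_cs k : mean (cs k) = (k == 0)%:R.
Proof.
have [->|k0] := eqVneq k 0.
  rewrite (_ : cs 0 = fun=> 1) ?mean_cst//; apply/funext => x.
  by rewrite /cs /phase/= !mul0r addr0 cos0.
case: (eqVneq k.1 0) k0 => [k1|k1 _].
  case: (eqVneq k.2 0) => [k2|k2 _].
    by case: k k1 k2 => a b /= -> ->; rewrite eqxx.
  have : mean (fun x => k.2%:~R * cs k x) = 0 :> R.
    apply: (mean_derive2 (f := sn k)); [by move=> x; have [] := sn_periodic k x|exact: is_derive_sn2|].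
    by apply: ctM; [exact: ctC|exact: ct_cs].
  by rewrite meanZ; [move/eqP; rewrite mulf_eq0 intr_eq0 (negPf k2) => /eqP|exact: ct_cs].
have : mean (fun x => k.1%:~R * cs k x) = 0 :> R.
  apply: (mean_derive1 (f := sn k)); [by move=> x; have [] := sn_periodic k x|exact: is_derive_sn1|].
  by apply: ctM; [exact: ctC|exact: ct_cs].
by rewrite meanZ; [move/eqP; rewrite mulf_eq0 intr_eq0 (negPf k1) => /eqP|exact: ct_cs].
Qed.

Lemma mean_sn k : mean (sn k) = 0 :> R.
Proof.
have [->|k0] := eqVneq k 0.
  rewrite (_ : sn 0 = fun=> 0) ?mean_cst//; apply/funext => x.
  by rewrite /sn /phase/= !mul0r addr0 sin0.
case: (eqVneq k.1 0) k0 => [k1|k1 _].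
  case: (eqVneq k.2 0) => [k2|k2 _].
    by case: k k1 k2 => a b /= -> ->; rewrite eqxx.
  have : mean (fun x => - k.2%:~R * sn k x) = 0 :> R.
    apply: (mean_derive2 (f := cs k)); [by move=> x; have [] := cs_periodic k x|exact: is_derive_cs2|].
    by apply: ctM; [exact: ctC|exact: ct_sn].
  by rewrite meanZ; [move/eqP; rewrite mulf_eq0 oppr_eq0 intr_eq0 (negPf k2) => /eqP|exact: ct_sn].
have : mean (fun x => - k.1%:~R * sn k x) = 0 :> R.
  apply: (mean_derive1 (f := cs k)); [by move=> x; have [] := cs_periodic k x|exact: is_derive_cs1|].
  by apply: ctM; [exact: ctC|exact: ct_sn].
by rewrite meanZ; [move/eqP; rewrite mulf_eq0 oppr_eq0 intr_eq0 (negPf k1) => /eqP|exact: ct_sn].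
Qed.

(** [al f k - i be f k] is the Fourier coefficient at [k]. Real coefficients are
    used because the solution of interest has no sines. *)
Definition al f k : R := mean (fun x => f x * cs k x).
Definition be f k : R := mean (fun x => f x * sn k x).

Lemma fourier_coefE f k : fourier_coef f k = Complex (al f k) (- be f k).
Proof. by []. Qed.

Lemma alN f k : al f (- k) = al f k.
Proof. by congr mean; apply/funext => x; rewrite csN. Qed.
Lemma beN f k : continuous f -> be f (- k) = - be f k.
Proof.
move=> cf; rewrite /be -meanN; last by apply: ctM => //; exact: ct_sn.
by congr mean; apply/funext => x; rewrite snN mulrN.
Qed.

Lemma al_cs l k : al (cs l) k = 2^-1 * ((k == l)%:R + (k == - l)%:R).
Proof.
rewrite /al (_ : (fun x => _) = fun x => 2^-1 * (cs (k - l) x + cs (k + l) x)).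
  rewrite meanZ ?meanD; [|exact: ct_cs|exact: ct_cs|by apply: ctD; exact: ct_cs].
  by rewrite !mean_cs subr_eq0 addr_eq0.
by apply/funext => x; rewrite /cs phaseD phaseD phaseN cosB cosD; field.
Qed.
Lemma be_sn l k : be (sn l) k = 2^-1 * ((k == l)%:R - (k == - l)%:R).
Proof.
rewrite /be (_ : (fun x => _) = fun x => 2^-1 * (cs (k - l) x - cs (k + l) x)).
  rewrite meanZ ?meanB; [|exact: ct_cs|exact: ct_cs|].
    by rewrite !mean_cs subr_eq0 addr_eq0.
  by apply: ctD; [|apply: ctN]; exact: ct_cs.
by apply/funext => x; rewrite /cs /sn phaseD phaseD phaseN cosB cosD; field.
Qed.
Lemma al_sn l k : al (sn l) k = 0.
Proof.
rewrite /al (_ : (fun x => _) = fun x => 2^-1 * (sn (l - k) x + sn (k + l) x)).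
  rewrite meanZ ?meanD; [|exact: ct_sn|exact: ct_sn|by apply: ctD; exact: ct_sn].
  by rewrite !mean_sn addr0 mulr0.
by apply/funext => x; rewrite /cs /sn phaseD phaseD phaseN sinB sinD; field.
Qed.
Lemma be_cs l k : be (cs l) k = 0.
Proof.
rewrite /be (_ : (fun x => _) = fun x => 2^-1 * (sn (k - l) x + sn (k + l) x)).
  rewrite meanZ ?meanD; [|exact: ct_sn|exact: ct_sn|by apply: ctD; exact: ct_sn].
  by rewrite !mean_sn addr0 mulr0.
by apply/funext => x; rewrite /cs /sn phaseD phaseD phaseN sinB sinD; field.
Qed.

Definition trigp (s : seq Z2) (a b : Z2 -> R) (x : X) : R :=
  \sum_(k <- s) (a k * cs k x + b k * sn k x).

Lemma ct_trigp s a b : continuous (trigp s a b).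
Proof.
rewrite /trigp; apply: ct_sum => k; apply: ctD; apply: ctM; try exact: ctC.
exact: ct_cs. exact: ct_sn.
Qed.

Lemma trigp_periodic s a b : periodic2 (trigp s a b).
Proof.
by move=> x; split; apply: eq_bigr => k _;
  have [c1 c2] := cs_periodic k x; have [s1 s2] := sn_periodic k x;
  rewrite ?c1 ?c2 ?s1 ?s2.
Qed.

Lemma mean_trigp_mul s a b g : continuous g ->
  mean (fun x => g x * trigp s a b x) = \sum_(k <- s) (a k * al g k + b k * be g k).
Proof.
move=> cg; rewrite (_ : (fun x => _) =
   fun x => \sum_(k <- s) (a k * (g x * cs k x) + b k * (g x * sn k x))).
  have cc k : continuous (fun x => g x * cs k x) by apply: ctM => //; exact: ct_cs.
  have cn k : continuous (fun x => g x * sn k x) by apply: ctM => //; exact: ct_sn.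
  rewrite (mean_sum _ _).1; last by move=> k; apply: ctD; apply: ctM => //; exact: ctC.
  apply: eq_bigr => k _; rewrite meanD ?meanZ//; by apply: ctM => //; exact: ctC.
apply/funext => x; rewrite mulr_sumr; apply: eq_bigr => k _; ring.
Qed.

Lemma sum_box_delta K (F : Z2 -> R) k : k \in box K ->
  \sum_(l <- box K) F l * (l == k)%:R = F k.
Proof.
move=> kb; rewrite (bigD1_seq k) ?box_uniq//= eqxx mulr1 big1 ?addr0// => l lk.
by rewrite (negPf lk) mulr0.
Qed.

Lemma mem_boxN K k : (- k \in box K) = (k \in box K).
Proof. by rewrite !mem_box/=; lia. Qed.

(** The coefficient is shared by [k] and [- k], which carry the same cosine;
    whence the parity assumption. *)
Lemma al_trigp K a b k : (forall k, a (- k) = a k) -> k \in box K ->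
  al (trigp (box K) a b) k = a k.
Proof.
move=> aN kb; rewrite /al (_ : (fun x => _) = fun x => cs k x * trigp (box K) a b x); last first.
  by apply/funext => x; rewrite mulrC.
rewrite mean_trigp_mul; last exact: ct_cs.
under eq_bigr => l _ do rewrite al_cs be_cs mulr0 addr0 mulrCA mulrDr mulrDr.
rewrite big_split/= -!mulr_sumr !sum_box_delta ?mem_boxN// aN; by field.
Qed.

Lemma be_trigp K a b k : (forall k, b (- k) = - b k) -> k \in box K ->
  be (trigp (box K) a b) k = b k.
Proof.
move=> bN kb; rewrite /be (_ : (fun x => _) = fun x => sn k x * trigp (box K) a b x); last first.
  by apply/funext => x; rewrite mulrC.
rewrite mean_trigp_mul; last exact: ct_sn.
under eq_bigr => l _ do rewrite al_sn be_sn mulr0 add0r mulrCA mulrBr mulrBr.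
rewrite sumrB -!mulr_sumr !sum_box_delta ?mem_boxN// bN; by field.
Qed.

End Trig.

Ltac ct_leaf ::= first [ct_hyp
  | lazymatch goal with
    | |- cont (fun x => cs ?k x) => exact: ct_cs
    | |- cont (fun x => sn ?k x) => exact: ct_sn
    | |- cont (cs ?k) => exact: ct_cs
    | |- cont (sn ?k) => exact: ct_sn
    | |- cont (trigp ?s ?a ?b) => exact: ct_trigp
    | |- cont (fun x => trigp ?s ?a ?b x) => exact: ct_trigp
    end].

(** * Uniqueness of Fourier coefficients *)

Section Uniq.
Context {R : realType}.
Local Notation X := (R * R)%type.
Local Notation Z2 := (int * int)%type.
Implicit Types (f g : X -> R) (k l : Z2).

Definition cper f := periodic2 f /\ continuous f.

Lemma continuous_ball f (x : X) (e : R) : continuous f -> 0 < e ->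
  exists2 d : R, 0 < d & forall y : X, `|y.1 - x.1| < d -> `|y.2 - x.2| < d ->
    `|f y - f x| < e.
Proof.
move=> cf e0; have /cvgrPdist_lt/(_ _ e0)/nbhs_ballP[d /= d0 H] := cf x.
exists d => // y y1 y2; rewrite distrC; apply: H.
by rewrite /ball/= /prod_ball/= /ball/=; split; rewrite distrC.
Qed.

Lemma periodic_reduce f (x : X) : periodic2 f ->
  exists2 y : X, f y = f x &
    [/\ 0 <= y.1, y.1 < pi *+ 2, 0 <= y.2 & y.2 < pi *+ 2].
Proof.
move=> pf; pose T : R := pi *+ 2.
have T0 : 0 < T := twopi_gt0.
have red (a : R) : exists m : int, 0 <= a + m%:~R * T < T.
  exists (- Num.floor (a / T)); rewrite intrN mulNr.
  have /andP[h1 h2] := real_floor_itv (num_real (a / T)).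
  rewrite intrD mulr1z in h2; set z := _%:~R in h1 h2 *.
  have {1 2}-> : a = a / T * T by rewrite divfK// gt_eqF.
  rewrite -mulrBl mulr_ge0 ?subr_ge0 ?(ltW T0)//= gtr_pMl//.
  by rewrite ltrBlDr addrC.
have [m /andP[m1 m2]] := red x.1; have [n /andP[n1 n2]] := red x.2.
exists (x.1 + m%:~R * T, x.2 + n%:~R * T) => //=.
rewrite (@periodic_int _ (fun z => f (z, x.2 + n%:~R * T))).
  rewrite (@periodic_int _ (fun z => f (x.1, z))); first by case: x {m1 m2 n1 n2}.
  by move=> a; have [_] := pf (x.1, a).
by move=> a; have [+ _] := pf (a, x.2 + n%:~R * T).
Qed.

Lemma cper_bounded f : cper f -> exists2 M : R, 0 <= M & forall x, `|f x| <= M.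
Proof.
move=> [pf cf]; have [M M0 HM] := continuous_cell_bounded cf.
exists M => // x; have [y <- [a b c d]] := periodic_reduce x pf.
by apply: HM; split; rewrite /= in_itv/= ?a ?c ltW.
Qed.

Section zero_coefs.
Variable f : X -> R.
Hypotheses (pf : periodic2 f) (cf : continuous f).
Hypotheses (a0 : forall k, al f k = 0) (b0 : forall k, be f k = 0).

(** The products [f h] orthogonal to all the modes: the class of such [h]
    contains 1 and all that is needed to build the peaking polynomial [P] below. *)
Let orth (h : X -> R) := continuous h /\ forall k,
  mean (fun x => f x * h x * cs k x) = 0 /\ mean (fun x => f x * h x * sn k x) = 0.

Let orth1 : orth (fun=> 1).
Proof.
split; first exact: ctC.
by move=> k; split; [rewrite -[RHS](a0 k)|rewrite -[RHS](b0 k)]; congr mean;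
  apply/funext => x; rewrite mulr1.
Qed.

Let orthD h1 h2 : orth h1 -> orth h2 -> orth (fun x => h1 x + h2 x).
Proof.
move=> [c1 o1] [c2 o2]; split; first exact: ctD.
move=> k; have [p1 q1] := o1 k; have [p2 q2] := o2 k; split.
  rewrite (_ : (fun x => _) = (fun x => f x * h1 x * cs k x + f x * h2 x * cs k x)).
    by rewrite meanD ?p1 ?p2 ?addr0//; ct.
  by apply/funext => x; ring.
rewrite (_ : (fun x => _) = (fun x => f x * h1 x * sn k x + f x * h2 x * sn k x)).
  by rewrite meanD ?q1 ?q2 ?addr0//; ct.
by apply/funext => x; ring.
Qed.

Let orthZ r h : orth h -> orth (fun x => r * h x).
Proof.
move=> [c1 o1]; split; first by ct.
move=> k; have [p1 q1] := o1 k; split.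
  rewrite (_ : (fun x => _) = (fun x => r * (f x * h x * cs k x))).
    by rewrite meanZ ?p1 ?mulr0//; ct.
  by apply/funext => x; ring.
rewrite (_ : (fun x => _) = (fun x => r * (f x * h x * sn k x))).
  by rewrite meanZ ?q1 ?mulr0//; ct.
by apply/funext => x; ring.
Qed.

Let orth_cs l h : orth h -> orth (fun x => h x * cs l x).
Proof.
move=> [c1 o1]; split; first by ct.
move=> k; have [p1 q1] := o1 (k + l); have [p2 q2] := o1 (k - l); split.
  rewrite (_ : (fun x => _) = (fun x => 2^-1 * (f x * h x * cs (k + l) x + f x * h x * cs (k - l) x))).
    rewrite meanZ ?meanD ?p1 ?p2 ?addr0 ?mulr0//; ct.
  by apply/funext => x; rewrite /cs !phaseD !phaseN cosB cosD; field.
rewrite (_ : (fun x => _) = (fun x => 2^-1 * (f x * h x * sn (k + l) x + f x * h x * sn (k - l) x))).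
  rewrite meanZ ?meanD ?q1 ?q2 ?addr0 ?mulr0//; ct.
by apply/funext => x; rewrite /sn /cs !phaseD !phaseN sinB sinD; field.
Qed.

Let orth_sn l h : orth h -> orth (fun x => h x * sn l x).
Proof.
move=> [c1 o1]; split; first by ct.
move=> k; have [p1 q1] := o1 (k + l); have [p2 q2] := o1 (k - l); split.
  rewrite (_ : (fun x => _) = (fun x => 2^-1 * (f x * h x * sn (k + l) x - f x * h x * sn (k - l) x))).
    rewrite meanZ ?meanB ?q1 ?q2 ?subr0 ?mulr0//; ct.
  by apply/funext => x; rewrite /cs /sn !phaseD !phaseN sinB sinD; field.
rewrite (_ : (fun x => _) = (fun x => 2^-1 * (f x * h x * cs (k - l) x - f x * h x * cs (k + l) x))).
  rewrite meanZ ?meanB ?p1 ?p2 ?subr0 ?mulr0//; ct.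
by apply/funext => x; rewrite /sn /cs !phaseD !phaseN cosB cosD; field.
Qed.

Let orth_cosB (h : X -> R) (y : X) : orth h ->
  orth (fun x => h x * (cos (x.1 - y.1) + cos (x.2 - y.2))).
Proof.
move=> oh.
rewrite (_ : (fun x => _) = fun x =>
  (cos y.1 * (h x * cs (1, 0) x) + sin y.1 * (h x * sn (1, 0) x)) +
  (cos y.2 * (h x * cs (0, 1) x) + sin y.2 * (h x * sn (0, 1) x))).
  by apply: orthD; apply: orthD; apply: orthZ; do ?[exact: orth_cs|exact: orth_sn].
apply/funext => x; rewrite !cosB /cs /sn /phase/= !mul0r !mul1r addr0 add0r; ring.
Qed.

Lemma cos_le_far (r u : R) : 0 < r -> r <= pi -> r <= `|u| -> `|u| <= pi *+ 2 - r ->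
  cos u <= cos r.
Proof.
move=> r0 rp ru u2; rewrite -(cos_norm u); set v := `|u| in ru u2 *.
have H (w : R) : r <= w -> w <= pi -> cos w <= cos r.
  move=> rw wp; rewrite le_eqVlt; have [->|wr] := eqVneq w r; first by rewrite eqxx.
  apply/orP; right; rewrite ltr_cos ?in_itv/=; first by rewrite lt_neqAle eq_sym wr.
    by apply/andP; split => //; lra.
  by apply/andP; split => //; lra.
have [vp|vp] := leP v pi; first exact: H.
rewrite -cosN -(cosD2pi (- v)); apply: H; move: vp u2; rewrite !mulr2n; lra.
Qed.

(** If [f] were positive at a point, it would be at least [c > 0] on a square
    near it. The trigonometric polynomial [P] is larger than 1 near the center
    of the square and has values in [0, 1] outside of the square, so [mean (f
    P^n)] would be positive for large [n]. But [f] is orthogonal to [P^n]. *)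
Lemma zero_coefs_le x0 : f x0 <= 0.
Proof.
have [x1 <- [h1 h2 h3 h4]] := periodic_reduce x0 pf.
rewrite leNgt; apply/negP => fx0.
pose T : R := pi *+ 2.
have T0 : 0 < T := twopi_gt0.
have T1 : pi <= T by rewrite /T mulr2n lerDl pi_ge0.
pose c := f x1 / 2.
have c0 : 0 < c by rewrite divr_gt0.
have [d d0 Hd] := continuous_ball x1 cf c0.
pose eta := Num.min (Num.min (d / 2) 1) (Num.min ((T - x1.1) / 2) ((T - x1.2) / 2)).
have eta0 : 0 < eta by rewrite /eta !lt_min; rewrite -/T in h2 h4; lra.
have : eta <= eta by [].
rewrite {2}/eta !le_min -!andbA => /and4P[e1 e2 e3 e4].
(* The center [y] is moved off [x1] so that the square of radius [r] around it
   lies inside the period cell. *)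
pose y : X := (x1.1 + eta, x1.2 + eta).
pose r := eta / 2.
have r0 : 0 < r by rewrite /r; lra.
have rpi : r < pi by have := pi_ge2 R; rewrite /r; lra.
have fin x : `|x.1 - y.1| <= r -> `|x.2 - y.2| <= r -> c <= f x.
  rewrite /y /r/= !ler_norml => /andP[u1 u2] /andP[u3 u4].
  have : `|f x - f x1| < c by apply: Hd; rewrite ltr_norml; lra.
  by rewrite ltr_norml /c => /andP[]; lra.
pose kap := 1 - cos r.
have kap0 : 0 < kap.
  rewrite subr_gt0 -cos0 ltr_cos ?in_itv/= ?lexx ?pi_ge0// ?(ltW r0) ?(ltW rpi)//.
have [r' r'0 Hr'] : exists2 r' : R, 0 < r' <= r & forall u : R, `|u| <= r' -> 1 - cos u <= kap / 8.
  have k8 : 0 < kap / 8 by rewrite divr_gt0.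
  have /cvgrPdist_le/(_ _ k8)/nbhs_ballP[q /= q0 H] := @continuous_cos R 0.
  exists (Num.min (q / 2) r); first by rewrite lt_min ge_min lexx orbT r0 !andbT divr_gt0.
  move=> u; rewrite le_min => /andP[uq _].
  have := H u; rewrite /ball/= sub0r normrN cos0.
  by move=> /(_ (le_lt_trans uq _)) h; rewrite (le_trans (ler_norm _))// h//; lra.
case/andP: r'0 => r'0 r'r.
pose P (x : X) : R := (2^-1 + kap / 8) + 4^-1 * (cos (x.1 - y.1) + cos (x.2 - y.2)).
have cP : continuous P by rewrite /P; ct.
have P0 x : 0 <= P x.
  by have := cos_geN1 (x.1 - y.1); have := cos_geN1 (x.2 - y.2); rewrite /P; lra.
have Pout x : torus_cell x -> ~ (`|x.1 - y.1| <= r /\ `|x.2 - y.2| <= r) -> P x <= 1.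
  move=> [/=]; rewrite !in_itv/= => /andP[u1 u2] /andP[u3 u4] nin.
  have C1 := cos_le1 (x.1 - y.1); have C2 := cos_le1 (x.2 - y.2).
  suff : cos (x.1 - y.1) <= cos r \/ cos (x.2 - y.2) <= cos r.
    by rewrite /P /kap => -[]; rewrite /kap in kap0; lra.
  have [v1|v1] := leP `|x.1 - y.1| r; [right|left]; apply: cos_le_far => //; try exact: ltW.
  - have [//|v2] := leP r `|x.2 - y.2|.
    by exfalso; apply: nin; split => //; exact: ltW.
  - by rewrite -/T ler_norml /y/= /r; rewrite -/T in u2 u4; apply/andP; split; lra.
  - by rewrite -/T ler_norml /y/= /r; rewrite -/T in u2 u4; apply/andP; split; lra.
have Pin x : `|x.1 - y.1| <= r' -> `|x.2 - y.2| <= r' -> 1 + kap / 16 <= P x.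
  by move=> /Hr' u1 /Hr' u2; rewrite /P; lra.
have oP n : orth (fun x => P x ^+ n).
  elim: n => [|n IH]; first exact: orth1.
  rewrite (_ : (fun x => _) = fun x => (2^-1 + kap / 8) * P x ^+ n +
     4^-1 * (P x ^+ n * (cos (x.1 - y.1) + cos (x.2 - y.2)))).
    by apply: orthD; apply: orthZ => //; exact: orth_cosB.
  by apply/funext => x; rewrite exprS {1}/P; ring.
have mP n : mean (fun x => f x * P x ^+ n) = 0.
  have [_ /(_ 0)[+ _]] := oP n; congr (mean _ = _); apply/funext => x.
  by rewrite /cs /phase/= !mul0r addr0 cos0 mulr1.
have [M M0 HM] := continuous_cell_bounded cf.
have key n : c * (1 + kap / 16) ^+ n * (T ^+ 2)^-1 * (2 * r') ^+ 2 <= M.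
  have <- : mean (fun x => f x * P x ^+ n + M) = M.
    by rewrite meanD ?mP ?mean_cst ?add0r//; ct.
  apply: (@mean_box_ge _ _ _ _ y) => //.
  - by ct.
  - by rewrite mulr_ge0 ?exprn_ge0//; lra.
  - by rewrite /y/=; rewrite /r in r'r; lra.
  - by rewrite -/T /y/=; rewrite /r in r'r; lra.
  - by rewrite /y/=; rewrite /r in r'r; lra.
  - by rewrite -/T /y/=; rewrite /r in r'r; lra.
  - move=> x xc.
    have [[in1 in2]|nin] := pselect (`|x.1 - y.1| <= r /\ `|x.2 - y.2| <= r).
      by rewrite addr_ge0// mulr_ge0 ?exprn_ge0// (le_trans (ltW c0))// fin.
    have : `|f x * P x ^+ n| <= M.
      rewrite normrM (ger0_norm (exprn_ge0 _ (P0 x))) -[leRHS]mulr1.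
      by rewrite ler_pM ?exprn_ge0// ?HM// exprn_ile1// Pout.
    by rewrite ler_norml => /andP[]; lra.
  - move=> x u1 u2; rewrite -[leLHS]addr0 lerD// ler_pM//.
    + exact: ltW.
    + by rewrite exprn_ge0//; lra.
    + by apply: fin; exact: le_trans r'r.
    + by rewrite lerXn2r ?nnegrE ?Pin//; lra.
pose D := c * (T ^+ 2)^-1 * (2 * r') ^+ 2.
have D0 : 0 < D by rewrite /D !mulr_gt0// ?invr_gt0 ?exprn_gt0//; lra.
have [n Hn] : exists n : nat, M / D / (kap / 16) < n%:R.
  by exists (Num.bound (M / D / (kap / 16))); rewrite archi_boundP// !divr_ge0// ltW.
have := key n; rewrite leNgt => /negP; apply.
(* Bernoulli's inequality. *)
have bern : 1 + n%:R * (kap / 16) <= (1 + kap / 16) ^+ n.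
  elim: (n) => [|m IH]; first by rewrite mul0r addr0 expr0.
  rewrite exprS (le_trans _ (ler_wpM2l _ IH))//; last by lra.
  have : 0 <= m%:R * (kap / 16) * (kap / 16) by rewrite !mulr_ge0//; lra.
  by rewrite -natr1; lra.
have -> : c * (1 + kap / 16) ^+ n / T ^+ 2 * (2 * r') ^+ 2 = D * (1 + kap / 16) ^+ n.
  by rewrite /D; ring.
rewrite -ltr_pdivrMl// mulrC (lt_le_trans _ bern)//.
by rewrite ltr_pdivrMr// in Hn; [lra|lra].
Qed.

End zero_coefs.

Theorem fourier_uniq f : cper f -> (forall k, al f k = 0) -> (forall k, be f k = 0) ->
  forall x, f x = 0.
Proof.
move=> [pf cf] a0 b0 x; apply/eqP; rewrite eq_le zero_coefs_le//=.
rewrite -oppr_le0; apply: (@zero_coefs_le (fun x => - f x)).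
- by move=> z; have [-> ->] := pf z.
- exact: ctN.
- move=> k; rewrite -[RHS]oppr0 -[in RHS](a0 k) /al -meanN; last by ct.
  by congr mean; apply/funext => z; rewrite mulNr.
- move=> k; rewrite -[RHS]oppr0 -[in RHS](b0 k) /be -meanN; last by ct.
  by congr mean; apply/funext => z; rewrite mulNr.
Qed.

End Uniq.

(** * Uniform limits with rates *)

Section UnifLim.
Context {R : realType}.

Lemma ler_norm_add (a b u v : R) : `|a - b| <= u -> `|b| <= v -> `|a| <= v + u.
Proof. by move=> h1 h2; have := ler_normD (a - b) b; rewrite subrK; lra. Qed.

Lemma seq_cvg_rate (u : nat -> R) (e : nat -> R) : e @ \oo --> 0 ->
  (forall m n, (n <= m)%N -> `|u m - u n| <= e n) ->
  cvg (u @ \oo) /\ forall n, `|lim (u @ \oo) - u n| <= e n.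
Proof.
move=> e0 ue.
have cu : cvg (u @ \oo).
  apply/cauchy_cvgP/cauchy_exP => eps eps0.
  have /cvgrPdist_lt/(_ _ eps0)[N _ HN] := e0.
  exists (u N); exists N => //= n /= Nn; rewrite /ball/= distrC.
  apply: le_lt_trans (ue _ _ Nn) _.
  by have := HN N (leqnn _); rewrite sub0r normrN; apply: le_lt_trans; exact: ler_norm.
split=> // n; have : (fun m => `|u m - u n|) @ \oo --> `|lim (u @ \oo) - u n|.
  by apply: cvg_norm; apply: cvgB => //; exact: cvg_cst.
move=> /cvgr_to_le; apply; exists n => // m /= nm; exact: ue.
Qed.

Lemma unif_lim_continuous {T : topologicalType} (F : nat -> T -> R) (g : T -> R)
    (e : nat -> R) : e @ \oo --> 0 -> (forall n, continuous (F n)) ->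
  (forall n x, `|g x - F n x| <= e n) -> continuous g.
Proof.
move=> e0 cF gF x; apply/cvgrPdist_lt => eps eps0.
have eps3 : 0 < eps / 3 by rewrite divr_gt0.
have /cvgrPdist_lt/(_ _ eps3)[N _ /(_ N (leqnn _))] := e0.
rewrite sub0r normrN => /(le_lt_trans (ler_norm _)) eN.
have /cvgrPdist_lt/(_ _ eps3) := cF N x.
apply: filterS => y FNxy.
have g1 := gF N x; have g2 := gF N y.
have -> : g x - g y = (g x - F N x) + (F N x - F N y) - (g y - F N y) by ring.
rewrite (le_lt_trans (ler_normB _ _))//.
have := ler_normD (g x - F N x) (F N x - F N y); lra.
Qed.

Lemma cvg_inv_sqr (L : R) : (fun n : nat => L / n.+1%:R ^+ 2) @ \oo --> 0.
Proof.
rewrite -[X in _ --> X](mulr0 L); apply: cvgM; first exact: cvg_cst.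
have H := @cvg_harmonic R.
have -> : (fun n : nat => (n.+1%:R ^+ 2)^-1 : R) = fun n => harmonic n * harmonic n.
  by apply/funext => n; rewrite /harmonic/= expr2 invfM.
by rewrite -[X in _ --> X](mulr0 0); apply: cvgM.
Qed.
End UnifLim.

(** * Fourier inversion, Parseval and Bessel *)

Section Inversion.
Context {R : realType}.
Local Notation X := (R * R)%type.
Local Notation Z2 := (int * int)%type.
Implicit Types (f g : X -> R) (k l : Z2).

(** The weight in [Hs_norm]. *)
Definition sq k : R := 1 + sqnormk k.

Lemma sqnormk_ge0 k : 0 <= sqnormk k :> R.
Proof. by rewrite addr_ge0// sqr_ge0. Qed.
Lemma sq_ge1 k : 1 <= sq k. Proof. by rewrite lerDl sqnormk_ge0. Qed.
Lemma sq_gt0 k : 0 < sq k. Proof. by rewrite (lt_le_trans ltr01)// sq_ge1. Qed.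
Lemma sqN k : sq (- k) = sq k.
Proof. by rewrite /sq /sqnormk/= !intrN !sqrrN. Qed.

Lemma sq_out K k : k \notin box K -> K.+1%:R ^+ 2 <= sq k.
Proof.
have H (a b : int) : (K < absz a)%N -> (K.+1%:R : R) ^+ 2 <= 1 + (a%:~R ^+ 2 + b%:~R ^+ 2).
  move=> Ka; have : (K.+1%:R : R) ^+ 2 <= a%:~R ^+ 2.
    rewrite -[leRHS]real_normK ?num_real// lerXn2r ?nnegrE//.
    by rewrite -intr_norm -natr_absz ler_nat.
  by have := sqr_ge0 (b%:~R : R); lra.
rewrite mem_box negb_and -!ltnNge => /orP[h|h]; first exact: H.
by rewrite /sq /sqnormk [X in 1 + X]addrC; exact: H.
Qed.

(** Outside of [s], the sum of [G] is at most that of [H / c]. *)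
Lemma sumr_tail (T : eqType) (s t : seq T) (c L : R) (G H : T -> R) :
  uniq s -> uniq t -> {subset s <= t} -> 0 < c ->
  (forall k : T, k \notin s -> c * G k <= H k) -> (forall k : T, 0 <= H k) ->
  \sum_(k <- t) H k <= L ->
  \sum_(k <- t) G k - \sum_(k <- s) G k <= L / c.
Proof.
move=> us ut st c0 GH H0 HL; rewrite ler_pdivlMr// mulrC.
rewrite [X in X - _](perm_big _ (perm_sub_cat us ut st))/= big_cat/= addrAC subrr add0r.
apply: le_trans HL; rewrite mulr_sumr.
rewrite [leRHS](perm_big _ (perm_sub_cat us ut st))/= big_cat/=.
rewrite -[leLHS]add0r lerD ?sumr_ge0// !big_filter ler_sum//.
Qed.

(** The coefficients of a real function. *)
Definition parity (a b : Z2 -> R) :=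
  (forall k, a (- k) = a k) /\ (forall k, b (- k) = - b k).

Definition W1 (a b : Z2 -> R) (L : R) := forall K,
  \sum_(k <- box K) sq k * (`|a k| + `|b k|) <= L.

Lemma trigp_le s (a b : Z2 -> R) x :
  `|trigp s a b x| <= \sum_(k <- s) (`|a k| + `|b k|).
Proof.
rewrite (le_trans (ler_norm_sum _ _ _))// ler_sum// => k _.
rewrite (le_trans (ler_normD _ _))// !normrM.
by rewrite lerD// -[leRHS]mulr1 ler_wpM2l ?cs_le1 ?sn_le1.
Qed.

Lemma trigp_cauchy a b L K M x : W1 a b L -> (K <= M)%N ->
  `|trigp (box M) a b x - trigp (box K) a b x| <= L / K.+1%:R ^+ 2.
Proof.
move=> w KM; have u1 := box_uniq K; have u2 := box_uniq M; have sub := box_sub KM.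
apply: (@le_trans _ _ (\sum_(k <- box M) (`|a k| + `|b k|) - \sum_(k <- box K) (`|a k| + `|b k|))).
  apply: sumr_norm_diff => // k.
  rewrite (le_trans (ler_normD _ _))// !normrM.
  by rewrite lerD// -[leRHS]mulr1 ler_wpM2l ?cs_le1 ?sn_le1.
apply: sumr_tail (w M) => //.
- by move=> k kK; rewrite ler_wpM2r ?addr_ge0// sq_out.
- by move=> k; apply: mulr_ge0; [exact/ltW/sq_gt0|exact: addr_ge0].
Qed.

Definition synth (a b : Z2 -> R) (x : X) : R := lim (trigp (box K) a b x @[K --> \oo]).

Section synth_props.
Variables (a b : Z2 -> R) (L : R).
Hypotheses (pab : parity a b) (w : W1 a b L).

Lemma synth_rate K x : `|synth a b x - trigp (box K) a b x| <= L / K.+1%:R ^+ 2.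
Proof.
have [_] := seq_cvg_rate (u := fun K => trigp (box K) a b x) (cvg_inv_sqr L)
  (fun M K => @trigp_cauchy a b L K M x w).
by apply.
Qed.

Lemma synth_continuous : continuous (synth a b).
Proof.
apply: (unif_lim_continuous (cvg_inv_sqr L)); last exact: synth_rate.
by move=> n; exact: ct_trigp.
Qed.

Lemma synth_periodic : periodic2 (synth a b).
Proof.
move=> x; rewrite /synth; split;
  (rewrite (_ : (fun K => _) = fun K => trigp (box K) a b x)//; apply/funext => K);
  by have [h1 h2] := trigp_periodic (box K) a b x.
Qed.

Lemma cper_synth : cper (synth a b).
Proof. by split; [exact: synth_periodic|exact: synth_continuous]. Qed.

End synth_props.

Lemma al_norm_le f k (M : R) : continuous f -> (forall x, `|f x| <= M) -> `|al f k| <= M.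
Proof.
move=> cf fM; apply: mean_norm_le; first by ct.
by move=> x; rewrite normrM -[leRHS]mulr1 ler_pM// cs_le1.
Qed.
Lemma be_norm_le f k (M : R) : continuous f -> (forall x, `|f x| <= M) -> `|be f k| <= M.
Proof.
move=> cf fM; apply: mean_norm_le; first by ct.
by move=> x; rewrite normrM -[leRHS]mulr1 ler_pM// sn_le1.
Qed.
Lemma alB f g k : continuous f -> continuous g ->
  al (fun x => f x - g x) k = al f k - al g k.
Proof.
move=> cf cg; rewrite /al -meanB; [|by ct|by ct].
by congr mean; apply/funext => x; rewrite mulrBl.
Qed.
Lemma beB f g k : continuous f -> continuous g ->
  be (fun x => f x - g x) k = be f k - be g k.
Proof.
move=> cf cg; rewrite /be -meanB; [|by ct|by ct].
by congr mean; apply/funext => x; rewrite mulrBl.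
Qed.

Lemma cvg_le0 (e : nat -> R) (r : R) N : e @ \oo --> 0 ->
  (forall n, (N <= n)%N -> r <= e n) -> r <= 0.
Proof.
move=> e0 re; apply: (cvgr_to_ge e0); first by exists N => // n /= /re.
Qed.

(** Means pass to uniform limits, and the partial sums have the right
    coefficient as soon as the box contains [k]. *)
Lemma al_unif_trigp a b f (e : nat -> R) k : e @ \oo --> 0 -> parity a b ->
  continuous f -> (forall K x, `|f x - trigp (box K) a b x| <= e K) ->
  al f k = a k /\ be f k = b k.
Proof.
move=> e0 [pa pb] cf fe.
pose N := maxn (absz k.1) (absz k.2).
have kN n : (N <= n)%N -> k \in box n by rewrite mem_box geq_max.
have cd n : continuous (fun x => f x - trigp (box n) a b x) by ct.
split; apply/eqP; rewrite -subr_eq0 -normr_le0; apply: (cvg_le0 (N := N) e0) => n /kN kn.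
  rewrite -(al_trigp b pa kn) -alB//; last exact: ct_trigp.
  by apply: al_norm_le => // x.
rewrite -(be_trigp a pb kn) -beB//; last exact: ct_trigp.
by apply: be_norm_le => // x.
Qed.

Lemma synth_coef a b L k : parity a b -> W1 a b L ->
  al (synth a b) k = a k /\ be (synth a b) k = b k.
Proof.
move=> pab w; apply: al_unif_trigp (cvg_inv_sqr L) pab _ _.
  exact: synth_continuous w.
exact: synth_rate w.
Qed.

Lemma parity_coef f : continuous f -> parity (al f) (be f).
Proof. by move=> cf; split=> k; [exact: alN|exact: beN]. Qed.

(** The function and its Fourier series have the same coefficients, so they
    agree by [fourier_uniq]. *)
Lemma inversion_rate f L : cper f -> W1 (al f) (be f) L ->
  forall K x, `|f x - trigp (box K) (al f) (be f) x| <= L / K.+1%:R ^+ 2.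
Proof.
move=> [pf cf] w K x.
have cg := synth_continuous w; have pg := synth_periodic (al f) (be f).
suff -> : f x = synth (al f) (be f) x by exact: synth_rate.
apply/eqP; rewrite -subr_eq0; apply/eqP.
apply: (fourier_uniq (f := fun x => f x - synth (al f) (be f) x)).
- by split; [move=> z; have [-> ->] := pf z; have [-> ->] := pg z|ct].
- move=> k; rewrite alB//; have [-> _] := synth_coef k (parity_coef cf) w.
  by rewrite subrr.
- move=> k; rewrite beB//; have [_ ->] := synth_coef k (parity_coef cf) w.
  by rewrite subrr.
Qed.

(** Dominates the [k]-th mode uniformly in space. *)
Definition am f k : R := `|al f k| + `|be f k|.

Lemma am_ge0 f k : 0 <= am f k. Proof. by rewrite addr_ge0. Qed.

Lemma cvg_le_lim (e : nat -> R) (r s : R) : e @ \oo --> 0 ->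
  (forall n, r <= s + e n) -> r <= s.
Proof.
move=> e0 re; rewrite -subr_le0; apply: (cvg_le0 (N := 0%N) e0) => n _.
by rewrite lerBlDl.
Qed.

Lemma sup_le_am f (L M : R) : cper f -> W1 (al f) (be f) L ->
  (forall K, \sum_(k <- box K) am f k <= M) -> forall x, `|f x| <= M.
Proof.
move=> pf w HM x; apply: (cvg_le_lim (cvg_inv_sqr L)) => K.
exact: ler_norm_add (inversion_rate pf w K x) (le_trans (trigp_le _ _ _ x) (HM K)).
Qed.

(** The sum is the mean of [g] against the partial sum of [f]. *)
Lemma parseval f g (L M : R) K : cper f -> W1 (al f) (be f) L -> continuous g ->
  (forall x, `|g x| <= M) ->
  `|mean (fun x => g x * f x) - \sum_(k <- box K) (al f k * al g k + be f k * be g k)|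
  <= M * (L / K.+1%:R ^+ 2).
Proof.
move=> pf w cg gM; have [_ cf] := pf.
rewrite -mean_trigp_mul// -meanB; [|by ct|by ct].
apply: mean_norm_le; first by ct.
move=> x; rewrite -mulrBr normrM ler_pM// inversion_rate//.
Qed.

(** The distance of [g] to its partial sum is nonnegative in mean square. *)
Lemma bessel g K : continuous g ->
  \sum_(k <- box K) (al g k ^+ 2 + be g k ^+ 2) <= mean (fun x => g x ^+ 2).
Proof.
move=> cg; set S := \sum_(k <- _) _; set p := trigp (box K) (al g) (be g).
have [pa pb] := parity_coef cg.
have cp : continuous p by exact: ct_trigp.
have gp : mean (fun x => g x * p x) = S.
  by rewrite mean_trigp_mul//; apply: eq_bigr => k _; rewrite !expr2.
have pp : mean (fun x => p x * p x) = S.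
  rewrite mean_trigp_mul// big_seq [RHS]big_seq; apply: eq_bigr => k kb.
  by rewrite al_trigp// be_trigp// !expr2.
have : 0 <= mean (fun x => (g x - p x) ^+ 2) by apply: mean_ge0 => x; exact: sqr_ge0.
rewrite (_ : (fun x => _) = fun x => g x ^+ 2 - 2 * (g x * p x) + p x * p x); last first.
  by apply/funext => x; ring.
rewrite meanD; [|by ct|by ct]; rewrite meanB; [|by ct|by ct].
by rewrite meanZ ?gp ?pp; [lra|ct].
Qed.

(** Integration by parts: the derivative of [f cs k] has zero mean. *)
Lemma al_derive1 f df k : periodic2 f -> continuous f -> continuous df ->
  (forall x : X, is_derive x.1 1 (fun y : R => f (y, x.2)) (df x)) ->
  al df k = k.1%:~R * be f k /\ be df k = - k.1%:~R * al f k.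
Proof.
move=> pf cf cdf dd; split.
  have : mean (fun x => df x * cs k x - k.1%:~R * (f x * sn k x)) = 0.
    apply: (@mean_derive1 _ (fun x => f x * cs k x)); last by ct.
      by move=> x; have [-> _] := pf x; have [-> _] := cs_periodic k x.
    move=> x; have h1 := dd x; have h2 := is_derive_cs1 k x.
    by apply: is_derive_eq; rewrite /GRing.scale/=; case: x {h1 h2} => ? ? /=; ring.
  rewrite meanB; [|by ct|by ct].
  by rewrite meanZ; [move/eqP; rewrite subr_eq0 => /eqP|ct].
have : mean (fun x => df x * sn k x - - k.1%:~R * (f x * cs k x)) = 0.
  apply: (@mean_derive1 _ (fun x => f x * sn k x)); last by ct.
    by move=> x; have [-> _] := pf x; have [-> _] := sn_periodic k x.
  move=> x; have h1 := dd x; have h2 := is_derive_sn1 k x.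
  by apply: is_derive_eq; rewrite /GRing.scale/=; case: x {h1 h2} => ? ? /=; ring.
rewrite meanB; [|by ct|by ct].
by rewrite meanZ; [move/eqP; rewrite subr_eq0 => /eqP|ct].
Qed.

Lemma al_derive2 f df k : periodic2 f -> continuous f -> continuous df ->
  (forall x : X, is_derive x.2 1 (fun y : R => f (x.1, y)) (df x)) ->
  al df k = k.2%:~R * be f k /\ be df k = - k.2%:~R * al f k.
Proof.
move=> pf cf cdf dd; split.
  have : mean (fun x => df x * cs k x - k.2%:~R * (f x * sn k x)) = 0.
    apply: (@mean_derive2 _ (fun x => f x * cs k x)); last by ct.
      by move=> x; have [_ ->] := pf x; have [_ ->] := cs_periodic k x.
    move=> x; have h1 := dd x; have h2 := is_derive_cs2 k x.
    by apply: is_derive_eq; rewrite /GRing.scale/=; case: x {h1 h2} => ? ? /=; ring.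
  rewrite meanB; [|by ct|by ct].
  by rewrite meanZ; [move/eqP; rewrite subr_eq0 => /eqP|ct].
have : mean (fun x => df x * sn k x - - k.2%:~R * (f x * cs k x)) = 0.
  apply: (@mean_derive2 _ (fun x => f x * sn k x)); last by ct.
    by move=> x; have [_ ->] := pf x; have [_ ->] := sn_periodic k x.
  move=> x; have h1 := dd x; have h2 := is_derive_sn2 k x.
  by apply: is_derive_eq; rewrite /GRing.scale/=; case: x {h1 h2} => ? ? /=; ring.
rewrite meanB; [|by ct|by ct].
by rewrite meanZ; [move/eqP; rewrite subr_eq0 => /eqP|ct].
Qed.

End Inversion.

(** * Derivatives and weighted sums of coefficients *)

Section C1fun.
Context {R : realType}.
Local Notation X := (R * R)%type.
Local Notation Z2 := (int * int)%type.
Implicit Types (f g : X -> R) (k l : Z2).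

Definition C1per f := periodic2 f /\ C1 f.

Lemma C1per_cper f : C1per f -> cper f.
Proof. by case=> pf [cf _ _ _ _]; split. Qed.

Lemma is_derive_partial1 f (x : X) : C1 f ->
  is_derive x.1 1 (fun y : R => f (y, x.2)) (partial1 f x).
Proof. by case=> _ d1 _ _ _; rewrite /partial1 derive1E; apply: derivableP. Qed.

Lemma is_derive_partial2 f (x : X) : C1 f ->
  is_derive x.2 1 (fun y : R => f (x.1, y)) (partial2 f x).
Proof. by case=> _ _ d2 _ _; rewrite /partial2 derive1E; apply: derivableP. Qed.

Lemma derive1_periodic (u : R -> R) (T : R) : (forall a, u (a + T) = u a) ->
  forall a, derive1 u (a + T) = derive1 u a.
Proof.
move=> uT a; rewrite /derive1.
rewrite (_ : (fun h => _) = fun h : R => h^-1 *: (u (h + a) - u a))//.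
by apply/funext => h; rewrite addrA !uT.
Qed.

Lemma partial1_periodic f : periodic2 f -> periodic2 (partial1 f).
Proof.
move=> pf x; rewrite /partial1/=; split.
  by apply: (@derive1_periodic (fun y => f (y, x.2))) => a; have [] := pf (a, x.2).
congr (derive1 _ _); apply/funext => y; by have [] := pf (y, x.2).
Qed.

Lemma partial2_periodic f : periodic2 f -> periodic2 (partial2 f).
Proof.
move=> pf x; rewrite /partial2/=; split.
  congr (derive1 _ _); apply/funext => y; by have [] := pf (x.1, y).
by apply: (@derive1_periodic (fun y => f (x.1, y))) => a; have [] := pf (x.1, a).
Qed.

Lemma cper_partial1 f : C1per f -> cper (partial1 f).
Proof. by case=> pf [_ _ _ c1 _]; split=> //; exact: partial1_periodic. Qed.
Lemma cper_partial2 f : C1per f -> cper (partial2 f).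
Proof. by case=> pf [_ _ _ _ c1]; split=> //; exact: partial2_periodic. Qed.

Lemma coef_partial1 f k : C1per f ->
  al (partial1 f) k = k.1%:~R * be f k /\ be (partial1 f) k = - k.1%:~R * al f k.
Proof.
case=> pf c; have [cf _ _ c1 _] := c; apply: (al_derive1 k pf cf c1) => x.
exact: is_derive_partial1.
Qed.
Lemma coef_partial2 f k : C1per f ->
  al (partial2 f) k = k.2%:~R * be f k /\ be (partial2 f) k = - k.2%:~R * al f k.
Proof.
case=> pf c; have [cf _ _ _ c1] := c; apply: (al_derive2 k pf cf c1) => x.
exact: is_derive_partial2.
Qed.

(** Control of [2 p] derivatives in the Wiener algebra. *)
Definition Wp (p : nat) f (L : R) := forall K, \sum_(k <- box K) sq k ^+ p * am f k <= L.

Lemma Wp_W1 f L : Wp 1 f L -> W1 (al f) (be f) L.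
Proof. by []. Qed.

Lemma Wp_le p q f L : (p <= q)%N -> Wp q f L -> Wp p f L.
Proof.
move=> pq w K; apply: le_trans (w K); apply: ler_sum => k _.
by rewrite ler_wpM2r ?am_ge0// ler_weXn2l// sq_ge1.
Qed.

Lemma norm_k1_le k : `|k.1%:~R| <= sq k :> R.
Proof.
rewrite /sq /sqnormk -(real_normK (num_real (k.1%:~R : R))).
have h2 := sqr_ge0 (k.2%:~R : R); have := sqr_ge0 (`|k.1%:~R : R| - 1).
have : 0 <= `|k.1%:~R : R| by []; set z := `|_|; lra.
Qed.
Lemma norm_k2_le k : `|k.2%:~R| <= sq k :> R.
Proof.
rewrite /sq /sqnormk -(real_normK (num_real (k.2%:~R : R))).
have h2 := sqr_ge0 (k.1%:~R : R); have := sqr_ge0 (`|k.2%:~R : R| - 1).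
have : 0 <= `|k.2%:~R : R| by []; set z := `|_|; lra.
Qed.

Lemma am_partial1 f k : C1per f -> am (partial1 f) k = `|k.1%:~R| * am f k.
Proof.
move=> /coef_partial1 => /(_ k)[h1 h2].
by rewrite /am h1 h2 !normrM normrN; ring.
Qed.
Lemma am_partial2 f k : C1per f -> am (partial2 f) k = `|k.2%:~R| * am f k.
Proof.
move=> /coef_partial2 => /(_ k)[h1 h2].
by rewrite /am h1 h2 !normrM normrN; ring.
Qed.

Lemma Wp_partial1 p f L : C1per f -> Wp p.+1 f L -> Wp p (partial1 f) L.
Proof.
move=> cf w K; apply: le_trans (w K); apply: ler_sum => k _.
rewrite am_partial1// mulrA ler_wpM2r ?am_ge0// exprSr.
by rewrite ler_wpM2l ?exprn_ge0 ?norm_k1_le// ltW// sq_gt0.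
Qed.
Lemma Wp_partial2 p f L : C1per f -> Wp p.+1 f L -> Wp p (partial2 f) L.
Proof.
move=> cf w K; apply: le_trans (w K); apply: ler_sum => k _.
rewrite am_partial2// mulrA ler_wpM2r ?am_ge0// exprSr.
by rewrite ler_wpM2l ?exprn_ge0 ?norm_k2_le// ltW// sq_gt0.
Qed.

Lemma Wp_sup f L : cper f -> Wp 1 f L -> forall x, `|f x| <= L.
Proof.
move=> cf w; apply: (sup_le_am cf (Wp_W1 w)) => K.
by have := Wp_le (leq0n 1) w K; under eq_bigr do rewrite mul1r.
Qed.

(** The field [grad_perp psi] is divergence-free. As [psi] is only of class C1,
    this is read off the coefficients: in Parseval's sums for the two terms, the
    factors [k.2 * k.1] and [k.1 * k.2] agree. *)
Lemma mean_grad_perp psi L G g1 g2 : C1per psi -> Wp 2 psi L ->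
  cper G -> cper g1 -> cper g2 ->
  (forall x : X, is_derive x.1 1 (fun y : R => G (y, x.2)) (g1 x)) ->
  (forall x : X, is_derive x.2 1 (fun y : R => G (x.1, y)) (g2 x)) ->
  mean (fun x => partial2 psi x * g1 x - partial1 psi x * g2 x) = 0.
Proof.
move=> cpsi w [pG cG] cg1 cg2 d1 d2.
have cp1 := cper_partial1 cpsi; have cp2 := cper_partial2 cpsi.
have [M1 M10 HM1] := cper_bounded cg1; have [M2 M20 HM2] := cper_bounded cg2.
have [_ kg1] := cg1; have [_ kg2] := cg2.
have [_ kp1] := cp1; have [_ kp2] := cp2.
have cd1 k := al_derive1 k pG cG kg1 d1; have cd2 k := al_derive2 k pG cG kg2 d2.
have e0 : (fun K : nat => M1 * (L / K.+1%:R ^+ 2) + M2 * (L / K.+1%:R ^+ 2)) @ \oo --> 0.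
  have -> : 0 = M1 * 0 + M2 * 0 :> R by rewrite !mulr0 addr0.
  by apply: cvgD; (apply: cvgM; [exact: cvg_cst|exact: cvg_inv_sqr]).
apply/eqP; rewrite -normr_le0; apply: (cvg_le0 (N := 0%N) e0) => K _.
have h1 := parseval K cp2 (Wp_W1 (Wp_partial2 cpsi w)) kg1 HM1.
have h2 := parseval K cp1 (Wp_W1 (Wp_partial1 cpsi w)) kg2 HM2.
rewrite meanB; [|by ct|by ct].
rewrite (_ : mean (fun x => _) = mean (fun x => g1 x * partial2 psi x)); last first.
  by congr mean; apply/funext => x; rewrite mulrC.
rewrite (_ : mean (fun x => partial1 _ _ * _) = mean (fun x => g2 x * partial1 psi x)); last first.
  by congr mean; apply/funext => x; rewrite mulrC.
have E : \sum_(k <- box K) (al (partial2 psi) k * al g1 k + be (partial2 psi) k * be g1 k)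
  = \sum_(k <- box K) (al (partial1 psi) k * al g2 k + be (partial1 psi) k * be g2 k).
  apply: eq_bigr => k _.
  have [-> ->] := coef_partial1 k cpsi; have [-> ->] := coef_partial2 k cpsi.
  by have [-> ->] := cd1 k; have [-> ->] := cd2 k; ring.
rewrite E in h1; set S := \sum_(k <- _) _ in h1 h2.
rewrite -(subrKA S) (le_trans (ler_normD _ _))// lerD// distrC; exact: h2.
Qed.

(** The negative term on the right makes an induction on [K] possible: it
    telescopes faster than the sum grows. *)
Lemma sum_inv_sqr1 K : \sum_(i <- iota 0 K.*2.+1) (1 + (i%:Z - K%:Z)%:~R ^+ 2)^-1
  <= 5 - 2 / (K%:R + 2^-1) :> R.
Proof.
pose g (z : int) : R := (1 + z%:~R ^+ 2)^-1.
have -> : \sum_(i <- iota 0 K.*2.+1) (1 + (i%:Z - K%:Z)%:~R ^+ 2)^-1 =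
    \sum_(0 <= i < K.*2.+1) g (i%:Z - K%:Z) by rewrite /index_iota subn0.
elim: K => [|K IH].
  by rewrite big_nat1 /g subrr expr0n/= addr0 invr1 add0r invrK; lra.
rewrite doubleS big_nat_recr//= big_nat_recl//=.
rewrite (eq_bigr (fun i : nat => g (i%:Z - K%:Z))); last first.
  by move=> i _; congr g; lia.
have -> : g (0%:Z - K.+1%:Z) = (1 + K.+1%:R ^+ 2)^-1.
  by rewrite /g sub0r intrN sqrrN.
have -> : g (K.*2.+2%:Z - K.+1%:Z) = (1 + K.+1%:R ^+ 2)^-1.
  by rewrite /g; congr ((1 + _ ^+ 2)^-1); rewrite -[RHS]/(K.+1%:Z%:~R); congr (_%:~R); lia.
apply: le_trans (lerD (lerD (lexx _) IH) (lexx _)) _.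
rewrite -natr1; set z : R := K%:R; have z0 : 0 <= z by exact: ler0n.
have : (1 + (z + 1) ^+ 2)^-1 <= (z + 2^-1)^-1 - (z + 1 + 2^-1)^-1.
  have -> : (z + 2^-1)^-1 - (z + 1 + 2^-1)^-1 = ((z + 2^-1) * (z + 1 + 2^-1))^-1.
    by field; rewrite ?andbT; apply/andP; split; apply: lt0r_neq0; lra.
  rewrite lef_pV2 ?posrE; [nra| |]; nra.
lra.
Qed.

(** The weight dominates a product: [(1 + a^2 + b^2)^2 >= (1 + a^2) (1 + b^2)]. *)
Lemma sum_inv_sqr K : \sum_(k <- box K) (sq k ^+ 2)^-1 <= 25 :> R.
Proof.
pose g (i : nat) : R := (1 + (i%:Z - K%:Z)%:~R ^+ 2)^-1.
have g0 i : 0 <= g i by rewrite invr_ge0 addr_ge0// sqr_ge0.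
rewrite /box big_allpairs_dep/=.
apply: (@le_trans _ _ (\sum_(i <- iota 0 K.*2.+1) \sum_(j <- iota 0 K.*2.+1) g i * g j)).
  apply: ler_sum => i _; apply: ler_sum => j _.
  rewrite -invfM /sq /sqnormk/=.
  set a := _%:~R; set b := _%:~R.
  have a0 := sqr_ge0 a; have b0 := sqr_ge0 b.
  have := mulr_ge0 a0 b0.
  move: (a ^+ 2) (b ^+ 2) a0 b0 => u v u0 v0 uv.
  by rewrite lef_pV2 ?posrE; nra.
have S5 : \sum_(i <- iota 0 K.*2.+1) g i <= 5.
  apply: le_trans (sum_inv_sqr1 K) _; by rewrite gerBl divr_ge0.
have S0 : 0 <= \sum_(i <- iota 0 K.*2.+1) g i by apply: sumr_ge0.
under eq_bigr do rewrite -mulr_sumr.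
by rewrite -mulr_suml; nra.
Qed.

(** Cauchy-Schwarz against the summable weight of [sum_inv_sqr]. *)
Lemma l2_Wp p f (B : R) : 0 <= B ->
  (forall K, \sum_(k <- box K) sq k ^+ p.*2.+2 * (al f k ^+ 2 + be f k ^+ 2) <= B ^+ 2) ->
  Wp p f (8 * B).
Proof.
move=> B0 H K.
rewrite -(@ler_pXn2r _ 2)// ?nnegrE; last 2 first.
- by apply: sumr_ge0 => k _; rewrite mulr_ge0 ?am_ge0// exprn_ge0// ltW// sq_gt0.
- by rewrite mulr_ge0.
have s0 k : 0 < sq k :> R := sq_gt0 k.
rewrite (eq_bigr (fun k => (sq k)^-1 * (sq k ^+ p.+1 * am f k))); last first.
  by move=> k _; rewrite exprS -mulrA mulKf// gt_eqF.
apply: le_trans (sum_cauchy _ _ _) _.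
have -> : (8 * B) ^+ 2 = 32 * (2 * B ^+ 2) by ring.
apply: ler_pM.
- by apply: sumr_ge0 => k _; exact: sqr_ge0.
- by apply: sumr_ge0 => k _; exact: sqr_ge0.
- under eq_bigr do rewrite exprVn; apply: le_trans (sum_inv_sqr K) _; lra.
apply: le_trans (ler_wpM2l _ (H K)); last by [].
rewrite mulr_sumr; apply: ler_sum => k _.
have -> : p.*2.+2 = (p.+1 * 2)%N by rewrite muln2.
rewrite exprMn -exprM [leRHS]mulrCA; apply: ler_wpM2l; first by rewrite exprn_ge0// ltW.
rewrite /am -[al f k ^+ 2]real_normK ?num_real// -[be f k ^+ 2]real_normK ?num_real//.
by have := sqr_ge0 (`|al f k| - `|be f k|); move: `|al f k| `|be f k| => u v; lra.
Qed.

Lemma normc_fourier f k :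
  Normc.normc (fourier_coef f k) ^+ 2 = al f k ^+ 2 + be f k ^+ 2.
Proof.
rewrite fourier_coefE /Normc.normc sqr_sqrtr ?sqrrN//.
by rewrite addr_ge0// sqr_ge0.
Qed.

Lemma Hs_norm_bound (s : R) f (B : R) : 0 <= B -> (Hs_norm s f <= B%:E)%E ->
  forall K, \sum_(k <- box K) (sq k `^ s) * (al f k ^+ 2 + be f k ^+ 2) <= B ^+ 2.
Proof.
move=> B0; rewrite /Hs_norm; set E := esum _ _ => EB K.
have E0 : (0 <= E)%E.
  by apply: esum_ge0 => k _; rewrite lee_fin mulr_ge0 ?powR_ge0 ?sqr_ge0.
have : (E <= (B ^+ 2)%:E)%E.
  case: E E0 EB => [r| |]//= r0.
    rewrite !lee_fin powR12_sqrt// => rB.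
    by rewrite -(sqr_sqrtr r0) lerXn2r ?nnegrE// sqrtr_ge0.
  by rewrite invr_eq0 pnatr_eq0.
move=> E2; rewrite -lee_fin; apply: le_trans E2.
apply: esum_ge; exists [set` box K]; first by split => //; exact: finite_seq.
rewrite -fsbig_seq ?box_uniq// sumEFin lee_fin; apply: ler_sum => k _.
by rewrite normc_fourier.
Qed.

Lemma Hs_norm_le (s : R) f (B : R) : 0 <= B ->
  (forall K, \sum_(k <- box K) (sq k `^ s) * (al f k ^+ 2 + be f k ^+ 2) <= B ^+ 2) ->
  (Hs_norm s f <= B%:E)%E.
Proof.
move=> B0 H; rewrite /Hs_norm; set E := esum _ _.
have E0 : (0 <= E)%E.
  by apply: esum_ge0 => k _; rewrite lee_fin mulr_ge0 ?powR_ge0 ?sqr_ge0.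
have : (E <= (B ^+ 2)%:E)%E.
  apply: ge_ereal_sup => _ [F [/finite_seqP[r ->] _] <-].
  have -> : [set` r] = [set` undup r].
    by apply/seteqP; split=> x /=; rewrite mem_undup.
  rewrite -fsbig_seq ?undup_uniq// sumEFin lee_fin.
  pose K := \max_(k <- undup r) maxn (absz k.1) (absz k.2).
  apply: le_trans (H K).
  under eq_bigr do rewrite normc_fourier.
  apply: sumr_sub.
  - exact: undup_uniq.
  - exact: box_uniq.
  - move=> k kr; rewrite mem_box -geq_max /K.
    exact: (@leq_bigmax_seq _ _ _ (fun k : Z2 => maxn (absz k.1) (absz k.2))).
  - by move=> k; rewrite mulr_ge0 ?powR_ge0// addr_ge0 ?sqr_ge0.
case: E E0 => [r| |]//= r0; rewrite !lee_fin powR12_sqrt// => rB.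
by rewrite -(ger0_norm B0) -sqrtr_sqr ler_wsqrtr.
Qed.

Lemma powR_ge_exp k (s : R) n : n%:R <= s -> sq k ^+ n <= sq k `^ s.
Proof.
by move=> ns; rewrite -powR_mulrn ?(ltW (sq_gt0 k))// ler_powR// sq_ge1.
Qed.

Lemma powR_le_exp k (s : R) n : s <= n%:R -> sq k `^ s <= sq k ^+ n.
Proof.
by move=> ns; rewrite -powR_mulrn ?(ltW (sq_gt0 k))// ler_powR// sq_ge1.
Qed.

(** An integer version of a bound on [Hs_norm], to which interpolation applies. *)
Definition L2w (n : nat) f (B : R) := forall K,
  \sum_(k <- box K) sq k ^+ n * (al f k ^+ 2 + be f k ^+ 2) <= B ^+ 2.

Lemma Hs_L2w (s : R) f (B : R) n : n%:R <= s -> 0 <= B -> (Hs_norm s f <= B%:E)%E ->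
  L2w n f B.
Proof.
move=> ns B0 HB K; apply: le_trans (Hs_norm_bound B0 HB K).
apply: ler_sum => k _; rewrite ler_wpM2r ?powR_ge_exp//.
by rewrite addr_ge0 ?sqr_ge0.
Qed.

Lemma L2w_le m n f B : (m <= n)%N -> L2w n f B -> L2w m f B.
Proof.
move=> mn w K; apply: le_trans (w K); apply: ler_sum => k _.
by rewrite ler_wpM2r ?addr_ge0 ?sqr_ge0// ler_weXn2l// sq_ge1.
Qed.

Lemma Hs_Wp (s : R) f (B : R) p : p.*2.+2%:R <= s -> 0 <= B -> (Hs_norm s f <= B%:E)%E ->
  Wp p f (8 * B).
Proof. by move=> ps B0 HB; apply: l2_Wp => //; exact: (Hs_L2w ps B0 HB). Qed.

End C1fun.

(** * Differentiation in time *)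

Section Time.
Context {R : realType}.
Local Notation X := (R * R)%type.
Local Notation Z2 := (int * int)%type.
Implicit Types (f g : X -> R) (k l : Z2) (t : R).

Lemma is_derive_eps (u : R -> R) (t l : R) :
  (forall e : R, 0 < e -> exists2 d : R, 0 < d & forall h, `|h| < d ->
    `|u (t + h) - u t - h * l| <= `|h| * e) ->
  is_derive t 1 u l.
Proof.
move=> H.
have cv : (fun h : R => h^-1 *: (u (h *: 1 + t) - u t)) @ 0^' --> l.
  apply/cvgrPdist_le => e e0; have [d d0 Hd] := H e e0.
  apply/nbhs_ballP; exists d => //= h; rewrite /ball/= sub0r normrN => hd h0.
  have := Hd h hd; rewrite /GRing.scale/= mulr1 (addrC h t) => hh.
  have -> : l - h^-1 * (u (t + h) - u t) = - (h^-1 * (u (t + h) - u t - h * l)).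
    by field.
  by rewrite normrN normrM normfV ler_pdivrMl ?normr_gt0.
split; first by apply/cvg_ex; exists l.
exact/cvg_lim.
Qed.

Lemma mvt_itv (u u' : R -> R) (a b : R) : a <= b ->
  (forall x, a <= x -> x <= b -> is_derive x 1 u (u' x)) ->
  exists c, [/\ a <= c, c <= b & u b - u a = u' c * (b - a)].
Proof.
move=> ab du.
have H1 x : x \in `]a, b[ -> is_derive x 1 u (u' x).
  by rewrite in_itv/= => /andP[x1 x2]; apply: du; exact: ltW.
have H2 : {within `[a, b], continuous u}.
  apply: derivable_within_continuous => x; rewrite in_itv/= => /andP[x1 x2].
  by case: (du x x1 x2).
have [c cab E] := MVT_segment ab H1 H2.
by exists c; move: cab; rewrite in_itv/= => /andP[c1 c2].
Qed.

(** The mean value theorem for [t |-> u t - t * l]. *)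
Lemma mvt_diff (u u' : R -> R) (t0 d l e : R) :
  (forall t, `|t - t0| < d -> is_derive t 1 u (u' t)) ->
  (forall t, `|t - t0| < d -> `|u' t - l| <= e) ->
  forall h, `|h| < d -> `|u (t0 + h) - u t0 - h * l| <= `|h| * e.
Proof.
move=> du ul h hd.
have mvt (a b : R) : a <= b -> `|a - t0| < d -> `|b - t0| < d ->
    exists2 c, `|c - t0| < d & u b - u a = u' c * (b - a).
  move=> ab; rewrite !ltr_norml => /andP[a1 a2] /andP[b1 b2].
  have H x : a <= x -> x <= b -> is_derive x 1 u (u' x).
    by move=> x1 x2; apply: du; rewrite ltr_norml; apply/andP; split; lra.
  have [c [c1 c2 E]] := mvt_itv ab H; exists c => //.
  by rewrite ltr_norml; apply/andP; split; lra.
have d0 : 0 < d by rewrite (le_lt_trans _ hd).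
have z0 : `|t0 - t0| < d by rewrite subrr normr0.
have zh : `|t0 + h - t0| < d by rewrite addrAC subrr add0r.
have [h0|h0] := leP 0 h.
  have [|c cd ->] := mvt t0 (t0 + h) _ z0 zh; first by rewrite lerDl.
  have -> : u' c * (t0 + h - t0) - h * l = h * (u' c - l) by ring.
  by rewrite normrM ler_wpM2l// ul.
have [|c cd E] := mvt (t0 + h) t0 _ zh z0; first by rewrite gerDl ltW.
have -> : u (t0 + h) - u t0 - h * l = h * (u' c - l).
  by have -> : u (t0 + h) - u t0 = - (u t0 - u (t0 + h)) by [rewrite opprB]; rewrite E; ring.
by rewrite normrM ler_wpM2l// ul.
Qed.

Definition ucont (P : R -> X -> R) (t0 : R) := forall e : R, 0 < e ->
  exists2 d : R, 0 < d & forall t, `|t - t0| < d -> forall x, `|P t x - P t0 x| <= e.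

Definition bdd f := exists2 M : R, 0 <= M & forall x, `|f x| <= M.

(** Closed under the algebraic operations, which is what [is_derive_mean] needs
    of the integrands. *)
Definition ucb P t0 := ucont P t0 /\ bdd (P t0).

Lemma ucbD P Q t0 : ucb P t0 -> ucb Q t0 -> ucb (fun t x => P t x + Q t x) t0.
Proof.
move=> [cP [M M0 HM]] [cQ [N N0 HN]]; split; last first.
  exists (M + N); first exact: addr_ge0.
  by move=> x; rewrite (le_trans (ler_normD _ _))// lerD.
move=> e e0; have e2 : 0 < e / 2 by rewrite divr_gt0.
have [d1 d10 H1] := cP _ e2; have [d2 d20 H2] := cQ _ e2.
exists (Num.min d1 d2); first by rewrite lt_min d10.
move=> t; rewrite lt_min => /andP[t1 t2] x.
have -> : P t x + Q t x - (P t0 x + Q t0 x) = (P t x - P t0 x) + (Q t x - Q t0 x) by ring.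
rewrite (le_trans (ler_normD _ _))//.
by have := H1 t t1 x; have := H2 t t2 x; lra.
Qed.

Lemma ucbM P Q t0 : ucb P t0 -> ucb Q t0 -> ucb (fun t x => P t x * Q t x) t0.
Proof.
move=> [cP [M M0 HM]] [cQ [N N0 HN]]; split; last first.
  exists (M * N); first exact: mulr_ge0.
  by move=> x; rewrite normrM ler_pM.
move=> e e0; pose r := Num.min 1 (e / (M + N + 1)).
have MN : 0 < M + N + 1 by rewrite ltr_wpDl// addr_ge0.
have r0 : 0 < r by rewrite lt_min ltr01/= divr_gt0.
have r1 : r <= 1 by rewrite ge_min lexx.
have re : r * (M + N + 1) <= e by rewrite -ler_pdivlMr// ge_min lexx orbT.
have [d1 d10 H1] := cP _ r0; have [d2 d20 H2] := cQ _ r0.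
exists (Num.min d1 d2); first by rewrite lt_min d10.
move=> t; rewrite lt_min => /andP[t1 t2] x.
have h1 := H1 t t1 x; have h2 := H2 t t2 x.
have -> : P t x * Q t x - P t0 x * Q t0 x =
   (P t x - P t0 x) * (Q t x - Q t0 x) + P t0 x * (Q t x - Q t0 x) + (P t x - P t0 x) * Q t0 x by ring.
rewrite (le_trans (ler_normD _ _))// (le_trans (lerD (ler_normD _ _) (lexx _)))// !normrM.
have a1 : `|P t x - P t0 x| * `|Q t x - Q t0 x| <= r * 1 by rewrite ler_pM// (le_trans h2).
have a2 : `|P t0 x| * `|Q t x - Q t0 x| <= M * r by rewrite ler_pM.
have a3 : `|P t x - P t0 x| * `|Q t0 x| <= r * N by rewrite ler_pM.
by apply: le_trans re; apply: le_trans (lerD (lerD a1 a2) a3) _; lra.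
Qed.

Lemma ucb_cst f t0 : bdd f -> ucb (fun _ => f) t0.
Proof.
by move=> bf; split=> // e e0; exists 1 => // t _ x; rewrite subrr normr0 ltW.
Qed.

Lemma bdd_cst (r : R) : bdd (fun=> r).
Proof. by exists `|r|. Qed.

Lemma ucbN P t0 : ucb P t0 -> ucb (fun t x => - P t x) t0.
Proof.
move=> uP; have := ucbM (ucb_cst t0 (bdd_cst (-1))) uP.
by under eq_fun do under eq_fun do rewrite mulN1r.
Qed.

Lemma ucbX P t0 n : ucb P t0 -> ucb (fun t x => P t x ^+ n) t0.
Proof.
move=> uP; elim: n => [|n IH]; first exact: (ucb_cst t0 (bdd_cst 1)).
by under eq_fun do under eq_fun do rewrite exprS; exact: ucbM.
Qed.

Lemma ucb_sum (I : Type) (s : seq I) (F : I -> R -> X -> R) t0 :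
  (forall i, ucb (F i) t0) -> ucb (fun t x => \sum_(i <- s) F i t x) t0.
Proof.
move=> uF; elim: s => [|i s IH].
  by under eq_fun do under eq_fun do rewrite big_nil; exact: (ucb_cst t0 (bdd_cst 0)).
by under eq_fun do under eq_fun do rewrite big_cons; exact: ucbD.
Qed.

Lemma ucb_poly (p : {poly R}) P t0 : ucb P t0 -> ucb (fun t x => p.[P t x]) t0.
Proof.
move=> uP; under eq_fun do under eq_fun do rewrite horner_coef.
apply: (@ucb_sum _ _ (fun (i : 'I_(size p)) t x => p`_i * P t x ^+ i) t0) => i.
by apply: ucbM; [exact: (ucb_cst t0 (bdd_cst _))|exact: ucbX].
Qed.

(** Differentiation under the mean: all time derivatives met below are
    continuous in time uniformly in space, so no domination is needed. *)
Lemma is_derive_mean (P P' : R -> X -> R) (t0 d0 : R) : 0 < d0 ->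
  (forall t, `|t - t0| < d0 -> continuous (P t)) -> continuous (P' t0) ->
  (forall t x, `|t - t0| < d0 -> is_derive t 1 (P ^~ x) (P' t x)) ->
  ucont P' t0 ->
  is_derive t0 1 (fun t => mean (P t)) (mean (P' t0)).
Proof.
move=> d00 cP cP' dP uP'; apply: is_derive_eps => e e0.
have [d d1 Hd] := uP' e e0.
exists (Num.min d d0); first by rewrite lt_min d1.
move=> h; rewrite lt_min => /andP[hd hd0].
have z0 : `|t0 - t0| < d0 by rewrite subrr normr0.
have zh : `|t0 + h - t0| < d0 by rewrite addrAC subrr add0r.
have c1 := cP _ z0; have c2 := cP _ zh.
rewrite -meanB// -meanZ// -meanB; [|by ct|by ct].
apply: mean_norm_le; first by ct.
move=> x; apply: (@mvt_diff (P ^~ x) (P' ^~ x) t0 (Num.min d d0)).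
- by move=> t; rewrite lt_min => /andP[_]; exact: dP.
- by move=> t; rewrite lt_min => /andP[td _]; exact: Hd.
- by rewrite lt_min hd.
Qed.

Definition rcont0 (u : R -> R) := forall e : R, 0 < e ->
  exists2 d : R, 0 < d & forall t, 0 <= t -> t < d -> `|u t - u 0| <= e.

(** The equation holds for positive times only, so continuity at zero is a
    separate assumption. *)
Lemma derive0_const (u : R -> R) : (forall t, 0 < t -> is_derive t 1 u 0) ->
  rcont0 u -> forall t, 0 <= t -> u t = u 0.
Proof.
move=> du cu t; rewrite le_eqVlt => /predU1P[<-//|t0].
have loc r : 0 < r -> r <= t -> u t = u r.
  move=> r0 rt.
  have H x : r <= x -> x <= t -> is_derive x 1 u 0.
    by move=> x1 x2; apply: du; exact: lt_le_trans r0 x1.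
  have [c [_ _]] := mvt_itv (u' := fun=> 0) rt H.
  by rewrite mul0r => /eqP; rewrite subr_eq0 => /eqP.
apply/eqP; rewrite -subr_eq0 -normr_le0; apply/ler_addgt0Pl => e e0; rewrite addr0.
have [d d0 Hd] := cu e e0.
have m0 : 0 < Num.min t (d / 2) by rewrite lt_min t0 divr_gt0.
rewrite (loc (Num.min t (d / 2)))//; last by rewrite ge_min lexx.
by apply: Hd; [exact: ltW|rewrite gt_min; apply/orP; right; lra].
Qed.

(** The function [expR (- C t) * u t] is nonincreasing, and tends to zero at
    zero. *)
Lemma gronwall0 (u u' : R -> R) (C T : R) : 0 <= C -> u 0 = 0 -> (forall t, 0 <= u t) ->
  rcont0 u -> (forall t, 0 < t -> t <= T -> is_derive t 1 u (u' t)) ->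
  (forall t, 0 < t -> t <= T -> u' t <= C * u t) ->
  forall t, 0 <= t -> t <= T -> u t = 0.
Proof.
move=> C0 u0 uge0 cu du uC t; rewrite le_eqVlt => /predU1P[<-//|t0] tT.
pose v s := expR (- C * s) * u s.
have loc r : 0 < r -> r <= t -> v t <= v r.
  move=> r0 rt.
  have H x : r <= x -> x <= t -> is_derive x 1 v (expR (- C * x) * (u' x - C * u x)).
    move=> x1 x2.
    have dux := du x (lt_le_trans r0 x1) (le_trans x2 tT).
    by apply: is_derive_eq; rewrite /GRing.scale/=; ring.
  have [c [c1 c2 E]] := mvt_itv rt H.
  rewrite -subr_le0 E.
  rewrite mulr_le0_ge0 ?subr_ge0// mulr_ge0_le0 ?expR_ge0// subr_le0.
  by apply: uC; [exact: lt_le_trans r0 c1|exact: le_trans c2 tT].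
apply/eqP; rewrite eq_le uge0 andbT.
suff : v t <= 0 by rewrite /v pmulr_rle0// expR_gt0.
apply/ler_addgt0Pl => e e0; rewrite addr0.
have [d d0 Hd] := cu e e0.
have m0 : 0 < Num.min t (d / 2) by rewrite lt_min t0 divr_gt0.
apply: (le_trans (loc _ m0 _)); first by rewrite ge_min lexx.
have : `|u (Num.min t (d / 2)) - u 0| <= e.
  by apply: Hd; [exact: ltW|rewrite gt_min; apply/orP; right; lra].
rewrite u0 subr0 ger0_norm// => ue.
rewrite /v -[leRHS]mul1r ler_pM// ?expR_ge0//.
by rewrite -[leRHS]expR0 ler_expR mulNr oppr_le0 mulr_ge0// ltW.
Qed.

End Time.

(** * Solutions on the Fourier side *)

Section Flow.
Context {R : realType}.
Local Notation X := (R * R)%type.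
Local Notation Z2 := (int * int)%type.
Implicit Types (f g : X -> R) (k l : Z2) (t : R).

Local Notation il k := (inv_sqrt_laplacian_symbol k : R).

Lemma sqnormk_ge1 k : k != 0 -> 1 <= sqnormk k :> R.
Proof.
case: k => a b k0; rewrite /sqnormk/= -!rmorphXn/= -intrD ler1z.
have [a0|a0] := eqVneq a 0; last by have := sqr_ge0 b; nia.
have [b0|b0] := eqVneq b 0; first by rewrite a0 b0 eqxx in k0.
by have := sqr_ge0 a; nia.
Qed.

Lemma il_ge0 k : 0 <= il k.
Proof. by rewrite /inv_sqrt_laplacian_symbol; case: ifP => // _; rewrite invr_ge0 sqrtr_ge0. Qed.

(** At [k = 0] both factors vanish, hence an inequality. *)
Lemma il_sqr k : il k ^+ 2 * sqnormk k <= 1.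
Proof.
rewrite /inv_sqrt_laplacian_symbol; case: ifPn => [_|k0]; first by rewrite expr0n/= mul0r ler01.
have k1 := sqnormk_ge1 k0.
rewrite exprVn /normk sqr_sqrtr ?sqnormk_ge0// mulVf//.
by rewrite gt_eqF// (lt_le_trans ltr01).
Qed.

Lemma il_le1 k : il k <= 1.
Proof.
rewrite /inv_sqrt_laplacian_symbol; case: ifPn => // k0.
have k1 := sqnormk_ge1 k0.
rewrite invf_le1; first by rewrite -sqrtr1 ler_wsqrtr.
by rewrite sqrtr_gt0 (lt_le_trans ltr01).
Qed.

Lemma ilN k : il (- k) = il k.
Proof.
rewrite /inv_sqrt_laplacian_symbol -[(0, 0)]/(0 : Z2) oppr_eq0; case: ifP => // _.
by rewrite /normk /sqnormk/= !intrN !sqrrN.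
Qed.

Definition transport (p f : X -> R) (x : X) : R :=
  partial2 p x * partial1 f x - partial1 p x * partial2 f x.

(** What the argument uses of a global solution, stated on the Fourier side. The
    norm of [Wp 2] controls first derivatives uniformly in space and leaves a
    summable tail. *)
Record flow (th ps : R -> X -> R) : Prop := Flow {
  fl_C1 : forall t, 0 <= t -> C1per (th t);
  fl_W : forall t, 0 <= t -> exists2 L : R, 0 <= L & Wp 2 (th t) L;
  fl_cont : forall t0, 0 <= t0 -> forall e : R, 0 < e -> exists2 d : R, 0 < d &
    forall t, 0 <= t -> `|t - t0| < d -> Wp 2 (fun x => th t x - th t0 x) e;
  fl_psi : forall t, 0 < t -> C1per (ps t);
  fl_psi_coef : forall t k, 0 < t ->
    al (ps t) k = il k * al (th t) k /\ be (ps t) k = il k * be (th t) k;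
  fl_eq : forall t x, 0 < t ->
    is_derive t 1 (fun tau => th tau x) (transport (ps t) (th t) x)
}.

(** Already [s >= 6] would give [Wp 2], by [Hs_Wp]; the stream function is
    chosen at each positive time. *)
Lemma sqg_flow (s : R) th0 th : 11 <= s -> sqg_solution s th0 +oo%E th ->
  exists ps, flow th ps.
Proof.
move=> s11 [h0 hHs hC1 hcont heq].
have life t : 0 <= t -> lifespan +oo%E t by move=> t0; split=> //; rewrite ltry.
have : forall t, exists psi, 0 < t ->
    [/\ is_inv_sqrt_laplacian (th t) psi, C1 psi &
      forall x, is_derive t 1 (fun tau : R => th tau x)
                  (dot (grad_perp psi x) (grad (th t) x))].
  move=> t; have [t0|t0] := ltP 0 t; last by exists (th t).
  by have [psi] := heq t t0 (life t (ltW t0)); exists psi.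
move=> /choice[ps Hps]; exists ps.
have s6 : 2.*2.+2%:R <= s by apply: le_trans s11; rewrite ler_nat.
split.
- by move=> t t0; have [] := hHs t (life t t0); split => //; exact: hC1 (life t t0).
- move=> t t0; have [_ _ _ Hlt] := hHs t (life t t0).
  have N0 : (0 <= Hs_norm s (th t))%E by exact: poweR_ge0.
  exists (8 * fine (Hs_norm s (th t))); first by rewrite mulr_ge0// fine_ge0.
  apply: (Hs_Wp s6); first exact: fine_ge0.
  by rewrite fineK// ge0_fin_numE.
- move=> t0 t00 e e0.
  have e8 : 0 < e / 8 by rewrite divr_gt0.
  have nb : nbhs (0 : \bar R)%E [set y : \bar R | (y < (e / 8)%:E)%E].
    rewrite /nbhs/=; have := @lt_nbhsl R 0 (e / 8) e8.
    by apply: filterS => z; rewrite lte_fin.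
  have := hcont t0 (life t0 t00) _ nb.
  rewrite /within/= => /nbhs_ballP[d /= d0 Hd]; exists d => // t tge td.
  have -> : e = 8 * (e / 8) by field.
  apply: (Hs_Wp s6); first exact: ltW.
  by apply: ltW; apply: Hd; [rewrite /ball/= distrC|exact: life].
- move=> t t0; have [[pp _ _] c1 _] := Hps t t0; by split.
- move=> t k t0; have [[_ _ pc] _ _] := Hps t t0; have := pc k.
  by rewrite !fourier_coefE /GRing.mul/= !mul0r subr0 addr0 => -[-> /eqP];
    rewrite mulrN eqr_opp => /eqP.
- move=> t x t0; have [_ _ H] := Hps t t0.
  rewrite (_ : transport _ _ _ = dot (grad_perp (ps t) x) (grad (th t) x)); first exact: H.
  by rewrite /transport /dot /grad_perp /grad/= mulNr.
Qed.

Lemma partial1B f g x : C1 f -> C1 g ->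
  partial1 (fun x => f x - g x) x = partial1 f x - partial1 g x.
Proof.
move=> cf cg; have h1 := is_derive_partial1 x cf; have h2 := is_derive_partial1 x cg.
by rewrite /partial1 derive1E; apply: derive_val.
Qed.
Lemma partial2B f g x : C1 f -> C1 g ->
  partial2 (fun x => f x - g x) x = partial2 f x - partial2 g x.
Proof.
move=> cf cg; have h1 := is_derive_partial2 x cf; have h2 := is_derive_partial2 x cg.
by rewrite /partial2 derive1E; apply: derive_val.
Qed.

Lemma C1perB f g : C1per f -> C1per g -> C1per (fun x => f x - g x).
Proof.
move=> [pf Cf] [pg Cg]; have [cf _ _ c1f c2f] := Cf; have [cg _ _ c1g c2g] := Cg.
split; first by move=> x; have [-> ->] := pf x; have [-> ->] := pg x.
split.
- by ct.
- move=> x; have h1 := is_derive_partial1 x Cf; have h2 := is_derive_partial1 x Cg.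
  exact: ex_derive.
- move=> x; have h1 := is_derive_partial2 x Cf; have h2 := is_derive_partial2 x Cg.
  exact: ex_derive.
- rewrite (_ : partial1 _ = fun x => partial1 f x - partial1 g x); first by ct.
  by apply/funext => x; rewrite partial1B.
- rewrite (_ : partial2 _ = fun x => partial2 f x - partial2 g x); first by ct.
  by apply/funext => x; rewrite partial2B.
Qed.

Lemma Wp2_sup f L : C1per f -> Wp 2 f L ->
  forall x, [/\ `|f x| <= L, `|partial1 f x| <= L & `|partial2 f x| <= L].
Proof.
move=> cf w x; split.
- by apply: (Wp_sup (C1per_cper cf)); exact: Wp_le w.
- by apply: (Wp_sup (cper_partial1 cf)); exact: Wp_partial1.
- by apply: (Wp_sup (cper_partial2 cf)); exact: Wp_partial2.
Qed.

Lemma am_triangle f g k : continuous f -> continuous g ->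
  am f k <= am (fun x => f x - g x) k + am g k.
Proof.
move=> cf cg; rewrite /am alB// beB//.
have := ler_normD (al f k - al g k) (al g k); have := ler_normD (be f k - be g k) (be g k).
by rewrite !subrK; lra.
Qed.

Section flow_props.
Variables (th ps : R -> X -> R).
Hypothesis F : flow th ps.

Lemma fl_cth t : 0 <= t -> continuous (th t).
Proof. by move=> /(fl_C1 F)/C1per_cper[]. Qed.
Lemma fl_cps t : 0 < t -> continuous (ps t).
Proof. by move=> /(fl_psi F)/C1per_cper[]. Qed.

Lemma fl_am_psi t k : 0 < t -> am (ps t) k = il k * am (th t) k.
Proof.
move=> t0; rewrite /am; have [-> ->] := fl_psi_coef F k t0.
by rewrite !normrM ger0_norm ?il_ge0// mulrDr.
Qed.

Lemma fl_am_psiB t t' k : 0 < t -> 0 < t' ->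
  am (fun x => ps t x - ps t' x) k = il k * am (fun x => th t x - th t' x) k.
Proof.
move=> t0 t'0; have cp := fl_cps t0; have cp' := fl_cps t'0.
have ct := fl_cth (ltW t0); have ct' := fl_cth (ltW t'0).
rewrite /am !alB// !beB//; have [-> ->] := fl_psi_coef F k t0.
have [-> ->] := fl_psi_coef F k t'0.
by rewrite -!mulrBr !normrM ger0_norm ?il_ge0// mulrDr.
Qed.

Lemma Wp_il p f g L : (forall k, am f k = il k * am g k) -> Wp p g L -> Wp p f L.
Proof.
move=> fg w K; apply: le_trans (w K); apply: ler_sum => k _.
rewrite fg ler_wpM2l ?exprn_ge0 ?(ltW (sq_gt0 k))//.
by rewrite -[leRHS]mul1r ler_wpM2r ?am_ge0// il_le1.
Qed.

Lemma fl_Wpsi t L : 0 < t -> Wp 2 (th t) L -> Wp 2 (ps t) L.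
Proof. by move=> t0; apply: Wp_il => k; exact: fl_am_psi. Qed.

Lemma fl_loc_bound t0 : 0 <= t0 -> exists2 L : R, 0 <= L & exists2 d : R, 0 < d &
  forall t, 0 <= t -> `|t - t0| < d -> Wp 2 (th t) L.
Proof.
move=> t00; have [L L0 HL] := fl_W F t00; have [d d0 Hd] := fl_cont F t00 ltr01.
exists (1 + L); first by rewrite addr_ge0.
exists d => // t tge td K; have := Hd t tge td K; have := HL K => h1 h2.
apply: le_trans (lerD h2 h1); rewrite -big_split/=; apply: ler_sum => k _.
rewrite -mulrDr ler_wpM2l ?exprn_ge0 ?(ltW (sq_gt0 k))//.
by apply: am_triangle; exact: fl_cth.
Qed.

(** Compactness of the time interval turns the local bounds into one bound. *)
Lemma fl_bound (T : R) : exists2 L : R, 0 <= L &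
  forall t, 0 <= t -> t <= T -> Wp 2 (th t) L.
Proof.
have /compact_near_coveringP/near_covering_withinP H : compact (`[0, T] : set R).
  exact: segment_compact.
have := H R +oo%R (fun (L : R) (t : R) => 0 <= L /\ Wp 2 (th t) L) _.
case.
  move=> x /=; rewrite in_itv/= => /andP[x0 xT].
  have [L L0 [d d0 HL]] := fl_loc_bound x0.
  exists ([set t | `|t - x| < d], [set M | L <= M]).
    split => /=; last by apply: nbhs_pinfty_ge; exact: num_real.
    by apply/nbhs_ballP; exists d => // z; rewrite /ball/= distrC.
  move=> [t M] /= [td LM]; rewrite in_itv/= => /andP[t0 tT].
  split; first exact: le_trans L0 LM.
  by move=> K; apply: le_trans LM; exact: HL.
move=> M [_ HM]; have M0 : M < Num.max (M + 1) 0 by rewrite lt_max ltrDl ltr01.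
exists (Num.max (M + 1) 0); first by rewrite le_max lexx orbT.
move=> t t0 tT; have := HM _ M0 t; rewrite /= in_itv/= t0 tT => /(_ isT)[] //.
Qed.

Lemma ucont_shift (P : R -> X -> R) t0 : 0 < t0 ->
  (forall e : R, 0 < e -> exists2 d : R, 0 < d & forall t, 0 < t -> `|t - t0| < d ->
     forall x, `|P t x - P t0 x| <= e) -> ucont P t0.
Proof.
move=> t00 H e e0; have [d d0 Hd] := H e e0; exists (Num.min d t0).
  by rewrite lt_min d0.
move=> t; rewrite lt_min => /andP[td tt]; apply: Hd => //.
by move: tt; rewrite ltr_norml => /andP[]; lra.
Qed.

(** Continuity in [Wp 2] is uniform in space for the functions and their
    gradients, and passes to the stream functions since [il k <= 1]. *)
Lemma fl_ucb t0 : 0 < t0 -> [/\ ucb th t0, ucb (fun t => partial1 (th t)) t0,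
  ucb (fun t => partial2 (th t)) t0, ucb (fun t => partial1 (ps t)) t0 &
  ucb (fun t => partial2 (ps t)) t0].
Proof.
move=> t00; have t00' := ltW t00.
have [L L0 HL] := fl_W F t00'; have c0 := fl_C1 F t00'; have p0 := fl_psi F t00.
have [pc0 C0] := c0; have [pp0 P0] := p0.
have S1 := Wp2_sup c0 HL; have S2 := Wp2_sup p0 (fl_Wpsi t00 HL).
have D t e : 0 < t -> Wp 2 (fun x => th t x - th t0 x) e -> forall x,
  [/\ `|th t x - th t0 x| <= e, `|partial1 (th t) x - partial1 (th t0) x| <= e &
      `|partial2 (th t) x - partial2 (th t0) x| <= e].
  move=> tt w x; have [ct Ct] := fl_C1 F (ltW tt).
  have cB := C1perB (fl_C1 F (ltW tt)) c0.
  by have := Wp2_sup cB w x; rewrite partial1B ?partial2B.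
have DP t e : 0 < t -> Wp 2 (fun x => th t x - th t0 x) e -> forall x,
  [/\ `|ps t x - ps t0 x| <= e, `|partial1 (ps t) x - partial1 (ps t0) x| <= e &
      `|partial2 (ps t) x - partial2 (ps t0) x| <= e].
  move=> tt w x; have [ct Ct] := fl_psi F tt.
  have cB := C1perB (fl_psi F tt) p0.
  have w' : Wp 2 (fun x => ps t x - ps t0 x) e.
    by apply: Wp_il w => k; exact: fl_am_psiB.
  by have := Wp2_sup cB w' x; rewrite partial1B ?partial2B.
by split; (split; [apply: ucont_shift => // e e0;
  have [d d0 Hd] := fl_cont F t00' e0; exists d => // t tt td x;
  have [h1 h2 h3] := D t e tt (Hd t (ltW tt) td) x;
  have [g1 g2 g3] := DP t e tt (Hd t (ltW tt) td) x|
  exists L => // x; have [h1 h2 h3] := S1 x; have [g1 g2 g3] := S2 x]).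
Qed.

Local Notation G t := (transport (ps t) (th t)).

Lemma fl_ucbG t0 : 0 < t0 -> ucb (fun t => G t) t0.
Proof.
move=> t00; have [_ u1 u2 v1 v2] := fl_ucb t00; rewrite /transport.
by apply: ucbD; [exact: ucbM|apply: ucbN; exact: ucbM].
Qed.

Lemma cper_transport f g : C1per f -> C1per g -> cper (transport f g).
Proof.
move=> cf cg; have [p1 c1] := cper_partial1 cf; have [p2 c2] := cper_partial2 cf.
have [q1 d1] := cper_partial1 cg; have [q2 d2] := cper_partial2 cg.
split; last by rewrite /transport; ct.
move=> x; rewrite /transport; have [-> ->] := p1 x; have [-> ->] := p2 x.
by have [-> ->] := q1 x; have [-> ->] := q2 x.
Qed.

Lemma fl_cG t : 0 < t -> cper (G t).
Proof. by move=> t0; apply: cper_transport; [exact: fl_psi F _ t0|exact: fl_C1 F _ (ltW t0)]. Qed.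

(** Differentiation under the mean. *)
Lemma fl_al t k : 0 < t ->
  is_derive t 1 (fun t => al (th t) k) (al (G t) k) /\
  is_derive t 1 (fun t => be (th t) k) (be (G t) k).
Proof.
move=> t0; have [_ cG] := fl_cG t0; have uG := fl_ucbG t0.
have pos s : `|s - t| < t -> 0 < s by rewrite ltr_norml => /andP[]; lra.
have bc : bdd (cs k : X -> R) by exists 1 => // x; exact: cs_le1.
have bs : bdd (sn k : X -> R) by exists 1 => // x; exact: sn_le1.
split; [apply: (is_derive_mean (P' := fun t x => G t x * cs k x) t0)
       |apply: (is_derive_mean (P' := fun t x => G t x * sn k x) t0)].
- by move=> s /pos/ltW/fl_cth cc; ct.
- by ct.
- move=> s x /pos s0; have := fl_eq F x s0 => h.
  by apply: is_derive_eq; rewrite /GRing.scale/=; ring.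
- by have [] := ucbM uG (ucb_cst t bc).
- by move=> s /pos/ltW/fl_cth cc; ct.
- by ct.
- move=> s x /pos s0; have := fl_eq F x s0 => h.
  by apply: is_derive_eq; rewrite /GRing.scale/=; ring.
- by have [] := ucbM uG (ucb_cst t bs).
Qed.

End flow_props.
End Flow.

(** * Conservation laws *)

Section Conserved.
Context {R : realType}.
Local Notation X := (R * R)%type.
Local Notation Z2 := (int * int)%type.
Implicit Types (f g : X -> R) (k l : Z2) (t : R).
Local Notation il k := (inv_sqrt_laplacian_symbol k : R).

Lemma norm_tri (a a' c c' x y z : R) : `|a - c| <= x -> `|a' - c'| <= y ->
  `|c - c'| <= z -> `|a - a'| <= x + z + y.
Proof.
move=> h1 h2 h3.
have -> : a - a' = (a - c) + (c - c') - (a' - c') by ring.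
rewrite (le_trans (ler_normB _ _))// (le_trans (lerD (ler_normD _ _) (lexx _)))//.
by rewrite !lerD.
Qed.

(** Truncations of the Hamiltonian, of the mass, and of their difference, the
    energy. All weights are nonnegative. *)
Definition hpart K f := \sum_(k <- box K) il k * (al f k ^+ 2 + be f k ^+ 2).
Definition mpart K f := \sum_(k <- box K) (al f k ^+ 2 + be f k ^+ 2).
Definition epart K f := \sum_(k <- box K) (1 - il k) * (al f k ^+ 2 + be f k ^+ 2).

(** The Hamiltonian [<f (-Delta)^(-1/2) f>]. *)
Definition hamilton f :=
  mean (fun x => f x * synth (fun k => il k * al f k) (fun k => il k * be f k) x).

Lemma mass_rate f L K : cper f -> Wp 1 f L ->
  `|mean (fun x => f x ^+ 2) - mpart K f| <= L * (L / K.+1%:R ^+ 2).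
Proof.
move=> cf w; have [_ c] := cf.
have := parseval K cf (Wp_W1 w) c (Wp_sup cf w).
under [X in mean X]eq_fun do rewrite -expr2.
by under eq_bigr do rewrite -!expr2.
Qed.

Lemma hamilton_rate f L K : cper f -> Wp 1 f L ->
  `|hamilton f - hpart K f| <= L * (L / K.+1%:R ^+ 2).
Proof.
move=> cf w; have [_ c] := cf; have [pa pb] := parity_coef c.
pose a k := il k * al f k; pose b k := il k * be f k.
have pab : parity a b by split=> k; rewrite /a /b ilN ?pa ?pb ?mulrN.
have wab : W1 a b L.
  move=> M; apply: le_trans (w M); apply: ler_sum => k _.
  rewrite ler_wpM2l ?(ltW (sq_gt0 k))// /a /b !(normrM (il k)) -mulrDr ger0_norm ?il_ge0//.
  by rewrite -[leRHS]mul1r ler_wpM2r ?am_ge0// il_le1.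
have W : W1 (al (synth a b)) (be (synth a b)) L.
  move=> M; rewrite (eq_bigr (fun k => sq k * (`|a k| + `|b k|))); first exact: wab.
  by move=> k _; have [-> ->] := synth_coef k pab wab.
have := parseval K (cper_synth wab) W c (Wp_sup cf w).
rewrite -/(hamilton f) (eq_bigr (fun k => il k * (al f k ^+ 2 + be f k ^+ 2)))//.
by move=> k _; have [-> ->] := synth_coef k pab wab; rewrite /a /b; ring.
Qed.

Lemma energy_rate f L K : cper f -> Wp 1 f L ->
  `|mean (fun x => f x ^+ 2) - hamilton f - epart K f| <= (L + L) * (L / K.+1%:R ^+ 2).
Proof.
move=> cf w; have h1 := mass_rate K cf w; have h2 := hamilton_rate K cf w.
have -> : epart K f = mpart K f - hpart K f.
  rewrite /epart /mpart /hpart -sumrB; apply: eq_bigr => k _; ring.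
move: h1 h2; set a := mean _; set b := hamilton f; set c := mpart K f; set d := hpart K f.
move=> h1 h2; have -> : a - b - (c - d) = (a - c) - (b - d) by move: (a) (b) (c) (d) => ? ? ? ?; ring.
by rewrite (le_trans (ler_normB _ _))// mulrDl lerD.
Qed.

Lemma am_le_Wp f L k : Wp 0 f L -> am f k <= L.
Proof.
move=> w; pose N := maxn (absz k.1) (absz k.2).
have kN : k \in box N by rewrite mem_box -geq_max.
apply: le_trans (w N); rewrite (bigD1_seq k) ?box_uniq//= mul1r lerDl.
by apply: sumr_ge0 => j _; rewrite mul1r am_ge0.
Qed.

(** The Hamiltonian is a continuous quadratic form; needed only for its
    continuity at the initial time. *)
Lemma hamiltonB f g L e : cper f -> cper g -> Wp 1 f L -> Wp 1 g L ->
  Wp 1 (fun x => f x - g x) e -> `|hamilton f - hamilton g| <= e * (L + L).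
Proof.
move=> cf cg wf wg wfg; have [_ kf] := cf; have [_ kg] := cg.
apply: (cvg_le_lim (e := fun K : nat => (L + L) * (L / K.+1%:R ^+ 2))).
  have -> : 0 = (L + L) * 0 :> R by rewrite mulr0.
  by apply: cvgM; [exact: cvg_cst|exact: cvg_inv_sqr].
move=> K; have h1 := hamilton_rate K cf wf; have h2 := hamilton_rate K cg wg.
have h3 : `|hpart K f - hpart K g| <= e * (L + L).
  rewrite /hpart -sumrB (le_trans (ler_norm_sum _ _ _))//.
  apply: (@le_trans _ _ (\sum_(k <- box K) sq k ^+ 1 * am (fun x => f x - g x) k * (L + L))).
    apply: ler_sum => k _; rewrite -mulrBr normrM ger0_norm ?il_ge0//.
    have a1 := am_le_Wp k (Wp_le (leq0n 1) wf); have a2 := am_le_Wp k (Wp_le (leq0n 1) wg).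
    have b1 := am_ge0 f k; have b2 := am_ge0 g k.
    have b3 := am_ge0 (fun x => f x - g x) k.
    have L0 : 0 <= L by exact: le_trans a1.
    apply: (@le_trans _ _ (1 * (am (fun x => f x - g x) k * (L + L)))); last first.
      rewrite -mulrA ler_wpM2r ?sq_ge1// mulr_ge0// addr_ge0//.
    apply: ler_pM => //; [exact: il_ge0|exact: il_le1|].
    have -> : al f k ^+ 2 + be f k ^+ 2 - (al g k ^+ 2 + be g k ^+ 2) =
      al (fun x => f x - g x) k * (al f k + al g k) + be (fun x => f x - g x) k * (be f k + be g k).
      by rewrite alB// beB//; ring.
    rewrite (le_trans (ler_normD _ _))// (normrM (al (fun z => f z - g z) k)) (normrM (be (fun z => f z - g z) k)).
    apply: (@le_trans _ _ (am (fun x => f x - g x) k * (am f k + am g k))); last first.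
      by rewrite ler_wpM2l// lerD.
    rewrite /am mulrDl; apply: lerD; apply: ler_wpM2l => //.
      by rewrite (le_trans (ler_normD _ _))// lerD// lerDl.
    by rewrite (le_trans (ler_normD _ _))// lerD// lerDr.
  by rewrite -mulr_suml ler_wpM2r// addr_ge0// (le_trans (am_ge0 f 0) (am_le_Wp 0 (Wp_le (leq0n 1) wf))).
apply: (le_trans (norm_tri h1 h2 h3)); rewrite mulrDl.
by rewrite addrAC (addrC _ (e * _)) addrA.
Qed.

Section flow_cons.
Variables (th ps : R -> X -> R).
Hypothesis F : flow th ps.
Local Notation G t := (transport (ps t) (th t)).

Lemma fl_cper t : 0 <= t -> cper (th t).
Proof. by move=> t0; exact: C1per_cper (fl_C1 F t0). Qed.

Lemma fl_sup0 (e : R) : 0 < e -> exists2 d : R, 0 < d & forall t, 0 <= t -> t < d ->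
  forall x, `|th t x - th 0 x| <= e.
Proof.
move=> e0; have [d d0 Hd] := fl_cont F (lexx 0) e0; exists d => // t t0 td x.
have w : Wp 2 (fun x => th t x - th 0 x) e by apply: Hd; rewrite ?subr0 ?ger0_norm.
by have [] := Wp2_sup (C1perB (fl_C1 F t0) (fl_C1 F (lexx 0))) w x.
Qed.

(** The time derivative of the mean is the mean of [grad_perp psi . grad (p
    theta)]. *)
Lemma flow_poly (p : {poly R}) t : 0 <= t ->
  mean (fun x => p.[th t x]) = mean (fun x => p.[th 0 x]).
Proof.
have ccomp (q : {poly R}) (s : R) : 0 <= s -> continuous (fun x => q.[th s x]).
  by move=> s0 x; apply: (@continuous_comp _ _ _ (th s) (horner q));
    [exact: (fl_cth F s0)|exact: continuous_horner].
apply: (derive0_const (u := fun t => mean (fun x => p.[th t x]))).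
  move=> {}t t0; have t0' := ltW t0; have [_ cG] := fl_cG F t0.
  have [u1 _ _ _ _] := fl_ucb F t0; have uG := fl_ucbG F t0.
  have pos s : `|s - t| < t -> 0 < s by rewrite ltr_norml => /andP[]; lra.
  have cp := ccomp p^`() t t0'.
  have -> : 0 = mean (fun x => p^`().[th t x] * G t x).
    have C := fl_C1 F t0'; have Cp := fl_psi F t0.
    have [L _ HL] := fl_W F t0'.
    have [q1 d1] := cper_partial1 C; have [q2 d2] := cper_partial2 C.
    have [pt kt] := C1per_cper C; have [_ CC] := C.
    transitivity (mean (fun x => partial2 (ps t) x * (p^`().[th t x] * partial1 (th t) x)
       - partial1 (ps t) x * (p^`().[th t x] * partial2 (th t) x))); last first.
      by congr mean; apply/funext => x; rewrite /transport; ring.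
    apply: esym; apply: (@mean_grad_perp _ (ps t) L (fun x => p.[th t x])) => //.
    - exact: fl_Wpsi HL.
    - split; last exact: ccomp.
      by move=> x; have [-> ->] := pt x.
    - split; last by ct.
      by move=> x; have [-> ->] := pt x; have [-> ->] := q1 x.
    - split; last by ct.
      by move=> x; have [-> ->] := pt x; have [-> ->] := q2 x.
    - move=> x; have h := is_derive_partial1 x CC.
      have := @is_derive1_comp R (horner p) (fun y => th t (y, x.2)) x.1 p^`().[th t x] (partial1 (th t) x).
      rewrite mulrC; apply => //; rewrite -surjective_pairing; exact: is_derive_poly.
    - move=> x; have h := is_derive_partial2 x CC.
      have := @is_derive1_comp R (horner p) (fun y => th t (x.1, y)) x.2 p^`().[th t x] (partial2 (th t) x).
      rewrite mulrC; apply => //; rewrite -surjective_pairing; exact: is_derive_poly.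
  apply: (@is_derive_mean _ (fun t x => p.[th t x]) (fun t x => p^`().[th t x] * G t x) t t t0).
  - by move=> s /pos s0; apply: ccomp; exact: ltW.
  - by ct.
  - move=> s x /pos s0; have h := fl_eq F x s0.
    exact: (@is_derive1_comp R (horner p) (fun s => th s x)).
  - by have [] := ucbM (ucb_poly p^`() u1) uG.
move=> e e0.
(* Extended by a constant to negative times, where nothing is known of the
   solution. *)
pose P s := if 0 <= s then th s else th 0.
have uP : ucb P 0.
  split; last first.
    have [M M0 HM] := cper_bounded (fl_cper (lexx 0)).
    by rewrite /P lexx; exists M.
  move=> r r0; have [d d0 Hd] := fl_sup0 r0; exists d => // s sd x.
  rewrite /P lexx; case: ifPn => s0; last by rewrite subrr normr0 ltW.
  by apply: Hd => //; rewrite subr0 ger0_norm// in sd.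
have [cP _] := ucb_poly p uP; have [d d0 Hd] := cP e e0.
exists d => // s s0 sd; rewrite -meanB; [|exact: ccomp|exact: ccomp].
apply: mean_norm_le.
  have c1 := ccomp p s s0; have c2 := ccomp p 0 (lexx 0); by ct.
move=> x; have := Hd s; rewrite subr0 ger0_norm// => /(_ sd x).
by rewrite /P lexx s0.
Qed.

(** The integrand is [grad_perp psi . grad (theta psi)]. *)
Lemma mean_psi_transport t : 0 < t -> mean (fun x => ps t x * G t x) = 0.
Proof.
move=> t0; have t0' := ltW t0.
have C := fl_C1 F t0'; have Cp := fl_psi F t0.
have [L _ HL] := fl_W F t0'.
have [q1 d1] := cper_partial1 C; have [q2 d2] := cper_partial2 C.
have [r1 e1] := cper_partial1 Cp; have [r2 e2] := cper_partial2 Cp.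
have [pt kt] := C1per_cper C; have [_ CC] := C.
have [pp kp] := C1per_cper Cp; have [_ CP] := Cp.
transitivity (mean (fun x =>
   partial2 (ps t) x * (partial1 (th t) x * ps t x + th t x * partial1 (ps t) x) -
   partial1 (ps t) x * (partial2 (th t) x * ps t x + th t x * partial2 (ps t) x))).
  by congr mean; apply/funext => x; rewrite /transport; ring.
apply: (@mean_grad_perp _ (ps t) L (fun x => th t x * ps t x)) => //.
- exact: fl_Wpsi HL.
- split; last by ct.
  by move=> x; have [-> ->] := pt x; have [-> ->] := pp x.
- split; last by ct.
  by move=> x; have [-> ->] := pt x; have [-> ->] := pp x; have [-> ->] := q1 x; have [-> ->] := r1 x.
- split; last by ct.
  by move=> x; have [-> ->] := pt x; have [-> ->] := pp x; have [-> ->] := q2 x; have [-> ->] := r2 x.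
- move=> x; have h := is_derive_partial1 x CC; have h' := is_derive_partial1 x CP.
  by apply: is_derive_eq; rewrite /GRing.scale/= -surjective_pairing; ring.
- move=> x; have h := is_derive_partial2 x CC; have h' := is_derive_partial2 x CP.
  by apply: is_derive_eq; rewrite /GRing.scale/= -surjective_pairing; ring.
Qed.

Lemma transport_sup t L : 0 < t -> Wp 2 (th t) L -> forall x, `|G t x| <= L * L + L * L.
Proof.
move=> t0 w x; have [_ h1 h2] := Wp2_sup (fl_C1 F (ltW t0)) w x.
have [_ g1 g2] := Wp2_sup (fl_psi F t0) (fl_Wpsi F t0 w) x.
by rewrite /transport (le_trans (ler_normB _ _))// !normrM lerD// ler_pM.
Qed.

Definition hpart' K t :=
  \sum_(k <- box K) il k * (2 * al (th t) k * al (G t) k + 2 * be (th t) k * be (G t) k).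

(** The full series would be twice [mean (psi G) = 0], so the truncated sum is
    bounded by the tail of [psi]. *)
Lemma hpart_derive K t L : 0 < t -> Wp 2 (th t) L ->
  is_derive t 1 (fun t => hpart K (th t)) (hpart' K t) /\
    `|hpart' K t| <= 2 * ((L * L + L * L) * (L / K.+1%:R ^+ 2)).
Proof.
move=> t0 w; split.
  rewrite /hpart /hpart'; elim: (box K) => [|k s IH].
    by under eq_fun do rewrite big_nil; rewrite big_nil; exact: is_derive_cst.
  under eq_fun do rewrite big_cons; rewrite big_cons.
  have [ha hb] := fl_al F k t0.
  by apply: is_derive_eq; rewrite /GRing.scale/=; ring.
have [pG cG] := fl_cG F t0; have [pp cp] := C1per_cper (fl_psi F t0).
have E : hpart' K t = 2 * mean (fun x => G t x * (trigp (box K) (al (ps t)) (be (ps t)) x - ps t x)).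
  have -> : mean (fun x => G t x * (trigp (box K) (al (ps t)) (be (ps t)) x - ps t x)) =
     mean (fun x => G t x * trigp (box K) (al (ps t)) (be (ps t)) x) - mean (fun x => ps t x * G t x).
    rewrite -meanB; [|by ct|by ct]; congr mean; apply/funext => x; ring.
  rewrite mean_psi_transport// subr0 mean_trigp_mul// mulr_sumr /hpart'; apply: eq_bigr => k _.
  by have [-> ->] := fl_psi_coef F k t0; ring.
rewrite E normrM ger0_norm// ler_wpM2l//; apply: mean_norm_le; first by ct.
move=> x; rewrite normrM ler_pM ?transport_sup// distrC.
apply: inversion_rate; first by split.
exact: Wp_W1 (Wp_le _ (fl_Wpsi F t0 w)).
Qed.

(** The truncations are differentiable in time with derivatives tending to zero,
    so their limit is constant. *)
Lemma flow_hamilton t : 0 <= t -> hamilton (th t) = hamilton (th 0).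
Proof.
apply: (derive0_const (u := fun t => hamilton (th t))).
  move=> {}t t0; have t0' := ltW t0.
  have [L L0 [d d0 HL]] := fl_loc_bound F t0'.
  apply: is_derive_eps => e e0; exists (Num.min d t); first by rewrite lt_min d0.
  move=> h hd; rewrite mulr0 subr0.
  have near s : `|s - t| < Num.min d t -> 0 < s /\ Wp 2 (th s) L.
    rewrite lt_min => /andP[sd st]; have s0 : 0 < s by move: st; rewrite ltr_norml => /andP[]; lra.
    by split => //; apply: HL => //; exact: ltW.
  have [s0 ws] : 0 < t + h /\ Wp 2 (th (t + h)) L by apply: near; rewrite addrAC subrr add0r.
  have [_ wt] : 0 < t /\ Wp 2 (th t) L by apply: near; rewrite subrr normr0 lt_min d0.
  suff -> : hamilton (th (t + h)) = hamilton (th t) by rewrite subrr normr0 mulr_ge0// ltW.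
  (* [C] collects the errors of the two truncations and of the derivative. *)
  pose C := L + L + `|h| * (2 * (L * L + L * L)).
  have C0 : (fun K : nat => C * (L / K.+1%:R ^+ 2)) @ \oo --> 0.
    have -> : 0 = C * 0 :> R by rewrite mulr0.
    by apply: cvgM; [exact: cvg_cst|exact: cvg_inv_sqr].
  apply/eqP; rewrite -subr_eq0 -normr_le0; apply: (cvg_le0 (N := 0%N) C0) => K _.
  have h1 := hamilton_rate K (fl_cper (ltW s0)) (Wp_le (leqnSn 1) ws).
  have h2 := hamilton_rate K (fl_cper t0') (Wp_le (leqnSn 1) wt).
  have dH s : `|s - t| < Num.min d t -> is_derive s 1 (fun t => hpart K (th t)) (hpart' K s).
    by move=> /near[s1 w1]; have [] := hpart_derive K s1 w1.
  have bH s : `|s - t| < Num.min d t -> `|hpart' K s - 0| <= 2 * ((L * L + L * L) * (L / K.+1%:R ^+ 2)).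
    by move=> /near[s1 w1]; rewrite subr0; have [] := hpart_derive K s1 w1.
  have := mvt_diff dH bH hd; rewrite mulr0 subr0 => h3.
  apply: (le_trans (norm_tri h1 h2 h3)); rewrite /C; set y := L / _.
  by rewrite le_eqVlt; apply/orP; left; apply/eqP; ring.
move=> e e0; have [L L0 [d1 d10 HL]] := fl_loc_bound F (lexx 0).
pose r := e / (L + L + 1).
have LL : 0 < L + L + 1 by rewrite ltr_wpDl// addr_ge0.
have r0 : 0 < r by rewrite divr_gt0.
have [d d0 Hd] := fl_cont F (lexx 0) r0.
exists (Num.min d1 d); first by rewrite lt_min d10.
move=> {}t t0; rewrite lt_min => /andP[td1 td].
have n0 : `|t - 0| = t by rewrite subr0 ger0_norm.
have H := hamiltonB (fl_cper t0) (fl_cper (lexx 0)) (Wp_le (leqnSn 1) (HL t t0 _))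
  (Wp_le (leqnSn 1) (HL 0 (lexx 0) _)) (Wp_le (leqnSn 1) (Hd t t0 _)).
apply: (le_trans (H _ _ _)); rewrite ?n0 ?subrr ?normr0//.
rewrite /r mulrAC ler_pdivrMr// ler_wpM2l ?(ltW e0)//; lra.
Qed.

Lemma flow_energy t L K : 0 <= t -> Wp 1 (th t) L ->
  `|(mean (fun x => th 0 x ^+ 2) - hamilton (th 0)) - epart K (th t)|
  <= (L + L) * (L / K.+1%:R ^+ 2).
Proof.
move=> t0 w; rewrite -(flow_hamilton t0).
have := flow_poly 'X^2 t0.
under eq_fun do rewrite hornerXn; under [X in _ = mean X]eq_fun do rewrite hornerXn.
by move=> <-; exact: energy_rate (fl_cper t0) w.
Qed.

Lemma flow_mass t L K : 0 <= t -> Wp 1 (th t) L ->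
  `|mean (fun x => th 0 x ^+ 2) - mpart K (th t)| <= L * (L / K.+1%:R ^+ 2).
Proof.
move=> t0 w; have := flow_poly 'X^2 t0.
under eq_fun do rewrite hornerXn; under [X in _ = mean X]eq_fun do rewrite hornerXn.
by move=> <-; exact: mass_rate (fl_cper t0) w.
Qed.

Lemma flow_mean t : 0 <= t -> al (th t) 0 = al (th 0) 0.
Proof.
move=> t0; have := flow_poly 'X t0.
under eq_fun do rewrite hornerX; under [X in _ = mean X]eq_fun do rewrite hornerX.
have H f : al f 0 = mean f.
  by congr mean; apply/funext => x; rewrite /cs /phase/= !mul0r addr0 cos0 mulr1.
by rewrite !H.
Qed.

End flow_cons.
End Conserved.

(** * Symmetries of the solution *)

Section Symmetry.
Context {R : realType}.
Local Notation X := (R * R)%type.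
Local Notation Z2 := (int * int)%type.
Implicit Types (f g : X -> R) (k l : Z2) (t : R).
Local Notation il k := (inv_sqrt_laplacian_symbol k : R).

Lemma ler_norm_add2 (a b u v y z : R) : `|a - u| <= y -> `|b - v| <= z ->
  a + b <= (u + v) + (y + z).
Proof. by rewrite !ler_norml => /andP[_ h1] /andP[_ h2]; lra. Qed.

(** An orientation-preserving symmetry [x |-> (e x1, e x2 + c)], with [e] a
    sign, that acts on the trigonometric basis by signs. *)
Record symmetry (e c : R) (ua ub : Z2 -> R) : Prop := Symmetry {
  sy_e : e = 1 \/ e = -1;
  sy_cs : forall k (x : X), cs k (e * x.1, e * x.2 + c) = ua k * cs k x;
  sy_sn : forall k (x : X), sn k (e * x.1, e * x.2 + c) = ub k * sn k x;
  sy_uaN : forall k, ua (- k) = ua k;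
  sy_ubN : forall k, ub (- k) = ub k;
  sy_u1 : forall k, `|ua k| <= 1 /\ `|ub k| <= 1
}.

Lemma symmetry_opp : symmetry (-1) 0 (fun=> 1) (fun=> -1).
Proof.
split => //; try by [right].
- move=> k x; rewrite [RHS]mul1r -(csN k x); congr cos.
  by rewrite phaseN /phase/=; ring.
- move=> k x; rewrite [RHS]mulN1r -(snN k x); congr sin.
  by rewrite phaseN /phase/=; ring.
- by move=> _; rewrite normrN normr1.
Qed.

Lemma symmetry_shift : symmetry 1 pi (fun k => (-1) ^+ absz k.2) (fun k => (-1) ^+ absz k.2).
Proof.
have H (u : R -> R) (m : int) (a : R) : (forall a, u (a + pi) = - u a) ->
    u (a + m%:~R * pi) = (-1) ^+ absz m * u a.
  move=> ua; have Hn (n : nat) b : u (b + n%:R * pi) = (-1) ^+ n * u b.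
    elim: n b => [|n IH] b; first by rewrite mul0r addr0 mul1r.
    by rewrite -natr1 mulrDl mul1r addrA ua IH exprS mulN1r mulNr.
  case: m => n; first exact: Hn.
  rewrite NegzE abszN absz_nat intrN mulNr.
  have := Hn n.+1 (a - n.+1%:R * pi); rewrite subrK => ->.
  by rewrite mulrA -exprD addnn -mul2n exprM sqrrN !expr1n mul1r.
split; try by [left].
- move=> k x; rewrite /cs -H; last exact: cosDpi.
  by congr cos; rewrite /phase/=; ring.
- move=> k x; rewrite /sn -H; last exact: sinDpi.
  by congr sin; rewrite /phase/=; ring.
- by move=> k; rewrite /= abszN.
- by move=> k; rewrite /= abszN.
- by move=> k; rewrite normrX normrN normr1 expr1n.
Qed.

Lemma Wp_B p f g L L' : continuous f -> continuous g -> Wp p f L -> Wp p g L' ->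
  Wp p (fun x => f x - g x) (L + L').
Proof.
move=> cf cg wf wg K; apply: le_trans (lerD (wf K) (wg K)).
rewrite -big_split/=; apply: ler_sum => k _.
rewrite -mulrDr ler_wpM2l ?exprn_ge0 ?(ltW (sq_gt0 k))//.
rewrite /am alB// beB//.
have := ler_normB (al f k) (al g k); have := ler_normB (be f k) (be g k); lra.
Qed.

Section act.
Variables (e c : R) (ua ub : Z2 -> R).
Hypothesis S : symmetry e c ua ub.

Definition act (x : X) : X := (e * x.1, e * x.2 + c).

Lemma act_continuous f : continuous f -> continuous (fun x => f (act x)).
Proof.
move=> cf x; apply: (@continuous_comp _ _ _ act f); last exact: cf.
have h1 : continuous (fun x : X => e * x.1) by ct.
have h2 : continuous (fun x : X => e * x.2 + c) by ct.
exact: (cvg_pair (F := nbhs x) (h1 x) (h2 x)).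
Qed.

Lemma act_periodic f : periodic2 f -> periodic2 (fun x => f (act x)).
Proof.
move=> pf; pose T : R := pi *+ 2.
have p1 y a : f (a + e * T, y) = f (a, y).
  have P := @periodic_int _ (fun a => f (a, y)) T.
  have Q b : f (b + T, y) = f (b, y) by have [] := pf (b, y).
  by case: (sy_e S) => ->; [have := P Q 1 a|have := P Q (-1) a]; rewrite ?intrN mulr1z.
have p2 y a : f (y, a + e * T) = f (y, a).
  have P := @periodic_int _ (fun a => f (y, a)) T.
  have Q b : f (y, b + T) = f (y, b) by have [] := pf (y, b).
  by case: (sy_e S) => ->; [have := P Q 1 a|have := P Q (-1) a]; rewrite ?intrN mulr1z.
by move=> x; rewrite /act/=; split; rewrite mulrDr ?p1// addrAC p2.
Qed.

Lemma is_derive_act1 f (x : X) : C1 f ->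
  is_derive x.1 1 (fun y : R => f (act (y, x.2))) (e * partial1 f (act x)).
Proof.
move=> Cf; rewrite /act/=; have h := is_derive_partial1 (act x) Cf.
rewrite [e * partial1 _ _]mulrC; apply: (@is_derive1_comp R (fun y => f (y, e * x.2 + c)) (fun y => e * y)) => //.
by apply: is_derive_eq; rewrite /GRing.scale/= mulr1.
Qed.

Lemma is_derive_act2 f (x : X) : C1 f ->
  is_derive x.2 1 (fun y : R => f (act (x.1, y))) (e * partial2 f (act x)).
Proof.
move=> Cf; rewrite /act/=; have h := is_derive_partial2 (act x) Cf.
rewrite [e * partial2 _ _]mulrC; apply: (@is_derive1_comp R (fun y => f (e * x.1, y)) (fun y => e * y + c)) => //.
by apply: is_derive_eq; rewrite /GRing.scale/= mulr1 addr0.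
Qed.

Lemma partial1_act f x : C1 f -> partial1 (fun x => f (act x)) x = e * partial1 f (act x).
Proof.
by move=> Cf; have h := is_derive_act1 x Cf; rewrite /partial1 derive1E; apply: derive_val.
Qed.
Lemma partial2_act f x : C1 f -> partial2 (fun x => f (act x)) x = e * partial2 f (act x).
Proof.
by move=> Cf; have h := is_derive_act2 x Cf; rewrite /partial2 derive1E; apply: derive_val.
Qed.

Lemma C1per_act f : C1per f -> C1per (fun x => f (act x)).
Proof.
move=> [pf Cf]; have [cf _ _ c1 c2] := Cf; split; first exact: act_periodic.
split.
- exact: act_continuous.
- by move=> x; have h := is_derive_act1 x Cf; exact: ex_derive.
- by move=> x; have h := is_derive_act2 x Cf; exact: ex_derive.
- have h := act_continuous c1; rewrite (_ : partial1 _ = fun x => e * partial1 f (act x)).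
    by apply: ctM; [exact: ctC|exact: h].
  by apply/funext => x; rewrite partial1_act.
- have h := act_continuous c2; rewrite (_ : partial2 _ = fun x => e * partial2 f (act x)).
    by apply: ctM; [exact: ctC|exact: h].
  by apply/funext => x; rewrite partial2_act.
Qed.

Lemma coef_act f L k : cper f -> Wp 1 f L ->
  al (fun x => f (act x)) k = ua k * al f k /\ be (fun x => f (act x)) k = ub k * be f k.
Proof.
move=> cf w; have [pf kf] := cf; have [pa pb] := parity_coef kf.
apply: (al_unif_trigp (a := fun k => ua k * al f k) (b := fun k => ub k * be f k) k (cvg_inv_sqr L)).
- by split=> j; rewrite ?(sy_uaN S) ?(sy_ubN S) ?pa ?pb ?mulrN.
- exact: act_continuous.
- move=> K x; have := inversion_rate cf (Wp_W1 w) K (act x).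
  congr (`|_ - _| <= _); apply: eq_bigr => j _.
  by rewrite /act (sy_cs S) (sy_sn S); ring.
Qed.

Lemma Wp_act p f L : cper f -> Wp p.+1 f L -> Wp p.+1 (fun x => f (act x)) L.
Proof.
move=> cf wf K; apply: le_trans (wf K); apply: ler_sum => k _.
rewrite ler_wpM2l ?exprn_ge0 ?(ltW (sq_gt0 k))// /am.
have [-> ->] := coef_act k cf (Wp_le (ltn0Sn p) wf); have [u1 v1] := sy_u1 S k.
rewrite (normrM (ua k)) (normrM (ub k)); apply: lerD.
  by rewrite -[leRHS]mul1r ler_wpM2r.
by rewrite -[leRHS]mul1r ler_wpM2r.
Qed.

Section flow_sym.
Variables (th ps : R -> X -> R).
Hypothesis F : flow th ps.
Hypothesis F0 : forall x, th 0 (act x) = th 0 x.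
Local Notation G t := (transport (ps t) (th t)).

Let d t (x : X) := th t x - th t (act x).

Let C1per_d t : 0 <= t -> C1per (d t).
Proof. by move=> t0; apply: C1perB; [exact: fl_C1 F _ t0|apply: C1per_act; exact: fl_C1 F _ t0]. Qed.

(** The stream function of the difference costs no derivative:
    [|grad (-Delta)^(-1/2) d|] is dominated by [|d|] in mean square. *)
Let mean_grad_psi t L : 0 < t -> Wp 2 (th t) L ->
  mean (fun x => (partial1 (ps t) x - e * partial1 (ps t) (act x)) ^+ 2) +
  mean (fun x => (partial2 (ps t) x - e * partial2 (ps t) (act x)) ^+ 2) <=
  mean (fun x => d t x ^+ 2).
Proof.
move=> t0 w; have t0' := ltW t0; have C := fl_C1 F t0'; have P := fl_psi F t0.
have wp := fl_Wpsi F t0 w; have [pP CP] := P; have PA := C1per_act P; have [_ CPA] := PA.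
have [_ cd] := C1per_cper (C1per_d t0').
have [_ cth] := C1per_cper C; have cta := act_continuous cth.
have [_ cps] := C1per_cper P; have cpa := act_continuous cps.
pose q x := ps t x - ps t (act x).
have Cq : C1per q by apply: C1perB.
have E1 : partial1 q = fun x => partial1 (ps t) x - e * partial1 (ps t) (act x).
  by apply/funext => x; rewrite /q partial1B// partial1_act.
have E2 : partial2 q = fun x => partial2 (ps t) x - e * partial2 (ps t) (act x).
  by apply/funext => x; rewrite /q partial2B// partial2_act.
suff : mean (fun x => partial1 q x ^+ 2) + mean (fun x => partial2 q x ^+ 2) <=
  mean (fun x => d t x ^+ 2) by rewrite E1 E2.
have cq k : al q k = il k * al (d t) k /\ be q k = il k * be (d t) k.
  rewrite /q /d !alB// !beB//.
  have [-> ->] := coef_act k (C1per_cper P) (Wp_le (leqnSn 1) wp).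
  have [-> ->] := coef_act k (C1per_cper C) (Wp_le (leqnSn 1) w).
  by have [-> ->] := fl_psi_coef F k t0; split; ring.
have wq : Wp 2 q (L + L).
  apply: Wp_B => //; last exact: Wp_act.
have w1 := Wp_partial1 Cq wq; have w2 := Wp_partial2 Cq wq.
apply: (cvg_le_lim (e := fun K : nat => ((L + L) + (L + L)) * ((L + L) / K.+1%:R ^+ 2))).
  have -> : 0 = ((L + L) + (L + L)) * 0 :> R by rewrite mulr0.
  by apply: cvgM; [exact: cvg_cst|exact: cvg_inv_sqr].
move=> K; have h1 := mass_rate K (cper_partial1 Cq) w1; have h2 := mass_rate K (cper_partial2 Cq) w2.
have h3 : mpart K (partial1 q) + mpart K (partial2 q) <= mean (fun x => d t x ^+ 2).
  apply: (le_trans _ (bessel K cd)); rewrite /mpart -big_split/=; apply: ler_sum => k _.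
  have [-> ->] := coef_partial1 k Cq; have [-> ->] := coef_partial2 k Cq.
  have [-> ->] := cq k.
  have -> : forall a b u v z : R, (u * (z * b)) ^+ 2 + (- u * (z * a)) ^+ 2 + ((v * (z * b)) ^+ 2 + (- v * (z * a)) ^+ 2) = (z ^+ 2 * (u ^+ 2 + v ^+ 2)) * (a ^+ 2 + b ^+ 2).
    by move=> *; ring.
  by rewrite -[leRHS]mul1r ler_wpM2r ?il_sqr// addr_ge0 ?sqr_ge0.
rewrite [X in _ <= _ + X]mulrDl.
exact: le_trans (ler_norm_add2 h1 h2) (lerD h3 (lexx _)).
Qed.

Let P' t (x : X) := 2 * d t x * (G t x - G t (act x)).

Let C1per_cd t : 0 <= t -> continuous (d t).
Proof. by move=> t0; have [_] := C1per_cper (C1per_d t0). Qed.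

Let diff_derive t : 0 < t -> is_derive t 1 (fun t => mean (fun x => d t x ^+ 2)) (mean (P' t)).
Proof.
move=> t0; have t0' := ltW t0; have [_ cG] := fl_cG F t0.
have uact Q : ucb Q t -> ucb (fun t x => Q t (act x)) t.
  move=> [cQ [M M0 HM]]; split; last by exists M.
  by move=> r r0; have [r' r'0 H] := cQ r r0; exists r' => // s sr x; exact: H.
have [u1 _ _ _ _] := fl_ucb F t0; have uG := fl_ucbG F t0.
have pos s : `|s - t| < t -> 0 < s by rewrite ltr_norml => /andP[]; lra.
apply: (@is_derive_mean _ (fun t x => d t x ^+ 2) P' t t t0).
- by move=> s /pos s0; have h := C1per_cd (ltW s0); ct.
- have h := C1per_cd t0'; have h2 := act_continuous cG; rewrite /P'; ct.
- move=> s x /pos s0; rewrite /d /P'.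
  have h1 := fl_eq F x s0; have h2 := fl_eq F (act x) s0.
  by apply: is_derive_eq; rewrite /GRing.scale/= /d; ring.
- have ud : ucb d t by apply: ucbD => //; apply: ucbN; exact: uact.
  have : ucb P' t by exact: ucbM (ucbM (ucb_cst t (bdd_cst 2)) ud) (ucbD uG (ucbN (uact _ uG))).
  by case.
Qed.

(** In the difference of the two transport terms, the part in which derivatives
    fall on [d] has zero mean, by incompressibility. The rest is a product of
    [d], of a difference of velocities and of a bounded gradient. *)
Let diff_ineq t L : 0 < t -> Wp 2 (th t) L -> 0 <= L ->
  mean (P' t) <= 3 * L * mean (fun x => d t x ^+ 2).
Proof.
move=> t0 w L0; have t0' := ltW t0; have C := fl_C1 F t0'; have P := fl_psi F t0.
have [pP CP] := P; have [pC CC] := C.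
have PA := C1per_act P; have CA := C1per_act C.
have [p1 c1] := cper_partial1 C; have [p2 c2] := cper_partial2 C.
have a1 := act_continuous c1; have a2 := act_continuous c2.
have [q1 e1] := cper_partial1 P; have [q2 e2] := cper_partial2 P.
have b1 := act_continuous e1; have b2 := act_continuous e2.
have cd := C1per_cd t0'; have [pd _] := C1per_d t0'.
have wpA := Wp_act (C1per_cper P) (fl_Wpsi F t0 w).
have [pD1 _] := cper_partial1 (C1per_d t0').
have [pD2 _] := cper_partial2 (C1per_d t0').
have D1 x : partial1 (d t) x = partial1 (th t) x - e * partial1 (th t) (act x).
  have [_ CCA] := CA; have -> := partial1B x CC CCA.
  by rewrite (partial1_act x CC).
have D2 x : partial2 (d t) x = partial2 (th t) x - e * partial2 (th t) (act x).
  have [_ CCA] := CA; have -> := partial2B x CC CCA.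
  by rewrite (partial2_act x CC).
have [_ Cd] := C1per_d t0'.
have cD1 : continuous (partial1 (d t)) by case: Cd.
have cD2 : continuous (partial2 (d t)) by case: Cd.
have Z : mean (fun x => partial2 (fun x => ps t (act x)) x * (d t x * partial1 (d t) x) -
    partial1 (fun x => ps t (act x)) x * (d t x * partial2 (d t) x)) = 0.
  apply: (@mean_grad_perp _ (fun x => ps t (act x)) L (fun x => 2^-1 * d t x ^+ 2)) => //.
  - by split; [move=> x; have [-> ->] := pd x|ct].
  - by split; [move=> x; have [-> ->] := pd x; have [-> ->] := pD1 x|ct].
  - by split; [move=> x; have [-> ->] := pd x; have [-> ->] := pD2 x|ct].
  - move=> x; have h := is_derive_partial1 x Cd.
    by apply: is_derive_eq; rewrite /GRing.scale/= -surjective_pairing; field.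
  - move=> x; have h := is_derive_partial2 x Cd.
    by apply: is_derive_eq; rewrite /GRing.scale/= -surjective_pairing; field.
pose r1 x := partial1 (ps t) x - e * partial1 (ps t) (act x).
pose r2 x := partial2 (ps t) x - e * partial2 (ps t) (act x).
have cr1 : continuous r1 by rewrite /r1; ct.
have cr2 : continuous r2 by rewrite /r2; ct.
pose Y x := 2 * (d t x * (r2 x * partial1 (th t) x - r1 x * partial2 (th t) x)).
have cY : continuous Y by rewrite /Y; ct.
have -> : mean (P' t) = mean Y.
  rewrite -[RHS]addr0 -[X in _ = _ + X](mulr0 2) -Z.
  have [_ [_ _ _ k1 k2]] := PA.
  rewrite -meanZ; last by ct.
  rewrite -meanD//; last by ct.
  congr mean; apply/funext => x; rewrite /P' /Y /r1 /r2 D1 D2 /transport.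
  rewrite partial1_act// partial2_act//.
  move: (partial1 _ _) (partial2 _ _) (partial1 _ _) (partial2 _ _) (partial1 _ _) (partial2 _ _) (partial1 _ _) (partial2 _ _) (d t x).
  by move=> u1 u2 u3 u4 u5 u6 u7 u8 u9; case: (sy_e S) => ->; ring.
have S2 := Wp2_sup C w.
apply: (@le_trans _ _ (mean (fun x => 2 * L * d t x ^+ 2 + L * (r1 x ^+ 2 + r2 x ^+ 2)))).
  apply: mean_le => //; first by ct.
  move=> x _; have [_ s1 s2] := S2 x; rewrite /Y.
  move: (d t x) (r1 x) (r2 x) (partial1 _ _) (partial2 _ _) s1 s2 => z u v a b.
  rewrite !ler_norml => /andP[a3 a4] /andP[b3 b4].
  have := ler_norm (z * v * a); rewrite !normrM => z1.
  have := lerNnormlW (lexx `|z * u * b|); rewrite !normrM => z2.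
  have z3 := sqr_ge0 (`|z| - `|v|); have z4 := sqr_ge0 (`|z| - `|u|).
  have na : `|a| <= L by rewrite ler_norml a3.
  have nb : `|b| <= L by rewrite ler_norml b3.
  have y1 : `|z| * `|v| * `|a| <= `|z| * `|v| * L by rewrite ler_wpM2l// mulr_ge0.
  have y2 : `|z| * `|u| * `|b| <= `|z| * `|u| * L by rewrite ler_wpM2l// mulr_ge0.
  have y3 := mulr_ge0 L0 z3; have y4 := mulr_ge0 L0 z4.
  rewrite -(real_normK (num_real z)) -(real_normK (num_real u)) -(real_normK (num_real v)).
  move: y1 y2 y3 y4 z1 z2; move: (`|z|) (`|u|) (`|v|) (`|a|) (`|b|) => nz nu nv n1 n2.
  lra.
rewrite meanD; [|by ct|by ct]; rewrite !meanZ; [|by ct|by ct].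
rewrite meanD; [|by ct|by ct].
have := ler_wpM2l L0 (mean_grad_psi t0 w); rewrite -/r1 -/r2.
by move: (mean _) (mean _) (mean _) => u v z; lra.
Qed.

(** Both sides solve the equation with the same datum; the mean square of the
    difference obeys Gronwall's inequality. *)
Lemma flow_sym t x : 0 <= t -> th t (act x) = th t x.
Proof.
move=> t0; have t1 : t <= t by [].
have [L L0 HL] := fl_bound F t.
have D0 : mean (fun x => d 0 x ^+ 2) = 0.
  rewrite (_ : (fun x => _) = fun=> 0) ?mean_cst//.
  by apply/funext => y; rewrite /d F0 subrr expr0n.
have Z : mean (fun x => d t x ^+ 2) = 0.
  apply: (@gronwall0 _ (fun t => mean (fun x => d t x ^+ 2)) (fun t => mean (P' t)) (3 * L) t) => //.
  - by rewrite mulr_ge0.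
  - by move=> s; apply: mean_ge0 => y; exact: sqr_ge0.
  - move=> r r0; pose r' := Num.min 1 (r / 4).
    have r'0 : 0 < r' by rewrite lt_min ltr01/= divr_gt0.
    have r'1 : r' <= 1 by rewrite ge_min lexx.
    have r'2 : r' <= r / 4 by rewrite ge_min lexx orbT.
    have [q q0 Hq] := fl_sup0 F r'0; exists q => // s s0 sq; rewrite D0 subr0.
    have h := C1per_cd s0; apply: mean_norm_le; first by ct.
    move=> y; have h1 := Hq s s0 sq y; have h2 := Hq s s0 sq (act y).
    have hd : `|d s y| <= 2 * r'.
      have -> : d s y = (th s y - th 0 y) - (th s (act y) - th 0 (act y)).
        by rewrite /d F0; ring.
      by rewrite (le_trans (ler_normB _ _))//; lra.
    rewrite normrX expr2; apply: le_trans (ler_pM _ _ hd hd) _ => //.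
    by nra.
  - by move=> s s0 _; exact: diff_derive.
  - by move=> s s0 st; apply: diff_ineq => //; apply: HL => //; exact: ltW.
apply/eqP; rewrite eq_sym -subr_eq0; apply/eqP.
have cd := C1per_cd t0.
have b K : mpart K (d t) <= 0 by rewrite -Z; exact: bessel.
have zz k : al (d t) k = 0 /\ be (d t) k = 0.
  have kN : k \in box (maxn (absz k.1) (absz k.2)) by rewrite mem_box -geq_max.
  have := b (maxn (absz k.1) (absz k.2)).
  rewrite /mpart (bigD1_seq k) ?box_uniq//=; set S' := \sum_(_ <- _ | _) _.
  have S'0 : 0 <= S' by apply: sumr_ge0 => j _; rewrite addr_ge0 ?sqr_ge0.
  move=> h; have u2 := sqr_ge0 (al (d t) k); have v2 := sqr_ge0 (be (d t) k).
  by split; apply/eqP; rewrite -sqrf_eq0; apply/eqP; lra.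
by apply: (fourier_uniq (C1per_cper (C1per_d t0))) => k; have [] := zz k.
Qed.

Lemma flow_sym_coef t k : 0 <= t ->
  ua k * al (th t) k = al (th t) k /\ ub k * be (th t) k = be (th t) k.
Proof.
move=> t0; have [L L0 w] := fl_W F t0.
have [<- <-] := coef_act k (C1per_cper (fl_C1 F t0)) (Wp_le (leqnSn 1) w).
by split; congr mean; apply/funext => x; rewrite flow_sym.
Qed.

End flow_sym.
End act.
End Symmetry.

(** * Small perturbations of the shear flow *)

Section Static.
Context {R : realType}.
Local Notation X := (R * R)%type.
Local Notation Z2 := (int * int)%type.
Implicit Types (k l : Z2).
Local Notation il k := (inv_sqrt_laplacian_symbol k : R).

Definition e1 : Z2 := (1, 0).
Definition ismain k := (k == e1) || (k == - e1).

Lemma il_e1 : il e1 = 1.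
Proof.
rewrite /inv_sqrt_laplacian_symbol /normk /sqnormk/=.
by rewrite expr1n expr0n addr0 sqrtr1 invr1.
Qed.

(** Such frequencies satisfy [|k| >= 2]. *)
Lemma il_half k : k != 0 -> ~~ odd (absz k.2) -> ~~ ismain k -> il k <= 2^-1.
Proof.
move=> k0 ko km; have s4 : 4 <= sqnormk k :> R.
  case: k k0 ko km => a b; rewrite /ismain /e1 /sqnormk/= -!rmorphXn/= -intrD.
  rewrite -[4]/(4%:~R) ler_int !xpair_eqE /= oppr0 => k0 ko km.
  have [b0|b0] := eqVneq b 0; last by have := sqr_ge0 a; nia.
  subst b; rewrite eqxx !andbT in k0 km.
  have : (2 <= a) || (a <= -2) by lia.
  by case/orP => ha; nia.
rewrite /inv_sqrt_laplacian_symbol (negPf k0) lef_pV2 ?posrE//.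
  have -> : 2 = Num.sqrt 4 :> R by rewrite (_ : 4 = 2 ^+ 2) ?sqrtr_sqr ?ger0_norm//; ring.
  exact: ler_wsqrtr.
by rewrite sqrtr_gt0 (lt_le_trans _ s4).
Qed.

(** Cauchy-Schwarz against the summable weight of [sum_inv_sqr]. *)
Lemma l1_l2 K (x : Z2 -> R) (Q : R) : \sum_(k <- box K) sq k ^+ 2 * x k ^+ 2 <= Q ->
  (\sum_(k <- box K) `|x k|) ^+ 2 <= 25 * Q.
Proof.
move=> H; rewrite (eq_bigr (fun k => (sq k)^-1 * (sq k * `|x k|))); last first.
  by move=> k _; rewrite mulKf// gt_eqF// sq_gt0.
apply: le_trans (sum_cauchy _ _ _) _.
apply: ler_pM.
- by apply: sumr_ge0 => k _; exact: sqr_ge0.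
- by apply: sumr_ge0 => k _; exact: sqr_ge0.
- by under eq_bigr do rewrite exprVn; exact: sum_inv_sqr.
- by under eq_bigr do rewrite exprMn real_normK ?num_real//.
Qed.

(** The initial datum: a large shear flow and a small perturbation of it whose
    average over [x2] vanishes. *)
Definition datum (al0 tau : R) (x : X) : R :=
  2 * al0 * cos x.1 + 4 * tau * (cos x.1 * cos (2 * x.2)).

(** What the conservation laws and the symmetries say at each time about the
    solution issued from [datum al0 tau]; [E0] is the conserved energy
    [\sum_k (1 - 1/|k|) |f_k|^2]. *)
Record perturbed (al0 nu tau E0 : R) (f : X -> R) : Prop := Perturbed {
  pt_tau : tau = nu ^+ 11;
  pt_nu0 : 0 < nu;
  pt_nu1 : nu <= 1;
  pt_E0l : 2 * tau ^+ 2 <= E0;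
  pt_E0u : E0 <= 4 * tau ^+ 2;
  pt_C1 : C1per f;
  pt_be : forall k, be f k = 0;
  pt_odd : forall k, odd (absz k.2) -> al f k = 0;
  pt_0 : al f 0 = 0;
  pt_energy : exists C : R, forall K, `|E0 - epart K f| <= C / K.+1%:R ^+ 2;
  pt_mass : exists C : R, forall K,
    `|2 * al0 ^+ 2 + 4 * tau ^+ 2 - mpart K f| <= C / K.+1%:R ^+ 2;
  pt_casimir : forall p : {poly R},
    mean (fun x => p.[f x]) = mean (fun x => p.[datum al0 tau x])
}.

Variables (f : X -> R) (E0 A al0 nu tau : R).
Hypothesis S : perturbed al0 nu tau E0 f.
Let tauE := pt_tau S.
Let nu0 := pt_nu0 S.
Let nu1 := pt_nu1 S.
Let E0u := pt_E0u S.
Let f_even := pt_be S.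
Let f_odd := pt_odd S.
Let f_0 := pt_0 S.
Let f_energy := pt_energy S.
Let f_mass := pt_mass S.

(** The coefficients off the main modes, where the weight of the energy is at
    least one half. *)
Definition vv k := if ismain k then 0 else al f k.
Local Notation ae := (al f e1).

Lemma vv_sqr_le k : vv k ^+ 2 <= al f k ^+ 2.
Proof. by rewrite /vv; case: ifP => // _; rewrite expr0n sqr_ge0. Qed.

Lemma vv_energy k : vv k ^+ 2 <= 2 * ((1 - il k) * (al f k ^+ 2 + be f k ^+ 2)).
Proof.
have w0 : 0 <= 1 - il k by rewrite subr_ge0 il_le1.
have pos : 0 <= 2 * ((1 - il k) * (al f k ^+ 2 + be f k ^+ 2)).
  by rewrite !mulr_ge0// addr_ge0 ?sqr_ge0.
rewrite /vv; case: ifPn => km; first by rewrite expr0n.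
have [k0|k0] := eqVneq k 0; first by rewrite k0 f_0 expr0n in pos *.
have [ko|ko] := boolP (odd (absz k.2)); first by rewrite (f_odd ko) expr0n in pos *.
have := il_half k0 ko km; rewrite f_even expr0n addr0; have := sqr_ge0 (al f k).
move: (al f k ^+ 2) (il k) => u z u0 z2; nra.
Qed.

(** The truncated energies increase to the energy. *)
Lemma epart_le K : epart K f <= E0.
Proof.
have [C HC] := f_energy; apply: (cvg_le_lim (cvg_inv_sqr C)) => n.
have := HC (maxn K n) => h.
have h2 : epart K f <= epart (maxn K n) f.
  apply: sumr_sub; [exact: box_uniq|exact: box_uniq|apply: box_sub; exact: leq_maxl|].
  by move=> k; rewrite mulr_ge0 ?subr_ge0 ?il_le1// addr_ge0 ?sqr_ge0.
apply: (le_trans h2); have C0 : 0 <= C.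
  by have := le_trans (normr_ge0 _) (HC 0%N); rewrite expr1n divr1.
have : C / (maxn K n).+1%:R ^+ 2 <= C / n.+1%:R ^+ 2.
  rewrite ler_wpM2l// lef_pV2 ?posrE ?exprn_gt0// lerXn2r ?nnegrE// ler_nat ltnS.
  exact: leq_maxr.
move: h; rewrite ler_norml => /andP[h _].
by move: h; set y := C / _; set z := C / _; set q := epart _ _; lra.
Qed.

Lemma vv_mass K : \sum_(k <- box K) vv k ^+ 2 <= 8 * tau ^+ 2.
Proof.
apply: (@le_trans _ _ (2 * epart K f)).
  rewrite /epart mulr_sumr; apply: ler_sum => k _; exact: vv_energy.
by have := epart_le K; have := E0u; lra.
Qed.

Lemma mpart_main K : (0 < K)%N -> mpart K f = 2 * ae ^+ 2 + \sum_(k <- box K) vv k ^+ 2.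
Proof.
move=> K0; rewrite /mpart.
rewrite (eq_bigr (fun k => (ae ^+ 2 * (k == e1)%:R + ae ^+ 2 * (k == - e1)%:R) + vv k ^+ 2)).
  by rewrite !big_split/= !sum_box_delta ?mem_boxN ?mem_box/= ?K0//; ring.
move=> k _; rewrite f_even expr0n addr0 /vv /ismain.
have [->|k1] := eqVneq k e1; first by rewrite /= expr0n mulr1 mulr0 !addr0.
have [->|k2] := eqVneq k (- e1); first by rewrite /= alN expr0n mulr1 mulr0 add0r addr0.
by rewrite /= !mulr0 !add0r.
Qed.

(** The mass is conserved, and only little of it is off the main modes. *)
Lemma ae_sqr : al0 ^+ 2 - 2 * tau ^+ 2 <= ae ^+ 2 /\ ae ^+ 2 <= al0 ^+ 2 + 2 * tau ^+ 2.
Proof.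
have [C HC] := f_mass.
set M0 : R := 2 * al0 ^+ 2 + 4 * tau ^+ 2 in HC *.
have H K : (0 < K)%N -> `|M0 - (2 * ae ^+ 2 + \sum_(k <- box K) vv k ^+ 2)| <= C / K.+1%:R ^+ 2.
  by move=> /mpart_main <-.
have c0 := cvg_inv_sqr C.
have V0 K : 0 <= \sum_(k <- box K) vv k ^+ 2 by apply: sumr_ge0 => k _; exact: sqr_ge0.
have h1 : M0 - 2 * ae ^+ 2 - 8 * tau ^+ 2 <= 0.
  apply: (cvg_le0 (N := 1%N) c0) => K /H; rewrite ler_norml => /andP[_].
  by have := vv_mass K; set y := C / _; set z := \sum_(_ <- _) _; lra.
have h2 : 2 * ae ^+ 2 - M0 <= 0.
  apply: (cvg_le0 (N := 1%N) c0) => K /H; rewrite ler_norml => /andP[+ _].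
  by have := V0 K; set y := C / _; set z := \sum_(_ <- _) _; lra.
by move: h1 h2; rewrite /M0; split; lra.
Qed.

Section bounded.
Hypotheses (A0 : 0 <= A) (fA : L2w 11 f A).
Local Notation B := (8 + A ^+ 2).
Local Notation b := (25 * (8 + A ^+ 2)).

Lemma al_L2w n K : (n <= 11)%N -> \sum_(k <- box K) sq k ^+ n * al f k ^+ 2 <= A ^+ 2.
Proof.
move=> n11; apply: le_trans (L2w_le n11 fA K); apply: ler_sum => k _.
by rewrite f_even expr0n addr0.
Qed.

(** One derivative bounds the energy outside of a box. *)
Lemma energy_tail K : E0 <= epart K f + A ^+ 2 / K.+1%:R ^+ 2.
Proof.
have [C HC] := f_energy; apply: (cvg_le_lim (cvg_inv_sqr C)) => n.
have := HC (maxn K n) => h.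
have h2 : epart (maxn K n) f - epart K f <= A ^+ 2 / K.+1%:R ^+ 2.
  apply: (sumr_tail (H := fun k => sq k * al f k ^+ 2)); [exact: box_uniq|exact: box_uniq| | | | |].
  - by apply: box_sub; exact: leq_maxl.
  - by rewrite exprn_gt0.
  - move=> k kK; rewrite f_even expr0n addr0 mulrA ler_wpM2r ?sqr_ge0//.
    rewrite -[leRHS]mulr1 ler_pM ?subr_ge0 ?il_le1 ?exprn_ge0 ?sq_out//.
    by rewrite gerBl il_ge0.
  - by move=> k; rewrite mulr_ge0 ?sqr_ge0 ?(ltW (sq_gt0 k)).
  - exact: (@al_L2w 1).
have C0 : 0 <= C.
  by have := le_trans (normr_ge0 _) (HC 0%N); rewrite expr1n divr1.
have : C / (maxn K n).+1%:R ^+ 2 <= C / n.+1%:R ^+ 2.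
  rewrite ler_wpM2l// lef_pV2 ?posrE ?exprn_gt0// lerXn2r ?nnegrE// ler_nat ltnS.
  exact: leq_maxr.
move: h; rewrite ler_norml => /andP[_ h].
by move: h h2; set y := C / _; set z := C / _; set q := epart _ _; set q' := epart _ _; set u := _ / _; lra.
Qed.

(** Interpolation: where [nu^2 * sq k <= 1] the factor on the left is at most 1
    and [vv_mass] applies; elsewhere it is at most [(nu^2 * sq k)^11], and
    [nu^22 = tau^2]. *)
Lemma vv_interp p K : (p <= 11)%N ->
  nu ^+ (p.*2) * \sum_(k <- box K) sq k ^+ p * vv k ^+ 2 <= B * tau ^+ 2.
Proof.
move=> p11; rewrite mulr_sumr.
apply: (@le_trans _ _ (\sum_(k <- box K) (vv k ^+ 2 + tau ^+ 2 * (sq k ^+ 11 * al f k ^+ 2)))).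
  apply: ler_sum => k _.
  have -> : nu ^+ p.*2 * (sq k ^+ p * vv k ^+ 2) = (nu ^+ 2 * sq k) ^+ p * vv k ^+ 2.
    by rewrite exprMn -exprM mul2n; ring.
  have z0 : 0 <= nu ^+ 2 * sq k by rewrite mulr_ge0 ?sqr_ge0// ltW// sq_gt0.
  have -> : tau ^+ 2 * (sq k ^+ 11 * al f k ^+ 2) = (nu ^+ 2 * sq k) ^+ 11 * al f k ^+ 2.
    by rewrite tauE; move: (sq k) (al f k) => u z; ring.
  have v2 := vv_sqr_le k; have v0 := sqr_ge0 (vv k); have a0 := sqr_ge0 (al f k).
  have [zz|zz] := leP (nu ^+ 2 * sq k) 1.
    rewrite -[leLHS]addr0; apply: lerD; last by apply: mulr_ge0 => //; exact: exprn_ge0.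
    by rewrite -[leRHS]mul1r; apply: ler_wpM2r => //; exact: exprn_ile1.
  rewrite -[leLHS]add0r; apply: lerD => //; apply: ler_pM => //; first exact: exprn_ge0.
  by rewrite ler_weXn2l// ltW.
rewrite big_split/= -mulr_sumr mulrDl lerD ?vv_mass// mulrC ler_wpM2r ?sqr_ge0//.
exact: al_L2w.
Qed.

Lemma B_ge8 : 8 <= B. Proof. by rewrite lerDl sqr_ge0. Qed.

(** The total exponent is eleven because [tau = nu^11]. *)
Lemma sum_vv_le (m q : nat) K (c : Z2 -> R) : (m + q = 11)%N ->
  (forall k, sq k ^+ 2 * c k ^+ 2 <= sq k ^+ m) ->
  \sum_(k <- box K) `|c k * vv k| <= b * nu ^+ q.
Proof.
move=> mq Hc; have B8 := B_ge8.
rewrite -(@ler_pXn2r _ 2)// ?nnegrE; last 2 first.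
- by apply: sumr_ge0.
- by rewrite mulr_ge0 ?exprn_ge0// ?(ltW nu0)//; lra.
have H : \sum_(k <- box K) sq k ^+ 2 * (c k * vv k) ^+ 2 <= B * nu ^+ q.*2.
  apply: (@le_trans _ _ (\sum_(k <- box K) sq k ^+ m * vv k ^+ 2)).
    by apply: ler_sum => k _; rewrite exprMn mulrA ler_wpM2r ?sqr_ge0.
  have m11 : (m <= 11)%N by rewrite -mq leq_addr.
  have := vv_interp K m11; have -> : tau ^+ 2 = nu ^+ m.*2 * nu ^+ q.*2.
    by rewrite tauE -exprD -doubleD mq -exprM.
  by rewrite (mulrCA B) ler_pM2l// exprn_gt0.
apply: le_trans (l1_l2 H) _.
rewrite exprMn -exprM muln2 mulrA ler_wpM2r ?exprn_ge0 ?(ltW nu0)//.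
by nra.
Qed.

Lemma sum_vv0 K : \sum_(k <- box K) `|vv k| <= b * nu ^+ 9.
Proof.
have := @sum_vv_le 2 9 K (fun=> 1) erefl; under eq_bigr do rewrite mul1r.
by apply => k; rewrite expr1n mulr1.
Qed.

Lemma sum_vv_k1 K : \sum_(k <- box K) `|k.1%:~R * vv k| <= b * nu ^+ 8.
Proof.
apply: (@sum_vv_le 3 8) => // k; rewrite [leRHS]exprSr; apply: ler_wpM2l; first by rewrite exprn_ge0// ltW// sq_gt0.
by rewrite /sq /sqnormk addrCA lerDl addr_ge0 ?sqr_ge0.
Qed.

Lemma sum_vv_k2 K : \sum_(k <- box K) `|k.2%:~R * vv k| <= b * nu ^+ 8.
Proof.
apply: (@sum_vv_le 3 8) => // k; rewrite [leRHS]exprSr; apply: ler_wpM2l; first by rewrite exprn_ge0// ltW// sq_gt0.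
by rewrite /sq /sqnormk addrA lerDr addr_ge0 ?sqr_ge0.
Qed.

Lemma sum_vv1 K : \sum_(k <- box K) `|sq k * vv k| <= b * nu ^+ 7.
Proof. by apply: (@sum_vv_le 4 7) => // k; rewrite -exprD. Qed.

End bounded.
End Static.

(** * Chebyshev polynomials *)

Section Chebyshev.
Context {R : realType}.

Fixpoint cheb (n : nat) : {poly R} :=
  match n with
  | 0 => 1
  | n1.+1 => match n1 with
    | 0 => 'X
    | n2.+1 => 2%:P * 'X * cheb n1 - cheb n2
    end
  end.

Lemma chebE n x : (cheb n).[cos x] = cos (n%:R * x).
Proof.
suff : (cheb n).[cos x] = cos (n%:R * x) /\ (cheb n.+1).[cos x] = cos (n.+1%:R * x) by case.
elim: n => [|n [IH1 IH2]].
  by rewrite /= mul0r cos0 hornerC hornerX mul1r.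
split; first exact: IH2.
have -> : cheb n.+2 = 2%:P * 'X * cheb n.+1 - cheb n by [].
rewrite !hornerE IH1 IH2.
have -> : n.+2%:R * x = n.+1%:R * x + x by rewrite -[in LHS]natr1 mulrDl mul1r.
have {1}-> : n%:R * x = n.+1%:R * x - x by rewrite -[in RHS]natr1 mulrDl mul1r addrK.
by rewrite cosB cosD; ring.
Qed.

Lemma sin_nat_le n (x : R) : `|sin (n%:R * x)| <= n%:R * `|sin x|.
Proof.
elim: n => [|n IH]; first by rewrite !mul0r sin0 normr0.
rewrite -natr1 !mulrDl !mul1r sinD (le_trans (ler_normD _ _))//.
apply: lerD; rewrite normrM.
  by rewrite (le_trans _ IH)// -[leRHS]mulr1 ler_wpM2l// cos_max.
by rewrite -[leRHS]mul1r ler_wpM2r// cos_max.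
Qed.

Lemma cos_diff (a b : R) :
  cos a - cos b = - (2 * (sin ((a + b) / 2) * sin ((a - b) / 2))).
Proof.
have H (u v : R) : cos (u + v) - cos (u - v) = - (2 * (sin u * sin v)).
  by rewrite cosD cosB; ring.
by rewrite -H; congr (cos _ - cos _); field.
Qed.

(** On the angle, [T_n] is [cos (n u)], whose increments are products of two
    sines, each at most [n] times the sine for [n = 1]. *)
Lemma cheb_lip n (y z : R) : `|y| <= 1 -> `|z| <= 1 ->
  `|(cheb n).[y] - (cheb n).[z]| <= n%:R ^+ 2 * `|y - z|.
Proof.
move=> hy hz; have {}hy : -1 <= y <= 1 by rewrite -ler_norml.
have {}hz : -1 <= z <= 1 by rewrite -ler_norml.
have -> : y = cos (acos y) by rewrite acosK// in_itv.
have -> : z = cos (acos z) by rewrite acosK// in_itv.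
rewrite !chebE !cos_diff !normrN !normrM ger0_norm//.
have -> : (n%:R * acos y + n%:R * acos z) / 2 = n%:R * ((acos y + acos z) / 2) by ring.
have -> : (n%:R * acos y - n%:R * acos z) / 2 = n%:R * ((acos y - acos z) / 2) by ring.
have := sin_nat_le n ((acos y + acos z) / 2); have := sin_nat_le n ((acos y - acos z) / 2).
move=> h1 h2; rewrite [leRHS]mulrCA; apply: ler_wpM2l => //.
by rewrite expr2 mulrACA; apply: ler_pM.
Qed.

Definition primitive_poly (q : {poly R}) : {poly R} :=
  \poly_(i < (size q).+1) (q`_i.-1 / i%:R).

Lemma primitive_polyE q : (primitive_poly q)^`() = q.
Proof.
apply/polyP => i; rewrite coef_deriv coef_poly ltnS.
case: ltnP => iq /=; last by rewrite mul0rn nth_default.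
by rewrite -[LHS]mulr_natr divfK// pnatr_eq0.
Qed.

(** The mean value theorem: the derivative [q] moves by at most [kap * |y - z|]. *)
Lemma primitive_taylor (q : {poly R}) (kap b y z : R) :
  (forall u v : R, `|u| <= b -> `|v| <= b -> `|q.[u] - q.[v]| <= kap * `|u - v|) ->
  `|y| <= b -> `|z| <= b -> 0 <= kap ->
  `|(primitive_poly q).[y] - (primitive_poly q).[z] - q.[z] * (y - z)| <= kap * (y - z) ^+ 2.
Proof.
move=> lip yb zb k0; set F := primitive_poly q.
have dF (x : R) : is_derive x 1 (horner F) q.[x].
  by have := is_derive_poly F x; rewrite primitive_polyE.
have step u : `|u - z| <= `|y - z| -> `|u| <= b -> F.[y] - F.[z] = q.[u] * (y - z) ->
    `|F.[y] - F.[z] - q.[z] * (y - z)| <= kap * (y - z) ^+ 2.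
  move=> uz ub ->; rewrite -mulrBl normrM -[(y - z) ^+ 2]real_normK ?num_real// expr2 mulrA.
  rewrite ler_wpM2r// (le_trans (lip _ _ ub zb))// ler_wpM2l//.
have bb (u v w : R) : u <= w -> w <= v -> `|u| <= b -> `|v| <= b -> `|w| <= b.
  by rewrite !ler_norml => h1 h2 /andP[h3 h4] /andP[h5 h6]; lra.
have [zy|yz] := leP z y.
  have [c [c1 c2 E]] := mvt_itv zy (fun x _ _ => dF x).
  apply: (step c) => //; last exact: bb c1 c2 zb yb.
  by rewrite !ger0_norm ?subr_ge0// lerD2r.
have [c [c1 c2 E]] := mvt_itv (ltW yz) (fun x _ _ => dF x).
apply: (step c) => //; first last.
- by rewrite -[LHS]opprB E -mulrN opprB.
- exact: bb c1 c2 yb zb.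
- by rewrite !ler0_norm ?subr_le0 ?(ltW yz)// lerN2 lerD2r.
Qed.

End Chebyshev.

(** * Splitting off the main modes *)

Section MainMode.
Context {R : realType}.
Local Notation X := (R * R)%type.
Local Notation Z2 := (int * int)%type.
Implicit Types (k l : Z2).
Local Notation il k := (inv_sqrt_laplacian_symbol k : R).

Lemma C1per_cs k (r : R) : C1per (fun x => r * cs k x).
Proof.
have D1 (x : X) : is_derive x.1 1 (fun y : R => r * cs k (y, x.2)) (r * (- k.1%:~R * sn k x)).
  by have h := is_derive_cs1 k x; apply: is_derive_eq; rewrite /GRing.scale/=; ring.
have D2 (x : X) : is_derive x.2 1 (fun y : R => r * cs k (x.1, y)) (r * (- k.2%:~R * sn k x)).
  by have h := is_derive_cs2 k x; apply: is_derive_eq; rewrite /GRing.scale/=; ring.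
split; first by move=> x; have [-> ->] := cs_periodic k x.
split.
- by ct.
- by move=> x; have h := D1 x; exact: ex_derive.
- by move=> x; have h := D2 x; exact: ex_derive.
- rewrite (_ : partial1 _ = fun x => r * (- k.1%:~R * sn k x)); first by ct.
  by apply/funext => x; rewrite /partial1 derive1E; have h := D1 x; apply: derive_val.
- rewrite (_ : partial2 _ = fun x => r * (- k.2%:~R * sn k x)); first by ct.
  by apply/funext => x; rewrite /partial2 derive1E; have h := D2 x; apply: derive_val.
Qed.

Lemma coef_scs l (r : R) k :
  al (fun x => 2 * r * cs l x) k = r * ((k == l)%:R + (k == - l)%:R) /\
  be (fun x => 2 * r * cs l x) k = 0.
Proof.
split.
  rewrite /al (_ : (fun x => _) = fun x => 2 * r * (cs l x * cs k x)); last first.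
    by apply/funext => x; rewrite mulrA.
  rewrite meanZ; last by ct.
  by rewrite -/(al (cs l) k) al_cs; field.
rewrite /be (_ : (fun x => _) = fun x => 2 * r * (cs l x * sn k x)); last first.
  by apply/funext => x; rewrite mulrA.
rewrite meanZ; last by ct.
by rewrite -/(be (cs l) k) be_cs mulr0.
Qed.

Variables (f : X -> R) (E0 A al0 nu tau : R).
Hypothesis S : perturbed al0 nu tau E0 f.
Hypotheses (A0 : 0 <= A) (fA : L2w 11 f A).
Local Notation b := (25 * (8 + A ^+ 2)).
Local Notation ae := (al f e1).
Local Notation vv := (vv f).

Definition offmain (x : X) : R := f x - 2 * ae * cs e1 x.

Lemma C1per_off : C1per offmain.
Proof. by apply: C1perB; [exact: pt_C1 S|exact: C1per_cs]. Qed.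

Lemma coef_off k : al offmain k = vv k /\ be offmain k = 0.
Proof.
have [_ cf] := C1per_cper (pt_C1 S).
have cg : continuous (fun x : X => 2 * ae * cs e1 x) by ct.
rewrite /offmain alB// beB//; have [-> ->] := coef_scs e1 ae k.
rewrite (pt_be S) subrr; split=> //.
rewrite /vv /ismain; have [->|k1] := eqVneq k e1; first by rewrite /= addr0 mulr1 subrr.
have [->|k2] := eqVneq k (- e1); first by rewrite /= alN add0r mulr1 subrr.
by rewrite /= addr0 mulr0 subr0.
Qed.

Lemma am_off k : am offmain k = `|vv k|.
Proof. by rewrite /am; have [-> ->] := coef_off k; rewrite normr0 addr0. Qed.

Lemma Wp_off : Wp 1 offmain (8 * A).
Proof.
apply: l2_Wp => // K; apply: le_trans (L2w_le (isT : 4 <= 11)%N fA K).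
apply: ler_sum => k _; rewrite ler_wpM2l ?exprn_ge0 ?(ltW (sq_gt0 k))//.
have [-> ->] := coef_off k; rewrite expr0n addr0 (le_trans (vv_sqr_le f k))//.
by rewrite lerDl sqr_ge0.
Qed.

Lemma off_sup x : `|offmain x| <= b * nu ^+ 9.
Proof.
apply: (sup_le_am (C1per_cper C1per_off) (Wp_W1 Wp_off)) => K.
by under eq_bigr do rewrite am_off; exact: (sum_vv0 S fA K).
Qed.

Lemma f_off x : f x = 2 * ae * cos x.1 + offmain x.
Proof. by rewrite /offmain /cs /phase/= mul0r mul1r addr0; ring. Qed.

Hypotheses (al00 : 0 < al0) (ae0 : 0 < ae).

Lemma ae_near : `|ae - al0| <= 2 * tau ^+ 2 / al0.
Proof.
have [h1 h2] := ae_sqr S; rewrite ler_pdivlMr//.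
have t0 := sqr_ge0 tau.
have a0 := al00; have a1 := ae0.
have [h|h] := leP al0 ae.
  rewrite ger0_norm ?subr_ge0//; nra.
rewrite ltr0_norm ?subr_lt0//; nra.
Qed.

End MainMode.

(** * Casimirs and the modes of shear flows *)

Section Casimir.
Context {R : realType}.
Local Notation X := (R * R)%type.
Local Notation Z2 := (int * int)%type.
Implicit Types (k l : Z2).
Variables (f : X -> R) (E0 A al0 nu tau : R).
Hypothesis S : perturbed al0 nu tau E0 f.
Hypotheses (A0 : 0 <= A) (fA : L2w 11 f A).
Local Notation b := (25 * (8 + A ^+ 2)).
Local Notation ae := (al f e1).
Local Notation vv := (vv f).
Hypotheses (al00 : 0 < al0) (ae0 : 0 < ae).

Definition shear (x : X) : R := 2 * al0 * cos x.1.
(** The modes of shear flows, on which the virial gives no information. *)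
Definition zmode (n : nat) : Z2 := (n%:Z, 0).

Lemma ct_horner (p : {poly R}) (h : X -> R) : continuous h -> continuous (fun x => p.[h x]).
Proof. by move=> ch x; apply: (@continuous_comp _ _ _ h (horner p)); [exact: ch|exact: continuous_horner]. Qed.

Lemma ct_shear : continuous shear.
Proof. by rewrite /shear; ct. Qed.

Lemma ct_datum : continuous (datum al0 tau).
Proof. by rewrite /datum; ct. Qed.

Lemma cs_zmode n x : cs (zmode n) x = cos (n%:R * x.1) :> R.
Proof. by rewrite /cs /phase/= mul0r addr0. Qed.

Lemma shear_cs x : shear x = 2 * al0 * cs e1 x.
Proof. by rewrite /shear /cs /phase/= mul1r mul0r addr0. Qed.

Let cf : continuous f.
Proof. by have [_] := C1per_cper (pt_C1 S). Qed.

(** The perturbation averages to zero along the streamlines of the shear flow,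
    hence is orthogonal to every function of [shear]. *)
Lemma datum_orth (q : {poly R}) :
  mean (fun x => q.[shear x] * (datum al0 tau x - shear x)) = 0.
Proof.
have cq : continuous (fun x => q.[shear x]).
  exact/ct_horner/ct_shear.
rewrite (_ : (fun x => _) = fun x => (q.[shear x] * (4 * tau * cos x.1)) * cos (2 * x.2)); last first.
  by apply/funext => x; rewrite /datum -/(shear x); ring.
apply: (@mean_derive2 _ (fun x : X => q.[shear x] * (4 * tau * cos x.1) * (2^-1 * sin (2 * x.2)))).
- move=> x; congr (_ * (_ * _)); rewrite mulrDr /=.
  by have := @periodic_int R sin (pi *+ 2) (@sinD2pi R) 2 (2 * x.2).
- by move=> x; rewrite /shear/=; apply: is_derive_eq; rewrite /GRing.scale/=; field.
- by ct.
Qed.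

Lemma mean_f2 : mean (fun x => f x ^+ 2) = 2 * al0 ^+ 2 + 4 * tau ^+ 2.
Proof.
have w : Wp 1 f (8 * A) by apply: l2_Wp => //; exact: (L2w_le (isT : 4 <= 11)%N fA).
have [C HC] := pt_mass S; apply/eqP; rewrite -subr_eq0 -normr_le0.
have e0 : (fun K : nat => 8 * A * (8 * A / K.+1%:R ^+ 2) + C / K.+1%:R ^+ 2) @ \oo --> 0.
  have -> : 0 = 8 * A * 0 + 0 :> R by rewrite mulr0 addr0.
  by apply: cvgD; [apply: cvgM; [exact: cvg_cst|exact: cvg_inv_sqr]|exact: cvg_inv_sqr].
apply: (cvg_le0 (N := 0%N) e0) => K _.
have h1 := mass_rate K (C1per_cper (pt_C1 S)) w; have h2 := HC K.
rewrite -(subrKA (mpart K f)) (le_trans (ler_normD _ _))// lerD//.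
by rewrite distrC.
Qed.

(** The conservation of mass determines the square term, and [ae_near] bounds
    the cross term. *)
Lemma mean_off_shear : mean (fun x => (f x - shear x) ^+ 2) <= 12 * tau ^+ 2.
Proof.
have -> : mean (fun x => (f x - shear x) ^+ 2) = 4 * al0 * (al0 - ae) + 4 * tau ^+ 2.
  rewrite (_ : (fun x => _) = fun x => f x ^+ 2 - 4 * al0 * (f x * cs e1 x) + 4 * al0 ^+ 2 * (cs e1 x * cs e1 x)); last first.
    by apply/funext => x; rewrite shear_cs; ring.
  rewrite meanD; [|by ct|by ct]; rewrite meanB; [|by ct|by ct].
  rewrite !meanZ; [|by ct|by ct].
  rewrite mean_f2 -/(al f e1) -/(al (cs e1) e1) al_cs eqxx.
  have -> : (e1 == - e1) = false by [].
  rewrite (_ : true%:R = 1 :> R)// (_ : false%:R = 0 :> R)//.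
  by field.
have := ae_near S al00 ae0; rewrite ler_pdivlMr// => h.
have a0 := al00; have t0 := sqr_ge0 tau.
have : (al0 - ae) * al0 <= `|ae - al0| * al0.
  by rewrite ler_wpM2r ?(ltW a0)// distrC ler_norm.
lra.
Qed.

Hypothesis small1 : nu * (4 / al0 + b) <= 1.
Hypothesis small2 : nu * (8 * 29 * b / al0) <= 1.

Let n0 := pt_nu0 S.

Lemma b_ge : 200 <= b.
Proof. by have := sqr_ge0 A; lra. Qed.

Lemma tau_small : 4 * tau ^+ 2 / al0 + b * nu ^+ 9 <= nu ^+ 8.
Proof.
have nu1 := pt_nu1 S; have nn := n0; rewrite (pt_tau S).
have h8 : 0 <= nu ^+ 8 by rewrite exprn_ge0// ltW.
have h : (nu ^+ 11) ^+ 2 <= nu ^+ 8 * nu.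
  by rewrite -exprM -exprSr ler_wiXn2l// ltW.
have a0 : 0 <= al0^-1 by rewrite invr_ge0 ltW.
have := ler_wpM2l h8 small1; rewrite mulr1 => hs.
have h9 : 4 * (nu ^+ 11) ^+ 2 / al0 <= 4 * (nu ^+ 8 * nu) / al0.
  by rewrite ler_wpM2r// ler_wpM2l.
by rewrite (exprSr nu 8); lra.
Qed.

Lemma off_shear_sup x : `|f x - shear x| <= nu ^+ 8.
Proof.
have h1 := ae_near S al00 ae0; have h2 := off_sup S A0 fA x.
rewrite (f_off f) /shear.
have -> : 2 * ae * cos x.1 + offmain f x - 2 * al0 * cos x.1 =
  2 * (ae - al0) * cos x.1 + offmain f x by ring.
rewrite (le_trans (ler_normD _ _))// (le_trans _ tau_small)// lerD//.
rewrite normrM -[leRHS]mulr1 ler_pM ?cos_max//.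
by rewrite normrM ger0_norm//; lra.
Qed.

Lemma nu_le : nu <= 200^-1.
Proof.
have hb := b_ge; have a0 : 0 <= 4 / al0 by rewrite divr_ge0// ltW.
have nn := n0; have s1 := small1; nra.
Qed.

Local Notation bb := (2 * al0 + nu ^+ 8).

Lemma nu8_gt0 : 0 < nu ^+ 8. Proof. by rewrite exprn_gt0. Qed.

Lemma shear_sup x : `|shear x| <= 2 * al0.
Proof.
have a0 := al00; rewrite /shear normrM ger0_norm; last by lra.
by rewrite -[leRHS]mulr1 ler_wpM2l ?cos_max//; lra.
Qed.

Lemma f_sup x : `|f x| <= bb.
Proof. exact: ler_norm_add (off_shear_sup x) (shear_sup x). Qed.

Lemma datum_shear_sup x : `|datum al0 tau x - shear x| <= 4 * tau.
Proof.
have t0 : 0 <= tau by rewrite (pt_tau S) exprn_ge0// ltW.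
rewrite /datum /shear addrAC subrr add0r normrM ger0_norm; last by rewrite mulr_ge0.
rewrite -[leRHS]mulr1 ler_wpM2l ?mulr_ge0// normrM.
by rewrite -[leRHS]mulr1 ler_pM// cos_max.
Qed.

Lemma datum_sup x : `|datum al0 tau x| <= bb.
Proof.
apply: le_trans (ler_norm_add (datum_shear_sup x) (shear_sup x)) _.
rewrite lerD2l (pt_tau S); have h := nu_le; have nn := n0.
rewrite (exprD nu 8 3) mulrCA -[leRHS]mulr1 ler_wpM2l ?(ltW nu8_gt0)//.
have : nu ^+ 3 <= 200^-1 ^+ 3 by rewrite lerXn2r ?nnegrE ?(ltW nn)// invr_ge0.
lra.
Qed.

Lemma zmode_big n : (2 <= n)%N -> ismain (zmode n) = false.
Proof. by move=> n2; rewrite /ismain /zmode /e1 !xpair_eqE/=; lia. Qed.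

Lemma al_shear n : (2 <= n)%N -> al shear (zmode n) = 0.
Proof.
move=> n2; rewrite (_ : shear = fun x => 2 * al0 * cs e1 x); last first.
  by apply/funext => x; rewrite shear_cs.
have [-> _] := coef_scs e1 al0 (zmode n).
have := zmode_big n2; rewrite /ismain => /norP[/negPf -> /negPf ->].
by rewrite addr0 mulr0.
Qed.

Lemma mean_norm_mean_le (h g : X -> R) : continuous h -> continuous g ->
  (forall x, `|h x| <= g x) -> `|mean h| <= mean g.
Proof.
move=> ch cg hg; rewrite ler_norml -meanN//; apply/andP; split.
  by apply: mean_le => //; [exact: ctN|move=> x _; have := hg x; rewrite ler_norml => /andP[]].
by apply: mean_le => // x _; have := hg x; rewrite ler_norml => /andP[].
Qed.

Section fixedK.
Variable K : nat.
Local Notation a n := (al f (zmode n)).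

(** At the shear flow, [cheb n \Po (bb^-1 *: 'X)] is close to [cos (n x1)], so
    [zpoly] is close to the part of the solution to be bounded. The constant
    [bb] is slightly larger than the amplitude [2 al0] in order to bound the
    solution as well. *)
Definition zpoly : {poly R} :=
  \sum_(2 <= n < K.+1) a n *: (cheb n \Po (bb^-1 *: 'X)).

Definition zlip : R := (\sum_(2 <= n < K.+1) `|a n| * n%:R ^+ 2) / bb.

Lemma bb_gt0 : 0 < bb. Proof. by have := nu8_gt0; have := al00; lra. Qed.

Lemma zpolyE y : zpoly.[y] = \sum_(2 <= n < K.+1) a n * (cheb n).[y / bb].
Proof.
rewrite /zpoly horner_sum; apply: eq_bigr => n _.
by rewrite hornerZ horner_comp hornerZ hornerX mulrC (mulrC _ y) mulrC.
Qed.

Lemma zpoly_lip u v : `|u| <= bb -> `|v| <= bb ->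
  `|zpoly.[u] - zpoly.[v]| <= zlip * `|u - v|.
Proof.
have b0 := bb_gt0; move=> hu hv; rewrite !zpolyE -sumrB.
have q (y : R) : `|y| <= bb -> `|y / bb| <= 1.
  by move=> h; rewrite normrM normfV (gtr0_norm b0) ler_pdivrMr// mul1r.
rewrite (le_trans (ler_norm_sum _ _ _))// /zlip mulrAC mulr_suml mulr_suml.
apply: ler_sum => n _; rewrite -mulrBr normrM -!mulrA ler_wpM2l//.
apply: (le_trans (cheb_lip n (q _ hu) (q _ hv))).
by rewrite -mulrBl normrM normfV (gtr0_norm b0) expr2 -!mulrA.
Qed.

Lemma zlip_ge0 : 0 <= zlip.
Proof.
apply: divr_ge0; last exact: ltW bb_gt0.
by apply: sumr_ge0 => n _; rewrite mulr_ge0// exprn_ge0.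
Qed.

Lemma zlip_le : zlip <= b * nu ^+ 7 / (2 * al0).
Proof.
have a0 := al00; have b0 := bb_gt0; have n8 := nu8_gt0.
have bn0 : 0 <= b * nu ^+ 7 by have := b_ge; move=> hb; rewrite mulr_ge0 ?exprn_ge0 ?(ltW n0)//; lra.
apply: (@le_trans _ _ (b * nu ^+ 7 / bb)); last first.
  by rewrite ler_wpM2l// lef_pV2 ?posrE//; lra.
rewrite ler_wpM2r ?invr_ge0 ?(ltW b0)//.
apply: le_trans (sum_vv1 S fA K).
pose s := [seq zmode n | n <- index_iota 2 K.+1].
have -> : \sum_(2 <= n < K.+1) `|a n| * n%:R ^+ 2 = \sum_(k <- s) `|al f k| * `|k.1%:~R| ^+ 2.
  rewrite big_map; apply: eq_bigr => n _ /=.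
  by rewrite -pmulrn normr_nat.
apply: (@le_trans _ _ (\sum_(k <- s) `|sq k * vv k|)).
  rewrite big_seq [leRHS]big_seq; apply: ler_sum => k /mapP[n].
  rewrite mem_index_iota => /andP[n2 _] ->.
  rewrite /vv zmode_big// (normrM (sq _)) mulrC; apply: ler_wpM2r => //.
  rewrite ger0_norm ?(ltW (sq_gt0 _))// real_normK ?num_real//.
  by rewrite /sq /sqnormk/= expr0n addr0 lerDr.
apply: sumr_sub; [|exact: box_uniq| |by []].
  by rewrite map_inj_uniq ?iota_uniq// => m n [].
move=> k /mapP[n]; rewrite mem_index_iota => /andP[_ nK] ->.
by rewrite mem_box /zmode/=; lia.
Qed.

(** A primitive of [zpoly] has the same mean at [f] and at the datum. Expand
    both at the shear flow: the first-order term of the datum vanishes by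
    [datum_orth] and the second-order terms are of order [tau^2]. *)
Lemma casimir_orth :
  `|mean (fun x => zpoly.[shear x] * (f x - shear x))| <= 28 * zlip * tau ^+ 2.
Proof.
set P := primitive_poly zpoly.
have cs := ct_shear; have cd := ct_datum; have k0 := zlip_ge0.
have c1 := ct_horner (p := P) cf; have c2 := ct_horner (p := P) cs; have c3 := ct_horner (p := P) cd.
have c4 := ct_horner (p := zpoly) cs.
have sh x : `|shear x| <= bb by rewrite (le_trans (shear_sup x))// lerDl ltW// nu8_gt0.
have T (g : X -> R) (M : R) : continuous g -> continuous (fun x => P.[g x]) ->
    (forall x, `|g x| <= bb) -> mean (fun x => (g x - shear x) ^+ 2) <= M ->
  `|mean (fun x => P.[g x]) - mean (fun x => P.[shear x]) -
    mean (fun x => zpoly.[shear x] * (g x - shear x))| <= zlip * M.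
  move=> cg cPg gb gM; apply: (@le_trans _ _ (zlip * mean (fun x => (g x - shear x) ^+ 2))); last first.
    by rewrite ler_wpM2l.
  rewrite -!meanB; [|by ct|by ct|by ct|by ct].
  rewrite -meanZ; last by ct.
  apply: mean_norm_mean_le; [by ct|by ct|].
  by move=> x; apply: (primitive_taylor zpoly_lip).
have t1 := T f _ cf c1 f_sup mean_off_shear.
have t2 := T (datum al0 tau) (16 * tau ^+ 2) cd c3 datum_sup.
rewrite datum_orth subr0 in t2.
have {}t2 := t2 _; rewrite -(pt_casimir S P) in t2.
have h16 : mean (fun x => (datum al0 tau x - shear x) ^+ 2) <= 16 * tau ^+ 2.
  rewrite -[leRHS]mean_cst; apply: mean_le; [by ct|by ct|].
  move=> x _; have -> : 16 * tau ^+ 2 = (4 * tau) ^+ 2 by ring.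
  have t0 : 0 <= tau by rewrite (pt_tau S) exprn_ge0// ltW.
  by rewrite -[leLHS]real_normK ?num_real// lerXn2r ?nnegrE ?datum_shear_sup// mulr_ge0.
have {h16}t2 := t2 h16; move: t1 t2.
set u := mean _; set v := mean _; set w := mean _.
rewrite !ler_norml => /andP[p1 p2] /andP[p3 p4].
by apply/andP; split; lra.
Qed.

(** The sum on the left is the mean of [E * (f - shear)], where [E] is close to
    [zpoly] of the shear flow; the gain over [tau^2] is the Lipschitz constant,
    of order [nu^7]. *)
Lemma zmodes_small : \sum_(2 <= n < K.+1) a n ^+ 2 <= tau ^+ 2 / 8.
Proof.
have b0 := bb_gt0; have k0 := zlip_ge0; have cs' := ct_shear; have c4 := ct_horner (p := zpoly) cs'.
pose E x := \sum_(2 <= n < K.+1) a n * cs (zmode n) x.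
have cE : continuous E by apply: ct_sum => n; ct.
have EE : mean (fun x => E x * (f x - shear x)) = \sum_(2 <= n < K.+1) a n ^+ 2.
  rewrite (_ : (fun x => _) = fun x => \sum_(2 <= n < K.+1) (a n * ((f x - shear x) * cs (zmode n) x))).
    rewrite (mean_sum _ _).1; last by move=> n; ct.
    rewrite big_nat_cond [RHS]big_nat_cond; apply: eq_bigr => n /andP[/andP[n2 _] _].
    rewrite meanZ; last by ct.
    by rewrite -/(al (fun x => f x - shear x) (zmode n)) alB// al_shear// subr0 expr2.
  by apply/funext => x; rewrite /E mulr_suml; apply: eq_bigr => n _; ring.
have close x : `|E x - zpoly.[shear x]| <= zlip * nu ^+ 8.
  rewrite zpolyE /E -sumrB (le_trans (ler_norm_sum _ _ _))// /zlip -[leRHS]mulrA mulr_suml.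
  apply: ler_sum => n _; rewrite -mulrBr normrM -[leRHS]mulrA; apply: ler_wpM2l => //.
  rewrite cs_zmode -chebE.
  have c1 : `|cos x.1| <= 1 := cos_max _.
  have sb : `|shear x / bb| <= 1.
    rewrite normrM normfV (gtr0_norm b0) ler_pdivrMr// mul1r (le_trans (shear_sup x))//.
    by rewrite lerDl ltW// nu8_gt0.
  apply: le_trans (cheb_lip n c1 sb) _; rewrite ler_wpM2l ?exprn_ge0//.
  have -> : cos x.1 - shear x / bb = cos x.1 * (nu ^+ 8 / bb).
    by rewrite /shear; field; rewrite gt_eqF.
  rewrite normrM -[leRHS]mul1r mulrC (mulrC 1) ler_pM//.
  by rewrite ger0_norm mulrC// mulr_ge0 ?invr_ge0 ?(ltW b0)// ltW// nu8_gt0.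
have h1 := casimir_orth.
have h2 : `|mean (fun x => (E x - zpoly.[shear x]) * (f x - shear x))| <= zlip * nu ^+ 8 * nu ^+ 8.
  apply: mean_norm_le; first by ct.
  by move=> x; rewrite normrM ler_pM// off_shear_sup.
have h3 : \sum_(2 <= n < K.+1) a n ^+ 2 <= 28 * zlip * tau ^+ 2 + zlip * nu ^+ 8 * nu ^+ 8.
  rewrite -EE (_ : (fun x => _) = fun x => zpoly.[shear x] * (f x - shear x) +
    (E x - zpoly.[shear x]) * (f x - shear x)); last first.
    by apply/funext => x; ring.
  rewrite meanD; [|by ct|by ct].
  by apply: lerD; [apply: le_trans h1|apply: le_trans h2]; exact: ler_norm.
apply: (le_trans h3).
have nn := n0; have nu1 := pt_nu1 S; have a0 := al00; have hb := b_ge.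
have t16 : tau ^+ 2 <= nu ^+ 16.
  by rewrite (pt_tau S) -exprM ler_wiXn2l// ltW.
have p16 : 0 <= nu ^+ 16 by rewrite exprn_ge0// ltW.
have -> : zlip * nu ^+ 8 * nu ^+ 8 = zlip * nu ^+ 16 by rewrite -mulrA -exprD.
apply: (@le_trans _ _ (29 * zlip * nu ^+ 16)).
  by have := ler_wpM2l k0 t16; lra.
apply: (@le_trans _ _ (29 * (b * nu ^+ 7 / (2 * al0)) * nu ^+ 16)).
  by rewrite ler_wpM2r// ler_wpM2l// zlip_le.
have -> : 29 * (b * nu ^+ 7 / (2 * al0)) * nu ^+ 16 = nu ^+ 22 * (nu * (8 * 29 * b / al0)) / 16.
  by field; rewrite gt_eqF.
have -> : tau ^+ 2 = nu ^+ 22 by rewrite (pt_tau S) -exprM.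
have p22 : 0 <= nu ^+ 22 by rewrite exprn_ge0// ltW.
have := ler_wpM2l p22 small2; lra.
Qed.

End fixedK.
End Casimir.

(** * The virial identity *)

Section BoxSums.
Context {R : realType}.
Local Notation Z2 := (int * int)%type.
Implicit Types (k l : Z2).

Lemma e1_fst k : (k + e1).1%:~R = k.1%:~R + 1 :> R.
Proof. by rewrite /= intrD. Qed.

Lemma e1_snd k : (k + e1).2 = k.2.
Proof. by rewrite /= addr0. Qed.

Lemma sum_box_shift K (g : Z2 -> R) : (forall k, 0 <= g k) ->
  \sum_(k <- box K) g (k + e1) <= \sum_(k <- box K.+1) g k.
Proof.
move=> g0; rewrite -(big_map (fun k => k + e1) xpredT g).
apply: sumr_sub => //; last 2 first.
- exact: box_uniq.
- move=> k /mapP[[m n]]; rewrite !mem_box => /andP[/= h1 h2] ->.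
  by rewrite /= addr0 (leqW h2) andbT; move: h1; clear; lia.
by rewrite map_inj_uniq ?box_uniq//; exact: addIr.
Qed.

Lemma sum_box_telescope K (F : Z2 -> R) :
  \sum_(k <- box K) (F k - F (k + e1)) =
  \sum_(j <- iota 0 K.*2.+1) (F (- K%:Z, j%:Z - K%:Z) - F (K.+1%:Z, j%:Z - K%:Z)).
Proof.
rewrite /box big_allpairs_dep exchange_big; apply: eq_bigr => j _.
have H n (u : nat -> R) : \sum_(i <- iota 0 n) (u i - u i.+1) = u 0%N - u n.
  elim: n => [|n IH]; first by rewrite big_nil subrr.
  by rewrite -addn1 iotaD big_cat/= big_seq1 IH add0n addn1; ring.
pose u (i : nat) := F (i%:Z - K%:Z, j%:Z - K%:Z).
transitivity (\sum_(i <- iota 0 K.*2.+1) (u i - u i.+1)).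
  apply: eq_bigr => i _; congr (_ - F _); rewrite /e1; apply/eqP; rewrite xpair_eqE /= addr0 eqxx andbT.
  by apply/eqP; lia.
by rewrite H /u sub0r; congr (_ - F (_, _)); lia.
Qed.

Lemma cauchy_le (s : seq Z2) (x y : Z2 -> R) (P Q : R) : 0 <= P -> 0 <= Q ->
  \sum_(k <- s) x k ^+ 2 <= P ^+ 2 -> \sum_(k <- s) y k ^+ 2 <= Q ^+ 2 ->
  `|\sum_(k <- s) x k * y k| <= P * Q.
Proof.
move=> P0 Q0 hx hy; rewrite -(@ler_pXn2r _ 2)// ?nnegrE ?mulr_ge0//.
rewrite real_normK ?num_real// (le_trans (sum_cauchy _ _ _))// exprMn.
by apply: ler_pM => //; apply: sumr_ge0 => k _; exact: sqr_ge0.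
Qed.

End BoxSums.

Section Phi.
Context {R : realType}.
Local Notation X := (R * R)%type.
Local Notation Z2 := (int * int)%type.
Implicit Types (k l : Z2).
Local Notation il k := (inv_sqrt_laplacian_symbol k : R).
Local Notation w k := (1 - inv_sqrt_laplacian_symbol k : R).

(** The weight makes the linearised equation a pure difference along [e1]. *)
Definition phi (f : X -> R) k : R := w k * al f k.

(** The inverse of 0 is 0, so the modes with [k.2 = 0] drop out of the virial. *)
Definition slope k : R := (k.1%:~R + 2^-1) / k.2%:~R.

Definition virial K (f : X -> R) : R :=
  \sum_(k <- box K) slope k * (phi f k * phi f (k + e1)).

Definition virial_rate K (f G : X -> R) : R :=
  \sum_(k <- box K) slope k *
    (w k * al G k * phi f (k + e1) + phi f k * (w (k + e1) * al G (k + e1))).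

Lemma w_ge0 k : 0 <= w k. Proof. by rewrite subr_ge0 il_le1. Qed.
Lemma w_le1 k : w k <= 1. Proof. by rewrite gerBl il_ge0. Qed.

Lemma sqr_w_le k (x : R) : (w k * x) ^+ 2 <= x ^+ 2.
Proof.
rewrite exprMn -[leRHS]mul1r; apply: ler_wpM2r; first exact: sqr_ge0.
by rewrite exprn_ile1 ?w_ge0 ?w_le1.
Qed.

Lemma slope_le k : `|slope k| <= `|k.1%:~R + 2^-1|.
Proof.
rewrite /slope normrM -[leRHS]mulr1; apply: ler_wpM2l => //.
have [->|h] := eqVneq k.2 0; first by rewrite invr0 normr0.
rewrite normfV invf_le1 ?normr_gt0 ?intr_eq0// -intr_norm ler1z.
by move: h; rewrite -normr_gt0 gtz0_ge1.
Qed.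

Lemma slope_sqr k : slope k ^+ 2 <= 2 * sq k.
Proof.
rewrite -real_normK ?num_real//.
apply: (@le_trans _ _ (`|k.1%:~R + 2^-1 : R| ^+ 2)).
  by rewrite lerXn2r ?nnegrE// slope_le.
rewrite real_normK ?num_real// /sq /sqnormk.
by move: (k.1%:~R : R) (k.2%:~R : R) => u v; have := sqr_ge0 (u - 1 / 2); have := sqr_ge0 v; lra.
Qed.

Lemma slope_sqr_shift k : slope k ^+ 2 <= 2 * sq (k + e1).
Proof.
rewrite -real_normK ?num_real//.
apply: (@le_trans _ _ (`|k.1%:~R + 2^-1 : R| ^+ 2)).
  by rewrite lerXn2r ?nnegrE// slope_le.
rewrite real_normK ?num_real// /sq /sqnormk e1_fst.
by move: (k.1%:~R : R) ((k + e1).2%:~R : R) => u v; have := sqr_ge0 (u + 3 / 2); have := sqr_ge0 v; lra.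
Qed.

(** The quadratic form and the flux in the virial identity. The factor in front
    selects the lines on which [slope] is not zero. *)
Definition growth (f : X -> R) k : R := (k.2 != 0)%:R *
  (2^-1 * w (k + e1) * (phi f k + phi f (k + e1 + e1)) ^+ 2 +
   k.1%:~R * (w (k + e1) - w (k - e1)) * phi f k ^+ 2).

Definition flux (f : X -> R) k : R := (k.2 != 0)%:R *
  ((k.1%:~R - 2^-1) * w (k - e1) * phi f k ^+ 2 +
   (k.1%:~R + 2^-1) * w k * (phi f (k - e1) * phi f (k + e1)) +
   2^-1 * w (k - e1) * phi f k ^+ 2 + 2^-1 * w k * phi f (k + e1) ^+ 2).

(** Summation by parts along the line [k.2 = const]; the products of modes at
    distance two are completed to a square. *)
Lemma virial_identity f (a : R) k :
  slope k * (w k * (a * k.2%:~R * (phi f (k - e1) - phi f (k + e1))) * phi f (k + e1) +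
    phi f k * (w (k + e1) * (a * (k + e1).2%:~R *
      (phi f (k + e1 - e1) - phi f (k + e1 + e1))))) =
  a * (growth f k + (flux f k - flux f (k + e1))).
Proof.
rewrite /growth /flux e1_fst !e1_snd addrK /slope.
have [->|h] := eqVneq k.2 0; first by rewrite invr0 /=; ring.
have m0 : (k.2%:~R : R) != 0 by rewrite intr_eq0.
move: m0; rewrite /= mulr1n.
move: (phi f k) (phi f (k + e1)) (phi f (k - e1)) (phi f (k + e1 + e1)).
move: (w k) (w (k + e1)) (w (k - e1)) (k.1%:~R : R) (k.2%:~R : R).
by move=> w0 w1 w2 n m p0 p1 p2 p3 m0; field.
Qed.

Lemma flux_le f k (M D : R) : `|k.1%:~R| <= M -> phi f (k - e1) ^+ 2 <= D ->
  phi f k ^+ 2 <= D -> phi f (k + e1) ^+ 2 <= D -> `|flux f k| <= (2 * M + 2) * D.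
Proof.
move=> hM; have D1 := sqr_ge0 (phi f k); rewrite /flux.
have := w_ge0 k; have := w_ge0 (k - e1); have := w_le1 k; have := w_le1 (k - e1).
move: (phi f k) (phi f (k + e1)) (phi f (k - e1)) D1.
move: (w k) (w (k - e1)) hM => w0 w1 hM p0 p1 p2 D1 w11 w01 w1p w0p h1 h2 h3.
have M0 : 0 <= M by apply: le_trans hM.
have D0 : 0 <= D by lra.
rewrite normrM -[leRHS]mul1r; apply: ler_pM => //.
  by case: (k.2 != 0); rewrite /= ?normr1 ?normr0.
have hn (y : R) : `|y| <= 2^-1 -> `|k.1%:~R + y| <= M + 2^-1.
  by move=> hy; rewrite (le_trans (ler_normD _ _))// lerD.
have t (a v x : R) : `|a| <= M + 2^-1 -> 0 <= v -> v <= 1 -> `|x| <= D -> `|a * v * x| <= (M + 2^-1) * D.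
  move=> ha v0 v1 hx; rewrite !normrM (ger0_norm v0); apply: ler_pM => //.
    by rewrite mulr_ge0.
  by rewrite -[leRHS]mulr1; apply: ler_pM.
have t' (v x : R) : 0 <= v -> v <= 1 -> `|x| <= D -> `|2^-1 * v * x| <= 2^-1 * D.
  move=> v0 v1 hx; rewrite !normrM (ger0_norm v0) ger0_norm//; apply: ler_pM => //.
    by rewrite mulr_ge0.
  by rewrite -[leRHS]mulr1; apply: ler_pM.
have s (x : R) : x ^+ 2 <= D -> `|x ^+ 2| <= D by rewrite ger0_norm ?sqr_ge0.
have pp : `|p2 * p1| <= D.
  by rewrite ler_norml; apply/andP; split; have := sqr_ge0 (p2 + p1); have := sqr_ge0 (p2 - p1); nra.
have hp : `|2^-1 : R| <= 2^-1 by rewrite ger0_norm.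
have hm : `|- 2^-1 : R| <= 2^-1 by rewrite normrN.
have q1 := t (k.1%:~R - 2^-1) w1 (p0 ^+ 2) (hn _ hm) w1p w11 (s _ h2).
have q2 := t (k.1%:~R + 2^-1) w0 (p2 * p1) (hn _ hp) w0p w01 pp.
have q3 := t' w1 (p0 ^+ 2) w1p w11 (s _ h2).
have q4 := t' w0 (p1 ^+ 2) w0p w01 (s _ h3).
have -> : (2 * M + 2) * D = (M + 2^-1) * D + (M + 2^-1) * D + 2^-1 * D + 2^-1 * D by field.
apply: (le_trans (ler_normD _ _)); apply: lerD => //.
apply: (le_trans (ler_normD _ _)); apply: lerD => //.
apply: (le_trans (ler_normD _ _)); exact: lerD.
Qed.
End Phi.

(** * The quadratic remainder in the virial *)

Section VirialGrowth.
Context {R : realType}.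
Local Notation X := (R * R)%type.
Local Notation Z2 := (int * int)%type.
Implicit Types (k l : Z2).
Local Notation il k := (inv_sqrt_laplacian_symbol k : R).
Local Notation w k := (1 - inv_sqrt_laplacian_symbol k : R).
Variables (f ps : X -> R) (E0 A al0 nu tau : R).
Hypothesis S : perturbed al0 nu tau E0 f.
Hypotheses (A0 : 0 <= A) (fA : L2w 11 f A).
Local Notation B := (8 + A ^+ 2).
Local Notation b := (25 * (8 + A ^+ 2)).
Local Notation ae := (al f e1).
Local Notation vv := (vv f).
Local Notation off := (offmain f).
Local Notation phi := (phi f).
Hypotheses (al00 : 0 < al0) (ae0 : 0 < ae).
Hypothesis small1 : nu * (4 / al0 + b) <= 1.
Hypothesis small2 : nu * (8 * 29 * b / al0) <= 1.
Hypothesis Cps : C1per ps.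
Hypothesis ps_coef : forall k, al ps k = il k * al f k /\ be ps k = il k * be f k.
Let n0 := pt_nu0 S.

Lemma phi_vv k : phi k = w k * vv k.
Proof.
rewrite /phi /vv /ismain; have [->|_] := eqVneq k e1; first by rewrite il_e1 subrr !mul0r.
by have [->|//] := eqVneq k (- e1); rewrite ilN il_e1 subrr !mul0r.
Qed.

Lemma phi_sqr_le k : phi k ^+ 2 <= vv k ^+ 2.
Proof. by rewrite phi_vv sqr_w_le. Qed.

Definition offpsi (x : X) : R := ps x - 2 * ae * cs e1 x.

Lemma C1per_offpsi : C1per offpsi.
Proof. by apply: C1perB; [exact: Cps|exact: C1per_cs]. Qed.

Lemma coef_offpsi k : al offpsi k = il k * vv k /\ be offpsi k = 0.
Proof.
have [_ cp] := C1per_cper Cps.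
have cg : continuous (fun x : X => 2 * ae * cs e1 x) by ct.
rewrite /offpsi alB// beB//; have [-> ->] := coef_scs e1 ae k.
have [-> ->] := ps_coef k; rewrite (pt_be S) mulr0 subrr; split=> //.
rewrite /vv /ismain; have [->|k1] := eqVneq k e1; first by rewrite /= addr0 il_e1 mulr0 mul1r mulr1 subrr.
have [->|k2] := eqVneq k (- e1); first by rewrite /= alN ilN il_e1 mulr0 add0r mulr1 mul1r subrr.
by rewrite /= addr0 mulr0 subr0.
Qed.

Lemma am_offpsi k : am offpsi k = il k * `|vv k|.
Proof. by rewrite /am; have [-> ->] := coef_offpsi k; rewrite normr0 addr0 normrM ger0_norm// il_ge0. Qed.

Lemma Wp2_off : Wp 2 off (8 * A).
Proof.
apply: l2_Wp => // K; apply: le_trans (L2w_le (isT : 6 <= 11)%N fA K).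
apply: ler_sum => k _; rewrite ler_wpM2l ?exprn_ge0 ?(ltW (sq_gt0 k))//.
have [-> ->] := coef_off S k; rewrite expr0n addr0 (le_trans (vv_sqr_le f k))//.
by rewrite lerDl sqr_ge0.
Qed.

Lemma Wp2_offpsi : Wp 2 offpsi (8 * A).
Proof.
move=> K; apply: le_trans (Wp2_off K); apply: ler_sum => k _.
rewrite ler_wpM2l ?exprn_ge0 ?(ltW (sq_gt0 k))// am_offpsi (am_off S).
by rewrite ler_piMl// il_le1.
Qed.

Lemma il_k_le (m : int) k : (m%:~R ^+ 2 <= sqnormk k :> R) -> `|m%:~R * il k| <= 1.
Proof.
move=> h; rewrite -(@ler_pXn2r _ 2)// ?nnegrE// expr1n real_normK ?num_real//.
rewrite exprMn mulrC (le_trans _ (il_sqr k))//; apply: ler_wpM2l => //; exact: sqr_ge0.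
Qed.

(** The velocity is no larger than the vorticity-like variable, since [|k_i| /
    |k| <= 1]. *)
Lemma offpsi_grad x : `|partial1 offpsi x| <= b * nu ^+ 9 /\ `|partial2 offpsi x| <= b * nu ^+ 9.
Proof.
have C := C1per_offpsi.
split.
  apply: (sup_le_am (cper_partial1 C) (Wp_W1 (Wp_partial1 C Wp2_offpsi))) => K.
  apply: le_trans (sum_vv0 S fA K); apply: ler_sum => k _.
  rewrite am_partial1// am_offpsi mulrA -[leRHS]mul1r; apply: ler_wpM2r => //.
  have h : `|k.1%:~R * il k| <= 1 by apply: il_k_le; rewrite /sqnormk lerDl sqr_ge0.
  by move: h; rewrite normrM (ger0_norm (il_ge0 k)).
apply: (sup_le_am (cper_partial2 C) (Wp_W1 (Wp_partial2 C Wp2_offpsi))) => K.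
apply: le_trans (sum_vv0 S fA K); apply: ler_sum => k _.
rewrite am_partial2// am_offpsi mulrA -[leRHS]mul1r; apply: ler_wpM2r => //.
have h : `|k.2%:~R * il k| <= 1 by apply: il_k_le; rewrite /sqnormk lerDr sqr_ge0.
by move: h; rewrite normrM (ger0_norm (il_ge0 k)).
Qed.

Lemma off_grad x : `|partial1 off x| <= b * nu ^+ 8 /\ `|partial2 off x| <= b * nu ^+ 8.
Proof.
have C := C1per_off S.
split.
  apply: (sup_le_am (cper_partial1 C) (Wp_W1 (Wp_partial1 C Wp2_off))) => K.
  apply: le_trans (sum_vv_k1 S fA K); apply: ler_sum => k _.
  by rewrite am_partial1// (am_off S) (normrM k.1%:~R).
apply: (sup_le_am (cper_partial2 C) (Wp_W1 (Wp_partial2 C Wp2_off))) => K.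
apply: le_trans (sum_vv_k2 S fA K); apply: ler_sum => k _.
by rewrite am_partial2// (am_off S) (normrM k.2%:~R).
Qed.

Local Notation Rem := (transport offpsi off).

Lemma cper_rem : cper Rem.
Proof. by apply: cper_transport; [exact: C1per_offpsi|exact: C1per_off S]. Qed.

Lemma bnu_ge0 n : 0 <= b * nu ^+ n.
Proof. by rewrite mulr_ge0 ?exprn_ge0 ?(ltW n0)//; have := sqr_ge0 A; lra. Qed.

Lemma rem_sup x : `|Rem x| <= 2 * b ^+ 2 * nu ^+ 17.
Proof.
have [p1 p2] := offpsi_grad x; have [v1 v2] := off_grad x.
rewrite /transport; apply: le_trans (ler_normB _ _) _.
have -> : 2 * b ^+ 2 * nu ^+ 17 = (b * nu ^+ 9) * (b * nu ^+ 8) + (b * nu ^+ 9) * (b * nu ^+ 8) by ring.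
by rewrite !normrM; apply: lerD; apply: ler_pM.
Qed.

Lemma rem_l2 K : \sum_(k <- box K) al Rem k ^+ 2 <= (2 * b ^+ 2 * nu ^+ 17) ^+ 2.
Proof.
have [_ cr] := cper_rem.
apply: (@le_trans _ _ (\sum_(k <- box K) (al Rem k ^+ 2 + be Rem k ^+ 2))).
  by apply: ler_sum => k _; rewrite lerDl sqr_ge0.
apply: (le_trans (bessel K cr)); rewrite -[leRHS]mean_cst; apply: mean_le; [by ct|by ct|].
move=> x _; rewrite -[leLHS]real_normK ?num_real// lerXn2r ?nnegrE ?rem_sup//.
by rewrite mulr_ge0 ?exprn_ge0 ?(ltW n0)// mulr_ge0// sqr_ge0.
Qed.

Lemma partial1_main x : partial1 (fun x : X => 2 * ae * cs e1 x) x = - (2 * ae * sn e1 x).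
Proof.
rewrite /partial1 derive1E; have h := is_derive_cs1 e1 x.
have h2 : is_derive x.1 1 (fun y : R => 2 * ae * cs e1 (y, x.2)) (- (2 * ae * sn e1 x)).
  by apply: is_derive_eq; rewrite /GRing.scale/=; ring.
exact: derive_val.
Qed.

Lemma partial2_main x : partial2 (fun x : X => 2 * ae * cs e1 x) x = 0.
Proof.
rewrite /partial2 derive1E; have h := is_derive_cs2 e1 x.
have h2 : is_derive x.2 1 (fun y : R => 2 * ae * cs e1 (x.1, y)) 0.
  by apply: is_derive_eq; rewrite /GRing.scale/=; ring.
exact: derive_val.
Qed.

(** The main modes do not interact with each other, so the part not linear in
    the perturbation is quadratic in it. *)
Lemma transport_split x : transport ps f x =
  2 * ae * (sn e1 x * (partial2 off x - partial2 offpsi x)) + Rem x.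
Proof.
have [_ cf] := pt_C1 S; have [_ cp] := Cps; have [_ cm] := C1per_cs e1 (2 * ae).
rewrite /transport /offmain /offpsi !partial1B// !partial2B// partial1_main partial2_main.
by ring.
Qed.

(** Multiplication by [sn e1] shifts the frequency by [e1] on either side. *)
Lemma al_transport k : al (transport ps f) k =
  ae * k.2%:~R * (phi (k - e1) - phi (k + e1)) + al Rem k.
Proof.
have [_ cr] := cper_rem; have Co := C1per_off S; have Cp := C1per_offpsi.
have [_ c2] := cper_partial2 Co; have [_ d2] := cper_partial2 Cp.
pose g x := partial2 off x - partial2 offpsi x.
have cg : continuous g by rewrite /g; ct.
have bg m : be g m = - (m.2%:~R * phi m).
  rewrite /g beB//; have [_ ->] := coef_partial2 m Co; have [_ ->] := coef_partial2 m Cp.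
  have [-> _] := coef_off S m; have [-> _] := coef_offpsi m; rewrite phi_vv.
  by move: (il m) (vv m) (m.2%:~R) => *; ring.
rewrite {1}/al (_ : (fun x => _) = fun x =>
    ae * (g x * sn (k + e1) x) - ae * (g x * sn (k - e1) x) + Rem x * cs k x); last first.
  apply/funext => x; rewrite transport_split -/(g x) /sn /cs !phaseD phaseN sinB sinD.
  by move: (g x) (Rem x) => *; ring.
rewrite meanD; [|by ct|by ct]; rewrite meanB; [|by ct|by ct].
rewrite !meanZ; [|by ct|by ct].
rewrite -/(be g (k + e1)) -/(be g (k - e1)) -/(al Rem k) !bg /= oppr0 !addr0.
by move: (phi _) (phi _) (al Rem k) (k.2%:~R) ae => *; ring.
Qed.

Lemma slope_phi_l2 K : \sum_(k <- box K) (slope k * phi k) ^+ 2 <= (b * nu ^+ 10) ^+ 2 /\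
  \sum_(k <- box K) (slope k * phi (k + e1)) ^+ 2 <= (b * nu ^+ 10) ^+ 2.
Proof.
have H L : \sum_(k <- box L) 2 * (sq k * phi k ^+ 2) <= (b * nu ^+ 10) ^+ 2.
  rewrite -mulr_sumr.
  apply: (@le_trans _ _ (2 * (B * nu ^+ 20))); last first.
    have := exprn_ge0 20 (ltW n0); have := sqr_ge0 A.
    rewrite exprMn -exprM mulrA => a2 h; apply: ler_wpM2r => //; nra.
  rewrite ler_wpM2l//.
  apply: (@le_trans _ _ (\sum_(k <- box L) sq k ^+ 1 * vv k ^+ 2)).
    by apply: ler_sum => k _; rewrite expr1 ler_wpM2l ?(ltW (sq_gt0 k))// phi_sqr_le.
  have := vv_interp S fA L (isT : 1 <= 11)%N; rewrite (pt_tau S) -exprM.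
  by rewrite (exprD nu 2 20) mulrCA ler_pM2l// exprn_gt0.
split.
  apply: le_trans (H K); apply: ler_sum => k _; rewrite exprMn mulrA.
  by apply: ler_wpM2r; [exact: sqr_ge0|exact: slope_sqr].
apply: le_trans (H K.+1).
apply: le_trans (sum_box_shift (g := fun k => 2 * (sq k * phi k ^+ 2)) K _); last first.
  by move=> k; apply: mulr_ge0 => //; apply: mulr_ge0; [exact: ltW (sq_gt0 k)|exact: sqr_ge0].
apply: ler_sum => k _; rewrite exprMn mulrA.
by apply: ler_wpM2r; [exact: sqr_ge0|exact: slope_sqr_shift].
Qed.

(** Cauchy-Schwarz, with the remainder in the sup norm and the weighted modes in
    mean square. *)
Lemma rem_virial K : `|virial_rate K f Rem| <= 4 * b ^+ 3 * nu ^+ 27.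
Proof.
have [s1 s2] := slope_phi_l2 K.
have P0 : 0 <= 2 * b ^+ 2 * nu ^+ 17.
  by rewrite mulr_ge0 ?exprn_ge0 ?(ltW n0)// mulr_ge0// sqr_ge0.
have Q0 := bnu_ge0 10.
have r1 : \sum_(k <- box K) (w k * al Rem k) ^+ 2 <= (2 * b ^+ 2 * nu ^+ 17) ^+ 2.
  by apply: le_trans (rem_l2 K); apply: ler_sum => k _; exact: sqr_w_le.
have r2 : \sum_(k <- box K) (w (k + e1) * al Rem (k + e1)) ^+ 2 <= (2 * b ^+ 2 * nu ^+ 17) ^+ 2.
  apply: le_trans (rem_l2 K.+1).
  apply: le_trans (sum_box_shift (g := fun k => al Rem k ^+ 2) K _); last by move=> k; exact: sqr_ge0.
  by apply: ler_sum => k _; exact: sqr_w_le.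
have h1 := cauchy_le P0 Q0 r1 s2; have h2 := cauchy_le P0 Q0 r2 s1.
have -> : virial_rate K f Rem =
  \sum_(k <- box K) (w k * al Rem k) * (slope k * phi (k + e1)) +
  \sum_(k <- box K) (w (k + e1) * al Rem (k + e1)) * (slope k * phi k).
  rewrite -big_split; apply: eq_bigr => k _ /=.
  by move: (slope k) (al Rem k) (al Rem _) (phi k) (phi _) (w k) (w _) => *; ring.
rewrite (le_trans (ler_normD _ _))//.
have -> : 4 * b ^+ 3 * nu ^+ 27 = 2 * b ^+ 2 * nu ^+ 17 * (b * nu ^+ 10) + 2 * b ^+ 2 * nu ^+ 17 * (b * nu ^+ 10) by ring.
exact: lerD.
Qed.

Lemma virial_split K : virial_rate K f (transport ps f) =
  ae * (\sum_(k <- box K) growth f k + \sum_(k <- box K) (flux f k - flux f (k + e1)))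
  + virial_rate K f Rem.
Proof.
rewrite /virial_rate -big_split mulr_sumr -big_split /=; apply: eq_bigr => k _.
rewrite -virial_identity !al_transport.
set u := al Rem k; set v := al Rem (k + e1); set a := phi (k - e1).
set b' := phi (k + e1); set c := phi (k + e1 - e1); set d := phi (k + e1 + e1).
move: (slope k) (w k) (w (k + e1)) (phi k) (k.2%:~R : R) ((k + e1).2%:~R : R) => *.
by ring.
Qed.

End VirialGrowth.

(** * Positivity of the quadratic form *)

Section Positivity.
Context {R : realType}.
Local Notation X := (R * R)%type.
Local Notation Z2 := (int * int)%type.
Implicit Types (k l : Z2).
Local Notation il k := (inv_sqrt_laplacian_symbol k : R).
Local Notation w k := (1 - inv_sqrt_laplacian_symbol k : R).

Lemma il_sqrE k : k != 0 -> il k ^+ 2 = (sqnormk k)^-1.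
Proof.
move=> k0; rewrite /inv_sqrt_laplacian_symbol (negPf k0) exprVn.
by rewrite /normk sqr_sqrtr// sqnormk_ge0.
Qed.

(** Multiply by [il (k - e1) + il (k + e1)], which is at most 2: the difference
    of the squares is [4 k.1] divided by the product of the two square norms. *)
Lemma il_gap k : k.2 != 0 -> k.1 != 0 ->
  (2 * sq k ^+ 2)^-1 <= k.1%:~R * (il (k - e1) - il (k + e1)).
Proof.
move=> h2 h1.
have nz l : l.2 != 0 -> l != 0 by apply: contra_neq => ->.
have a0 : k - e1 != 0 by apply: nz; rewrite /= subr0.
have b0 : k + e1 != 0 by apply: nz; rewrite /= addr0.
have := il_sqrE a0; have := il_sqrE b0; have := il_ge0 (R := R) (k - e1); have := il_ge0 (R := R) (k + e1).
have := il_le1 (R := R) (k - e1); have := il_le1 (R := R) (k + e1).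
have : 1 <= sqnormk (k - e1) :> R by exact: sqnormk_ge1.
have : 1 <= sqnormk (k + e1) :> R by exact: sqnormk_ge1.
have n1 : 1 <= k.1%:~R ^+ 2 :> R.
  rewrite -rmorphXn /= ler1z -gtz0_ge1 lt_neqAle sqr_ge0 andbT eq_sym.
  by rewrite sqrf_eq0.
have m1 : 0 <= k.2%:~R ^+ 2 :> R by exact: sqr_ge0.
have sa : sqnormk (k - e1) = (k.1%:~R - 1) ^+ 2 + k.2%:~R ^+ 2 :> R.
  by rewrite /sqnormk /= intrB subr0.
have sb : sqnormk (k + e1) = (k.1%:~R + 1) ^+ 2 + k.2%:~R ^+ 2 :> R.
  by rewrite /sqnormk /= intrD addr0.
rewrite sa sb /sq /sqnormk.
move: (il (k - e1)) (il (k + e1)) n1 m1.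
move: (k.1%:~R : R) (k.2%:~R : R) => n m x y n1 m1 sb1 sa1 y1 x1 y0 x0 yE xE.
set q := 1 + (n ^+ 2 + m ^+ 2).
set u := (n - 1) ^+ 2 + m ^+ 2 in sa1 xE; set v := (n + 1) ^+ 2 + m ^+ 2 in sb1 yE.
have u0 : 0 < u by lra. 
have v0 : 0 < v by lra.
have q0 : 0 < q by rewrite /q; lra.
have uq : u <= 2 * q by rewrite /u /q; have := sqr_ge0 (n + 1); lra.
have vq : v <= 2 * q by rewrite /v /q; have := sqr_ge0 (n - 1); lra.
have E : n * (x - y) * (x + y) = 4 * n ^+ 2 / (u * v).
  have -> : n * (x - y) * (x + y) = n * (x ^+ 2 - y ^+ 2) by ring.
  rewrite xE yE; have -> : 4 * n ^+ 2 = n * (v - u) by rewrite /u /v; ring.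
  by field; rewrite !gt_eqF.
have H : (q ^+ 2)^-1 <= n * (x - y) * (x + y).
  rewrite E ler_pdivlMr ?mulr_gt0// mulrC ler_pdivrMr ?exprn_gt0//.
  apply: (@le_trans _ _ (2 * q * (2 * q))); first by apply: ler_pM => //; exact: ltW.
  by have := ler_wpM2r (sqr_ge0 q) n1; lra.
have iq : 0 < (q ^+ 2)^-1 by rewrite invr_gt0 exprn_gt0.
rewrite invfM; move: ((q ^+ 2)^-1) iq H => z z0 H.
have [D0|D0] := ltP (n * (x - y)) 0; move: (n * (x - y)) H D0 => D H D0; nra.
Qed.

Variables (f : X -> R) (E0 A al0 nu tau : R).
Hypothesis S : perturbed al0 nu tau E0 f.
Local Notation phi := (phi f).
Local Notation growth := (growth f).

Lemma growth_gap k : k.2 != 0 -> k.1 != 0 -> phi k ^+ 2 / sq k ^+ 2 <= 2 * growth k.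
Proof.
move=> h2 h1; have h := il_gap h2 h1; rewrite /growth h2 mul1r.
have w0 := w_ge0 (R := R) (k + e1).
have t1 : 0 <= 2^-1 * w (k + e1) * (phi k + phi (k + e1 + e1)) ^+ 2.
  by apply: mulr_ge0; [exact: mulr_ge0|exact: sqr_ge0].
have -> : w (k + e1) - w (k - e1) = il (k - e1) - il (k + e1) by ring.
have := ler_wpM2r (sqr_ge0 (phi k)) h; rewrite invfM.
by move: t1; set u := _ * _ ^+ 2; set v := k.1%:~R * _ * _; lra.
Qed.

Lemma growth_ge0 k : 0 <= growth k.
Proof.
have [h2|h2] := eqVneq k.2 0; first by rewrite /growth h2 eqxx mul0r.
have [h1|h1] := eqVneq k.1 0.
  rewrite /growth h1 !mul0r addr0 h2 mul1r; apply: mulr_ge0; [apply: mulr_ge0 => //; exact: w_ge0|exact: sqr_ge0].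
have := growth_gap h2 h1; have : 0 <= phi k ^+ 2 / sq k ^+ 2 by rewrite divr_ge0 ?sqr_ge0.
lra.
Qed.

Lemma even_ge2 (m : int) : m != 0 -> ~~ odd `|m|%N -> (2 <= `|m|)%N.
Proof. by rewrite -absz_eq0; case: (absz m) => [|[|n]]. Qed.

Lemma sq_shift2 k : k.1 = 0 -> (2 <= absz k.2)%N -> sq (k + e1 + e1) <= 2 * sq k :> R.
Proof.
move=> h1 h2; rewrite /sq /sqnormk !e1_fst !e1_snd h1 mulr0z !add0r expr0n add0r.
have : 4 <= k.2%:~R ^+ 2 :> R.
  rewrite -rmorphXn /= -[4]/(4%:~R) ler_int.
  have : (2 ^ 2 <= `|k.2| ^ 2)%N by rewrite leq_exp2r.
  by rewrite -abszX -lez_nat abszE ger0_norm ?sqr_ge0.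
lra.
Qed.

Lemma w_half k : k.2 != 0 -> ~~ odd (absz k.2) -> 2^-1 <= w k.
Proof.
move=> h2 ho; have : il k <= 2^-1.
  apply: il_half => //; first by apply: contra_neq h2 => ->.
  by apply/negP; rewrite /ismain => /orP[/eqP h|/eqP h]; move: h2; rewrite h.
lra.
Qed.

(** On [k.1 = 0] only the square in [growth] is left. It controls [phi k] once
    [phi (k + e1 + e1)] is known, and the latter is controlled off that line. *)
Lemma weight_le k : (k.2 != 0)%:R * (phi k ^+ 2 / sq k ^+ 2) <=
  10 * growth k + 16 * ((k.1 == 0)%:R * growth (k + e1 + e1)).
Proof.
have g0 := growth_ge0 k; have g2 := growth_ge0 (k + e1 + e1).
have rhs0 : 0 <= 10 * growth k + 16 * ((k.1 == 0)%:R * growth (k + e1 + e1)).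
  by apply: addr_ge0; apply: mulr_ge0 => //; exact: mulr_ge0.
have [h2|h2] := eqVneq k.2 0; first by rewrite mul0r.
have [ho|ho] := boolP (odd (absz k.2)).
  by rewrite /phi (pt_odd S ho) mulr0 expr0n mul0r mulr0.
rewrite mul1r; have [h1|h1] := eqVneq k.1 0; last first.
  by have := growth_gap h2 h1; rewrite mul0r; lra.
rewrite mul1r.
have h22 : (k + e1 + e1).2 != 0 by rewrite !e1_snd.
have h21 : (k + e1 + e1).1 != 0 by rewrite /= h1.
have G2 := growth_gap h22 h21.
have G0 : (phi k + phi (k + e1 + e1)) ^+ 2 <= 4 * growth k.
  rewrite /growth h2 h1 mul1r !mul0r addr0.
  have : 2^-1 <= w (k + e1) by apply: w_half; rewrite e1_snd.
  have := sqr_ge0 (phi k + phi (k + e1 + e1)).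
  by move: (w _) ((_ + _) ^+ 2) => *; nra.
have s2 := sq_shift2 h1 (even_ge2 h2 ho).
have q1 := sq_ge1 (R := R) k; have q2 := sq_gt0 (R := R) (k + e1 + e1).
have I : (sq k ^+ 2)^-1 <= 4 * (sq (k + e1 + e1) ^+ 2)^-1 :> R.
  have -> : 4 * (sq (k + e1 + e1) ^+ 2)^-1 = ((sq (k + e1 + e1) / 2) ^+ 2)^-1 :> R.
    by field; rewrite gt_eqF.
  rewrite lef_pV2 ?posrE ?exprn_gt0//; last 2 first.
  - by lra.
  - by lra.
  by rewrite lerXn2r ?nnegrE//; lra.
have I1 : (sq k ^+ 2)^-1 <= 1 :> R.
  by rewrite invf_le1 ?exprn_gt0//; [rewrite exprn_ege1|lra].
have I0 : 0 <= (sq k ^+ 2)^-1 :> R by rewrite invr_ge0 sqr_ge0.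
move: G0 G2 I I1 I0 g0; move: (growth k) (growth (k + e1 + e1)) (phi k) (phi (k + e1 + e1)) ((sq k ^+ 2)^-1) ((sq (k + e1 + e1) ^+ 2)^-1).
move=> g g' p p' z z' G0 G2 I I1 I0 gp.
have E : p ^+ 2 <= 2 * (p + p') ^+ 2 + 2 * p' ^+ 2 by have := sqr_ge0 (p + 2 * p'); nra.
apply: (@le_trans _ _ ((2 * (p + p') ^+ 2 + 2 * p' ^+ 2) * z)); first exact: ler_wpM2r.
have h1' : (p + p') ^+ 2 * z <= (p + p') ^+ 2 by rewrite ler_piMr ?sqr_ge0.
have h2' : p' ^+ 2 * z <= p' ^+ 2 * (4 * z') by rewrite ler_wpM2l ?sqr_ge0.
lra.
Qed.

Lemma weight_sum K : (2 <= K)%N ->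
  \sum_(k <- box K) (k.2 != 0)%:R * (phi k ^+ 2 / sq k ^+ 2) <=
  26 * \sum_(k <- box K) growth k.
Proof.
move=> K2.
apply: (@le_trans _ _ (\sum_(k <- box K) (10 * growth k + 16 * ((k.1 == 0)%:R * growth (k + e1 + e1))))).
  by apply: ler_sum => k _; exact: weight_le.
rewrite big_split/= -!mulr_sumr.
suff : \sum_(k <- box K) (k.1 == 0)%:R * growth (k + e1 + e1) <= \sum_(k <- box K) growth k by lra.
pose s := [seq k + e1 + e1 | k <- box K & k.1 == 0].
have -> : \sum_(k <- box K) (k.1 == 0)%:R * growth (k + e1 + e1) = \sum_(k <- s) growth k.
  rewrite big_map big_filter [RHS]big_mkcond; apply: eq_bigr => k _.
  by case: (k.1 == 0); rewrite ?mul1r ?mul0r.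
apply: sumr_sub; [|exact: box_uniq| |exact: growth_ge0].
  rewrite map_inj_uniq ?filter_uniq ?box_uniq// => k l.
  by move=> /addIr /addIr.
move=> k /mapP[[m n]]; rewrite mem_filter mem_box => /andP[/eqP/= -> /andP[_ h]] ->.
by rewrite mem_box /= !addr0 h andbT.
Qed.

(** These are the modes [(n, 0)] and their opposites; for [|n| <= 1] the term is
    zero. *)
Lemma zmodes_energy K : \sum_(k <- box K) (k.2 == 0)%:R * (w k * al f k ^+ 2) <=
  2 * \sum_(2 <= n < K.+1) al f (zmode n) ^+ 2.
Proof.
pose s := [seq zmode n | n <- index_iota 2 K.+1].
pose P k := (k.2 == 0) && (2 <= absz k.1)%N.
have -> : \sum_(k <- box K) (k.2 == 0)%:R * (w k * al f k ^+ 2) =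
    \sum_(k <- box K | P k) w k * al f k ^+ 2.
  rewrite [RHS]big_mkcond; apply: eq_bigr => -[m n] _; rewrite /P /=.
  have [->|n0] := eqVneq n 0; last by rewrite mul0r.
  rewrite mul1r; case: ifPn => // /=; rewrite -ltnNge ltnS => m1.
  have : (m, 0 : int) \in [:: 0; e1; - e1] by rewrite !inE /e1 !xpair_eqE /=; lia.
  rewrite !inE => /or3P[] /eqP ->.
  - by rewrite (pt_0 S) expr0n mulr0.
  - by rewrite il_e1 subrr mul0r.
  - by rewrite ilN il_e1 subrr mul0r.
rewrite -big_filter.
have us : uniq s by rewrite map_inj_uniq ?iota_uniq// => m n [].
have D : 2 * \sum_(2 <= n < K.+1) al f (zmode n) ^+ 2 = \sum_(k <- s ++ map -%R s) al f k ^+ 2.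
  rewrite big_cat !big_map /= -[RHS]/(_ + _) (eq_bigr (fun n => al f (zmode n) ^+ 2)); last first.
    by move=> n _.
  rewrite [X in _ = _ + X](eq_bigr (fun n => al f (zmode n) ^+ 2)); last by move=> n _; rewrite alN.
  by ring.
rewrite D; apply: (@le_trans _ _ (\sum_(k <- [seq k <- box K | P k]) al f k ^+ 2)).
  apply: ler_sum => k _; rewrite ler_piMl ?sqr_ge0//; exact: w_le1.
apply: sumr_sub => [||[m n]|k]; last exact: sqr_ge0.
- by rewrite filter_uniq ?box_uniq.
- rewrite cat_uniq us (map_inj_uniq oppr_inj) us andbT /=.
  apply/hasPn => k /mapP[l /mapP[n hn] -> ->]; apply/mapP => -[n' hn' [E]].
  by move: hn hn' E; rewrite !mem_index_iota; lia.
- rewrite mem_filter mem_box /P /= => /andP[/andP[/eqP -> m2] /andP[mK _]].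
  rewrite mem_cat; case: m m2 mK => m m2 mK.
    by apply/orP; left; apply/mapP; exists m => //; rewrite mem_index_iota m2.
  apply/orP; right; apply/mapP; exists (zmode m.+1); last by rewrite NegzE; congr (_, _).
  by apply/mapP; exists m.+1 => //; rewrite mem_index_iota; move: m2 mK; lia.
Qed.

Lemma epart_split K : epart K f <= 2 * \sum_(k <- box K) (k.2 != 0)%:R * phi k ^+ 2 +
  \sum_(k <- box K) (k.2 == 0)%:R * (w k * al f k ^+ 2).
Proof.
rewrite mulr_sumr -big_split /=; apply: ler_sum => k _.
rewrite (pt_be S) expr0n addr0.
have [h2|h2] := eqVneq k.2 0; first by rewrite mul0r mulr0 add0r mul1r.
rewrite mul0r addr0 mul1r /phi.
have [ho|ho] := boolP (odd (absz k.2)); first by rewrite (pt_odd S ho) expr0n !mulr0 expr0n mulr0.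
have := w_half h2 ho; have := sqr_ge0 (al f k).
by move: (w k) (al f k) => u v h h'; nra.
Qed.

End Positivity.

(** * Growth of the virial *)

Section Growth.
Context {R : realType}.
Local Notation X := (R * R)%type.
Local Notation Z2 := (int * int)%type.
Implicit Types (k l : Z2).
Local Notation il k := (inv_sqrt_laplacian_symbol k : R).
Local Notation w k := (1 - inv_sqrt_laplacian_symbol k : R).
Variables (f : X -> R) (E0 A al0 nu tau : R).
Hypothesis S : perturbed al0 nu tau E0 f.
Hypotheses (A0 : 0 <= A) (fA : L2w 11 f A).
Local Notation B := (8 + A ^+ 2).
Local Notation b := (25 * (8 + A ^+ 2)).
Local Notation ae := (al f e1).
Local Notation phi := (phi f).
Hypotheses (al00 : 0 < al0) (ae0 : 0 < ae).
Hypothesis small1 : nu * (4 / al0 + b) <= 1.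
Hypothesis small2 : nu * (8 * 29 * b / al0) <= 1.
Let n0 := pt_nu0 S.

(** A single term of the weighted square sum. *)
Lemma phi_far (n : nat) k : (n <= absz k.1)%N -> phi k ^+ 2 <= A ^+ 2 / (1 + n%:R ^+ 2) ^+ 3.
Proof.
move=> hn; apply: (le_trans (sqr_w_le k (al f k))).
have [K kK] : exists K, k \in box K.
  by exists (maxn (absz k.1) (absz k.2)); rewrite mem_box leq_maxl leq_maxr.
have h : sq k ^+ 3 * al f k ^+ 2 <= A ^+ 2.
  apply: le_trans (al_L2w S fA K (isT : 3 <= 11)%N).
  rewrite (big_rem k)//= lerDl; apply: sumr_ge0 => l _.
  by rewrite mulr_ge0 ?sqr_ge0// exprn_ge0// ltW// sq_gt0.
have s0 : 0 < 1 + n%:R ^+ 2 :> R by rewrite ltr_wpDr// sqr_ge0.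
rewrite ler_pdivlMr ?exprn_gt0// mulrC (le_trans _ h)// ler_wpM2r ?sqr_ge0//.
rewrite lerXn2r ?nnegrE ?(ltW s0) ?(ltW (sq_gt0 k))//.
rewrite /sq /sqnormk lerD2l (@le_trans _ _ (k.1%:~R ^+ 2))//; last by rewrite lerDl sqr_ge0.
rewrite -[leRHS]real_normK ?num_real// lerXn2r ?nnegrE//.
by rewrite -intr_norm -abszE -pmulrn ler_nat.
Qed.

(** The sum telescopes to the two ends of the lines, where eleven derivatives
    make the modes small. *)
Lemma flux_sum K : `|\sum_(k <- box K.+1) (flux f k - flux f (k + e1))| <= 108 * (A ^+ 2 / K.+1%:R ^+ 2).
Proof.
rewrite sum_box_telescope; set D := A ^+ 2 / (1 + K%:R ^+ 2) ^+ 3.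
have D0 : 0 <= D.
  by rewrite divr_ge0 ?sqr_ge0// exprn_ge0// addr_ge0// sqr_ge0.
have H (m j : int) : (K.+1 <= absz m)%N -> (absz m <= K.+2)%N -> `|flux f (m, j)| <= (2 * K.+2%:R + 2) * D.
  move=> m1 m2; apply: flux_le.
  - by rewrite /= -intr_norm -abszE -pmulrn ler_nat.
  - by apply: phi_far => /=; move: m1; clear; lia.
  - by apply: phi_far => /=; move: m1; clear; lia.
  - by apply: phi_far => /=; move: m1; clear; lia.
apply: (le_trans (ler_norm_sum _ _ _)).
apply: (@le_trans _ _ (\sum_(j <- iota 0 K.+1.*2.+1) (2 * ((2 * K.+2%:R + 2) * D)))).
  apply: ler_sum => j _; rewrite (le_trans (ler_normB _ _))// mulr2n mulrDl !mul1r.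
  by apply: lerD; apply: H; clear; lia.
rewrite big_const_seq count_predT size_iota iter_addr_0 -[leLHS]mulr_natl.
have -> : K.+1.*2.+1%:R = 2 * K%:R + 3 :> R by rewrite -addn1 -muln2 natrD natrM -addn1 natrD; ring.
have -> : K.+2%:R = K%:R + 2 :> R by rewrite -addn2 natrD.
have -> : K.+1%:R = K%:R + 1 :> R by rewrite -addn1 natrD.
rewrite /D; have : 0 <= K%:R :> R by [].
move: (K%:R : R) (sqr_ge0 A) => n; move: (A ^+ 2) => a a0 n0'.
have s1 : 1 <= 1 + n ^+ 2 by rewrite lerDl sqr_ge0.
have i0 : 0 < 1 + n ^+ 2 by lra.
apply: (@le_trans _ _ (54 * (1 + n ^+ 2) * (a / (1 + n ^+ 2) ^+ 3))).
  have d0 : 0 <= a / (1 + n ^+ 2) ^+ 3 by rewrite divr_ge0// exprn_ge0// ltW.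
  have -> : (2 * n + 3) * (2 * ((2 * (n + 2) + 2) * (a / (1 + n ^+ 2) ^+ 3))) =
    (2 * n + 3) * 2 * (2 * n + 6) * (a / (1 + n ^+ 2) ^+ 3) by ring.
  by apply: ler_wpM2r => //; have := sqr_ge0 (n - 1); lra.
have -> : 54 * (1 + n ^+ 2) * (a / (1 + n ^+ 2) ^+ 3) = a * (54 * ((1 + n ^+ 2) ^+ 2)^-1).
  by field; rewrite gt_eqF.
rewrite [leRHS]mulrCA; apply: ler_wpM2l => //.
have h : (2^-1 * (n + 1) ^+ 2) <= (1 + n ^+ 2) ^+ 2.
  have : (2^-1 * (n + 1) ^+ 2) <= 1 + n ^+ 2 by have := sqr_ge0 (n - 1); lra.
  by move=> /le_trans; apply; rewrite expr2 ler_peMl// ltW.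
have p0 : 0 < (n + 1) ^+ 2 by rewrite exprn_gt0//; lra.
have : ((1 + n ^+ 2) ^+ 2)^-1 <= (2^-1 * (n + 1) ^+ 2)^-1.
  by rewrite lef_pV2 ?posrE ?exprn_gt0// mulr_gt0.
by rewrite (invfM 2^-1) invrK; lra.
Qed.

Local Notation La := (8 * (8 + A ^+ 2) / nu ^+ 2).

(** Below the cut-off the weight of [weight_sum] is at least [La^-2]; above it
    one derivative gives [La^-1]. *)
Lemma cut_le k : (k.2 != 0)%:R * phi k ^+ 2 <=
  La ^+ 2 * ((k.2 != 0)%:R * (phi k ^+ 2 / sq k ^+ 2)) + La^-1 * (sq k ^+ 1 * vv f k ^+ 2).
Proof.
(* The cut-off frequency, squared: beyond it the eleven derivatives leave at
   most an eighth of [tau ^+ 2]. *)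
have L0 : 0 < La by rewrite divr_gt0 ?exprn_gt0// mulr_gt0// ltr_wpDr// sqr_ge0.
have q0 := sq_gt0 (R := R) k; have v0 := sqr_ge0 (vv f k).
have r0 : 0 <= La^-1 * (sq k ^+ 1 * vv f k ^+ 2).
  by apply: mulr_ge0; [rewrite invr_ge0 ltW|rewrite expr1; apply: mulr_ge0 => //; exact: ltW].
have [_|_] := eqVneq k.2 0; first by rewrite !mul0r mulr0 add0r.
rewrite !mul1r; have := phi_sqr_le f k; have := sqr_ge0 (phi k).
move: r0; rewrite expr1; move: La L0 (sq k) q0 (phi k ^+ 2) (vv f k ^+ 2) v0.
move=> L L0 q q0 p v v0 r0 p0 pv.
have [h|h] := leP q L.
  rewrite -[leLHS]addr0; apply: lerD => //.
  rewrite mulrCA ler_peMr// ler_pdivlMr ?exprn_gt0// mul1r.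
  by apply: lerXn2r; rewrite ?nnegrE ?(ltW q0) ?(ltW L0).
rewrite -[leLHS]add0r; apply: lerD.
  by apply: mulr_ge0; [exact: sqr_ge0|apply: divr_ge0 => //; exact: sqr_ge0].
apply: (le_trans pv); rewrite mulrA ler_peMl// mulrC ler_pdivlMr// mul1r; exact: ltW.
Qed.

(** The energy, at least [2 tau^2], is neither in the modes [(n, 0)] nor at high
    frequencies, so the form sees a fixed part of it. *)
Lemma growth_sum K : (2 <= K)%N ->
  (3 / 4 * nu ^+ 22 - A ^+ 2 / K.+1%:R ^+ 2 / 2) <=
  La ^+ 2 * 26 * \sum_(k <- box K) growth f k.
Proof.
move=> K2; have h1 := weight_sum S K2; have h2 := zmodes_small S A0 fA al00 ae0 small1 small2 K.
have h3 := zmodes_energy S K; have h4 := epart_split S K; have h5 := energy_tail S fA K.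
have h6 := pt_E0l S; have h7 := vv_interp S fA K (isT : 1 <= 11)%N.
rewrite (pt_tau S) -exprM in h2 h6 h7.
have h8 : \sum_(k <- box K) (k.2 != 0)%:R * phi k ^+ 2 <=
  La ^+ 2 * \sum_(k <- box K) (k.2 != 0)%:R * (phi k ^+ 2 / sq k ^+ 2) + nu ^+ 22 / 8.
  apply: (@le_trans _ _ (La ^+ 2 * \sum_(k <- box K) (k.2 != 0)%:R * (phi k ^+ 2 / sq k ^+ 2) +
     La^-1 * \sum_(k <- box K) sq k ^+ 1 * vv f k ^+ 2)).
    by rewrite !mulr_sumr -big_split; apply: ler_sum => k _; exact: cut_le.
  rewrite lerD2l invf_div mulrAC ler_pdivrMr; last first.
    by rewrite mulr_gt0// ltr_wpDr// sqr_ge0.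
  by move: h7; set y := \sum_(_ <- _) _; lra.
have := ler_wpM2l (sqr_ge0 La) h1.
move: h8 h2 h3 h4 h5 h6; set u := \sum_(_ <- _) _; set v := \sum_(_ <- _) _.
set y := \sum_(2 <= _ < _) _; set z := \sum_(_ <- _) _; set g := \sum_(_ <- _) _.
set d := A ^+ 2 / _; move: (La ^+ 2) (epart K f) (nu ^+ (11 * 2)) => L e t.
lra.
Qed.
Lemma virial_growth (ps : X -> R) K : C1per ps ->
  (forall k, al ps k = il k * al f k /\ be ps k = il k * be f k) ->
  ae * ((3 / 4 * nu ^+ 22 - A ^+ 2 / K.+2%:R ^+ 2 / 2) / (La ^+ 2 * 26) -
    108 * (A ^+ 2 / K.+2%:R ^+ 2)) - 4 * b ^+ 3 * nu ^+ 27 <=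
  virial_rate K.+2 f (transport ps f).
Proof.
move=> Cps cps; rewrite (virial_split S Cps cps).
have := rem_virial S A0 fA Cps cps K.+2; rewrite ler_norml => /andP[h1 _].
have := flux_sum K.+1; rewrite ler_norml => /andP[h2 _].
have h3 := @growth_sum K.+2 isT.
have dd : A ^+ 2 / K.+3%:R ^+ 2 <= A ^+ 2 / K.+2%:R ^+ 2.
  apply: ler_wpM2l; first exact: sqr_ge0.
  by rewrite lef_pV2 ?posrE ?exprn_gt0// lerXn2r ?nnegrE// ler_nat.
have L0 : 0 < La ^+ 2 * 26.
  by rewrite mulr_gt0// exprn_gt0// divr_gt0 ?exprn_gt0// mulr_gt0// ltr_wpDr// sqr_ge0.
apply: lerD; last exact: h1.
apply: ler_wpM2l; first exact: ltW.
apply: lerD; last exact: h2.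
rewrite ler_pdivrMr// [leRHS]mulrC; apply: le_trans h3.
by rewrite lerD2l lerN2 ler_wpM2r.
Qed.
End Growth.

(** * The Fourier coefficients of the datum *)

Section Datum.
Context {R : realType}.
Local Notation X := (R * R)%type.
Local Notation Z2 := (int * int)%type.
Implicit Types (k l : Z2).
Local Notation il k := (inv_sqrt_laplacian_symbol k : R).
Variables (al0 tau : R).

(** The frequencies of [cos x1 * cos (2 x2)], up to sign. *)
Definition kp : Z2 := (1, 2).
Definition km : Z2 := (1, -2).

Definition datum_coef k : R := al0 * ((k == e1)%:R + (k == - e1)%:R) +
  tau * ((k == kp)%:R + (k == - kp)%:R) + tau * ((k == km)%:R + (k == - km)%:R).

Lemma datum_cs x : datum al0 tau x =
  2 * al0 * cs e1 x + (2 * tau * cs kp x - (- (2 * tau)) * cs km x).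
Proof.
rewrite /datum /cs /phase/= !mul1r mul0r addr0 (_ : (-2)%:~R = - 2 :> R)//.
by rewrite !mulNr cosB cosD; ring.
Qed.

Lemma coef_datum k : al (datum al0 tau) k = datum_coef k /\ be (datum al0 tau) k = 0.
Proof.
have -> : datum al0 tau = fun x => 2 * al0 * cs e1 x -
    (2 * (- tau) * cs kp x - 2 * tau * cs km x).
  by apply/funext => x; rewrite datum_cs; ring.
have c1 l (r : R) : continuous (fun x : X => 2 * r * cs l x) by ct.
have c2 : continuous (fun x : X => 2 * (- tau) * cs kp x - 2 * tau * cs km x) by ct.
rewrite !alB// !beB//.
have [-> ->] := coef_scs e1 al0 k; have [-> ->] := coef_scs kp (- tau) k.
have [-> ->] := coef_scs km tau k; split; last by rewrite !subr0.
by rewrite /datum_coef; ring.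
Qed.

Lemma sum_datum K (F : Z2 -> R) : (2 <= K)%N -> (forall k, F (- k) = F k) ->
  \sum_(k <- box K) F k * datum_coef k ^+ 2 =
  2 * (al0 ^+ 2 * F e1 + tau ^+ 2 * F kp + tau ^+ 2 * F km).
Proof.
move=> K2 FN.
have K1 : (1 <= K)%N by apply: leq_trans K2.
rewrite (eq_bigr (fun k => F k * al0 ^+ 2 * (k == e1)%:R + F k * al0 ^+ 2 * (k == - e1)%:R +
    (F k * tau ^+ 2 * (k == kp)%:R + F k * tau ^+ 2 * (k == - kp)%:R) +
    (F k * tau ^+ 2 * (k == km)%:R + F k * tau ^+ 2 * (k == - km)%:R))).
  rewrite !big_split /= !sum_box_delta ?mem_boxN ?mem_box/= ?K1 ?K2// !FN.
  by ring.
move=> k _; rewrite /datum_coef.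
have [->|h1] := eqVneq k e1; first by rewrite /=; ring.
have [->|h2] := eqVneq k (- e1); first by rewrite /=; ring.
have [->|h3] := eqVneq k kp; first by rewrite /=; ring.
have [->|h4] := eqVneq k (- kp); first by rewrite /=; ring.
have [->|h5] := eqVneq k km; first by rewrite /=; ring.
by have [->|h6] := eqVneq k (- km); rewrite /=; ring.
Qed.

Lemma mpart_datum K : (2 <= K)%N -> mpart K (datum al0 tau) = 2 * al0 ^+ 2 + 4 * tau ^+ 2.
Proof.
move=> K2; rewrite /mpart (eq_bigr (fun k => 1 * datum_coef k ^+ 2)).
  by rewrite (sum_datum (F := fun=> 1))//; ring.
by move=> k _; have [-> ->] := coef_datum k; rewrite expr0n addr0 mul1r.
Qed.

Lemma epart_datum K : (2 <= K)%N ->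
  2 * tau ^+ 2 <= epart K (datum al0 tau) /\ epart K (datum al0 tau) <= 4 * tau ^+ 2.
Proof.
move=> K2; have -> : epart K (datum al0 tau) =
    2 * (tau ^+ 2 * (1 - il kp) + tau ^+ 2 * (1 - il km)).
  rewrite /epart (eq_bigr (fun k => (1 - il k) * datum_coef k ^+ 2)).
    rewrite (sum_datum (F := fun k => 1 - il k))//; last by move=> k; rewrite ilN.
    by rewrite il_e1 subrr mulr0 add0r.
  by move=> k _; have [-> ->] := coef_datum k; rewrite expr0n addr0.
have hp : il kp <= 2^-1 by apply: il_half.
have hm : il km <= 2^-1 by apply: il_half.
have := il_ge0 (R := R) kp; have := il_ge0 (R := R) km; have := sqr_ge0 tau.
by move: (il kp) (il km) (tau ^+ 2) hp hm => u v t hp hm t0 v0 u0; split; nra.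
Qed.

End Datum.

(** * Unboundedness of the norm *)

Section Assembly.
Context {R : realType}.
Local Notation X := (R * R)%type.
Local Notation Z2 := (int * int)%type.
Implicit Types (k l : Z2).
Local Notation il k := (inv_sqrt_laplacian_symbol k : R).
Variables (th ps : R -> X -> R) (al0 nu A : R).
Hypothesis F : flow th ps.
Hypotheses (al00 : 0 < al0) (A0 : 0 <= A) (nu0 : 0 < nu) (nu1 : nu <= 1).
Local Notation tau := (nu ^+ 11).
Hypothesis th0 : th 0 = datum al0 tau.
Local Notation b := (25 * (8 + A ^+ 2)).
Local Notation La := (8 * (8 + A ^+ 2) / nu ^+ 2).
Hypothesis small1 : nu * (4 / al0 + b) <= 1.
Hypothesis small2 : nu * (8 * 29 * b / al0) <= 1.
Hypothesis small3 : nu * (64 * b ^+ 5 / al0) <= 1.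

Definition energy0 : R := mean (fun x => th 0 x ^+ 2) - hamilton (th 0).

Lemma mean_datum2 : mean (fun x => th 0 x ^+ 2) = 2 * al0 ^+ 2 + 4 * tau ^+ 2.
Proof.
have [L L0 /(Wp_le (leqnSn 1)) w] := fl_W F (lexx 0).
have c := cvg_inv_sqr (R := R) (L * L).
apply/eqP; rewrite -subr_eq0 -normr_le0; apply: (cvg_le0 (N := 2%N) c) => K K2.
have := flow_mass F K (lexx 0) w; rewrite th0 (mpart_datum al0 tau K2).
by rewrite mulrA.
Qed.

Lemma energy0_bounds : 2 * tau ^+ 2 <= energy0 /\ energy0 <= 4 * tau ^+ 2.
Proof.
have [L L0 /(Wp_le (leqnSn 1)) w] := fl_W F (lexx 0).
have c := cvg_inv_sqr (R := R) ((L + L) * L).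
have H K : (2 <= K)%N -> 2 * tau ^+ 2 - energy0 <= (L + L) * L / K.+1%:R ^+ 2 /\
    energy0 - 4 * tau ^+ 2 <= (L + L) * L / K.+1%:R ^+ 2.
  move=> K2; have := flow_energy F K (lexx 0) w; rewrite -/energy0 mulrA.
  have := epart_datum al0 tau K2; rewrite -th0; set e := epart _ _.
  set y := _ / _; rewrite ler_norml => -[h1 h2] /andP[h3 h4]; split; lra.
by split; rewrite -subr_le0; apply: (cvg_le0 (N := 2%N) c) => K /H[].
Qed.

(** The half turn excludes the sines, and the translation by [(0, pi)] the odd
    [k.2]. *)
Lemma flow_perturbed t : 0 <= t -> perturbed al0 nu tau energy0 (th t).
Proof.
move=> t0; have [L L0 /(Wp_le (leqnSn 1)) w] := fl_W F t0.
have [E1 E2] := energy0_bounds.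
have so x : th 0 (act (-1) 0 x) = th 0 x.
  by rewrite th0 /datum /act /= addr0 !mulN1r mulrN !cosN.
have ss x : th 0 (act 1 pi x) = th 0 x.
  rewrite th0 /datum /act /= !mul1r mulrDr.
  have -> : 2 * x.2 + 2 * pi = 2 * x.2 + pi *+ 2 by ring.
  by rewrite cosD2pi.
split => //.
- exact: (fl_C1 F).
- move=> k; have [_] := flow_sym_coef symmetry_opp F so k t0.
  by lra.
- move=> k ko; have [+ _] := flow_sym_coef symmetry_shift F ss k t0.
  by rewrite -signr_odd ko expr1; lra.
- rewrite (flow_mean F t0) th0; have [-> _] := coef_datum al0 tau 0.
  by rewrite /datum_coef /=; ring.
- by exists ((L + L) * L) => K; have := flow_energy F K t0 w; rewrite mulrA.
- exists (L * L) => K; rewrite -mean_datum2.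
  by have := flow_mass F K t0 w; rewrite mulrA.
- by move=> p; rewrite (flow_poly F p t0) th0.
Qed.

Lemma nu_al0 : nu <= al0 / 4.
Proof.
have a0 := al00; have n0 := nu0; have A2 := sqr_ge0 A; have h := small1.
have p : 0 <= nu * b by rewrite mulr_ge0 ?(ltW n0)//; lra.
have : nu * (4 / al0) <= 1 by lra.
by rewrite mulrA ler_pdivrMr// mul1r; lra.
Qed.

Lemma tau_al0 : 2 * tau ^+ 2 <= al0 ^+ 2 / 8.
Proof.
have h : tau ^+ 2 <= nu ^+ 2 by rewrite -exprM ler_wiXn2l// ltW.
have := nu_al0; have n0 := nu0; have a0 := al00; move: h => h h2; nra.
Qed.

Lemma ae_sqr_gt t : 0 <= t -> 0 < al (th t) e1 ^+ 2.
Proof.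
move=> t0; have [h _] := ae_sqr (flow_perturbed t0); have h2 := tau_al0.
have : 0 < al0 ^+ 2 by rewrite exprn_gt0.
by move: h; set u := al _ _; lra.
Qed.

(** The square stays positive, so the sign cannot change. *)
Lemma ae_gt0 t : 0 < t -> 0 < al (th t) e1.
Proof.
move=> t0; have a2 : 0 < al0 / 2 by rewrite divr_gt0.
have [d d0 Hd] := fl_sup0 F a2.
pose s := Num.min t (d / 2).
have s0 : 0 < s by rewrite lt_min t0 divr_gt0.
have st : s <= t by rewrite ge_min lexx.
have sd : s < d by rewrite gt_min; apply/orP; right; lra.
have as0 : 0 < al (th s) e1.
  have c1 := fl_cth F (ltW s0); have c2 := fl_cth F (lexx 0).
  have h : `|al (fun x => th s x - th 0 x) e1| <= al0 / 2.
    by apply: al_norm_le => [|x]; [ct|exact: Hd (ltW s0) sd x].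
  move: h; rewrite alB// th0; have [-> _] := coef_datum al0 tau e1.
  rewrite /datum_coef /= ler_norml => /andP[h _]; have a0 := al00; move: h.
  rewrite !mulr0n !addr0 mulr1n mulr1 mulr0 !addr0; lra.
rewrite ltNge; apply/negP => at0.
have cw : {within `[s, t], continuous (fun r => al (th r) e1)}.
  apply: derivable_within_continuous => r; rewrite in_itv /= => /andP[sr _].
  have [h _] := fl_al F e1 (lt_le_trans s0 sr); exact: ex_derive.
have [|c] := IVT (v := 0) st cw.
  by rewrite ge_min le_max at0 orbT (ltW as0).
rewrite in_itv /= => /andP[sc _] cE.
have := ae_sqr_gt (ltW (lt_le_trans s0 sc)); rewrite cE.
by rewrite expr0n ltxx.
Qed.

Lemma ae_between t : 0 < t -> al0 / 2 <= al (th t) e1 /\ al (th t) e1 <= 2 * al0.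
Proof.
move=> t0; have := ae_near (flow_perturbed (ltW t0)) al00 (ae_gt0 t0).
have h : 2 * tau ^+ 2 / al0 <= al0 / 8.
  by rewrite ler_pdivrMr//; have := tau_al0; lra.
have a0 := al00; move=> /le_trans /(_ h); set u := al _ _.
by rewrite ler_norml => /andP[h1 h2]; split; lra.
Qed.

Lemma al_le_A f k : L2w 11 f A -> `|al f k| <= A.
Proof.
move=> fA; have [K kK] : exists K, k \in box K.
  by exists (maxn (absz k.1) (absz k.2)); rewrite mem_box leq_maxl leq_maxr.
rewrite -(@ler_pXn2r _ 2)// ?nnegrE// real_normK ?num_real//.
apply: le_trans (fA K); rewrite (big_rem k)//=.
apply: (@le_trans _ _ (sq k ^+ 11 * (al f k ^+ 2 + be f k ^+ 2))).
  have e : al f k ^+ 2 <= al f k ^+ 2 + be f k ^+ 2 by rewrite lerDl sqr_ge0.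
  apply: (le_trans e); rewrite ler_peMl ?addr_ge0 ?sqr_ge0//.
  by rewrite exprn_ege1// sq_ge1.
rewrite lerDl; apply: sumr_ge0 => l _; apply: mulr_ge0.
  by rewrite exprn_ge0// ltW// sq_gt0.
by apply: addr_ge0; exact: sqr_ge0.
Qed.

Lemma virial_bound K f : L2w 11 f A ->
  `|virial K f| <= \sum_(k <- box K) `|slope k| * (A * A).
Proof.
move=> fA; apply: (le_trans (ler_norm_sum _ _ _)); apply: ler_sum => k _.
have H l : `|phi f l| <= A.
  rewrite /phi normrM -[leRHS]mul1r; apply: ler_pM => //; last exact: al_le_A.
  by rewrite ger0_norm ?w_le1 ?w_ge0.
by rewrite normrM ler_wpM2l// normrM ler_pM.
Qed.

Lemma is_derive_bigsum (T : Type) (s : seq T) (u : T -> R -> R) (du : T -> R) (t : R) :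
  (forall i, is_derive t 1 (u i) (du i)) ->
  is_derive t 1 (fun r => \sum_(k <- s) u k r) (\sum_(k <- s) du k).
Proof.
move=> H; elim: s => [|i s IH].
  by under eq_fun do rewrite big_nil; rewrite big_nil; exact: is_derive_cst.
under eq_fun do rewrite big_cons; rewrite big_cons.
have h := H i; exact: is_deriveD.
Qed.

Lemma is_derive_quad (u v : R -> R) (t du dv a a' c : R) :
  is_derive t 1 u du -> is_derive t 1 v dv ->
  is_derive t 1 (fun r => c * (a * u r * (a' * v r)))
    (c * (a * du * (a' * v t) + a * u t * (a' * dv))).
Proof. by move=> h1 h2; apply: is_derive_eq; rewrite /GRing.scale/=; ring. Qed.

Lemma virial_derive (K : nat) (t : R) : 0 < t ->
  is_derive t 1 (fun r => virial K (th r)) (virial_rate K (th t) (transport (ps t) (th t))).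
Proof.
move=> t0; apply: is_derive_bigsum => k.
have [h1 _] := fl_al F k t0; have [h2 _] := fl_al F (k + e1) t0.
exact: is_derive_quad h1 h2.
Qed.

(** By [small3] the growth beats the quadratic remainder; the box is then chosen
    so large that its boundary is negligible. *)
Lemma rate_lower : exists K : nat, exists2 c : R, 0 < c & forall t : R, 0 < t -> L2w 11 (th t) A ->
  c <= virial_rate K (th t) (transport (ps t) (th t)).
Proof.
have A2 := sqr_ge0 A; have b0 : 0 < b by lra.
pose m := (La ^+ 2 * 26)^-1.
have La0 : 0 < La by rewrite divr_gt0 ?exprn_gt0// mulr_gt0//; lra.
have m0 : 0 < m by rewrite invr_gt0 mulr_gt0// exprn_gt0.
pose c := 2 * b ^+ 3 * nu ^+ 27.
have c0 : 0 < c by rewrite mulr_gt0 ?exprn_gt0// mulr_gt0// exprn_gt0.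
have main : 8 * b ^+ 3 * nu ^+ 27 <= al0 / 2 * (3 / 4 * nu ^+ 22 * m).
  (* Here [1875 / 13312 = 3 * 625 / (8 * 26 * 64)] and
     [8 + A ^+ 2 = b / 25]. *)
  have -> : al0 / 2 * (3 / 4 * nu ^+ 22 * m) =
      (b ^+ 3 * nu ^+ 26) * (al0 * (1875 / 13312) / b ^+ 5).
    rewrite /m; have : 0 < 8 + A ^+ 2 by lra.
    by move: (8 + A ^+ 2) nu0 => B B0 n0; field; rewrite !gt_eqF.
  have -> : 8 * b ^+ 3 * nu ^+ 27 = (b ^+ 3 * nu ^+ 26) * (8 * nu) by ring.
  rewrite ler_pM2l; last by rewrite mulr_gt0 ?exprn_gt0.
  rewrite ler_pdivlMr ?exprn_gt0//.
  have := small3; rewrite mulrA ler_pdivrMr// mul1r; have a0 := al00.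
  move: (b ^+ 5) => B5; lra.
have [K KH] : exists K : nat, 2 * al0 * ((m / 2 + 108) * (A ^+ 2 / K.+2%:R ^+ 2)) <= c.
  have := cvg_inv_sqr (R := R) (2 * al0 * ((m / 2 + 108) * A ^+ 2)).
  move/cvgrPdist_le => /(_ c c0) [N _ /(_ N.+1 (leqnSn N))].
  rewrite sub0r normrN => h; exists N.
  by apply: le_trans (le_trans (ler_norm _) h); rewrite !mulrA.
exists K.+2, c => // t t0 fA.
have S := flow_perturbed (ltW t0).
have := virial_growth S A0 fA al00 (ae_gt0 t0) small1 small2 K (fl_psi F t0) (fun k => fl_psi_coef F k t0).
apply: le_trans.
have [h1 h2] := ae_between t0; rewrite -/m.
move: KH; set d := A ^+ 2 / _ => KH.
have d0 : 0 <= d by rewrite divr_ge0// sqr_ge0.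
set ae := al _ _ in h1 h2 *.
have e0 : 0 <= (m / 2 + 108) * d by rewrite mulr_ge0//; lra.
have k1 : ae * ((m / 2 + 108) * d) <= 2 * al0 * ((m / 2 + 108) * d) by rewrite ler_wpM2r.
have k2 : al0 / 2 * (3 / 4 * nu ^+ 22 * m) <= ae * (3 / 4 * nu ^+ 22 * m).
  by rewrite ler_wpM2r// mulr_ge0 ?(ltW m0)// mulr_ge0// exprn_ge0// ltW.
have cE : c = 2 * b ^+ 3 * nu ^+ 27 by [].
move: main KH k1 k2 cE; move: (nu ^+ 22) (nu ^+ 27) (b ^+ 3) => n22 n27 b3.
rewrite mulrA; move: (al0 / 2 * _) => z.
lra.
Qed.

(** The virial grows at a fixed rate as long as the norm is below [A], but is
    bounded in terms of [A]. *)
Lemma norm_unbounded (t0 : R) : 0 < t0 -> ~ (forall t : R, t0 <= t -> L2w 11 (th t) A).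
Proof.
move=> t00 H; have [K [c c0 Hc]] := rate_lower.
set M := \sum_(k <- box K) `|slope k : R| * (A * A).
have Hb t : t0 <= t -> `|virial K (th t)| <= M by move=> /H; exact: virial_bound.
have M0 : 0 <= M by apply: le_trans (Hb t0 (lexx _)).
pose t1 := t0 + (2 * M + 1) / c.
have t01 : t0 <= t1 by rewrite lerDl divr_ge0 ?(ltW c0)//; lra.
have [s [s1 s2 E]] := mvt_itv t01 (fun x h _ => virial_derive K (lt_le_trans t00 h)).
have := Hc s (lt_le_trans t00 s1) (H s s1).
have p : 0 <= t1 - t0 by rewrite subr_ge0.
move=> /(ler_wpM2r p); rewrite -E /t1 addrAC subrr add0r mulrCA divff ?gt_eqF// mulr1.
have := Hb t0 (lexx _); have := Hb t1 t01; rewrite !ler_norml => /andP[h1 h2] /andP[h3 h4].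
by rewrite /t1 in h1 h2 *; lra.
Qed.

End Assembly.

(** * Geometrically convergent series *)

Section GeomSeries.
Context {R : realType}.

Lemma sum_tri (A B : nat -> R) N :
  \sum_(n < N) \sum_(i < n.+1) A i * B (n - i)%N = \sum_(i < N) A i * \sum_(j < N - i) B j.
Proof.
elim: N => [|N IH]; first by rewrite !big_ord0.
rewrite big_ord_recr /= IH big_ord_recr /= [in RHS]big_ord_recr /= subnn addrA -big_split /=.
rewrite subSnn big_ord1; congr (_ + _); apply: eq_bigr => i _ /=.
by rewrite subSn ?(ltnW (ltn_ord i))// big_ord_recr mulrDr.
Qed.

Lemma sum_tri_le (A : nat -> R) N : (forall n, 0 <= A n) ->
  \sum_(n < N) \sum_(i < n.+1) A i * A (n - i)%N <= (\sum_(n < N) A n) ^+ 2.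
Proof.
move=> A0; rewrite sum_tri expr2 mulr_suml; apply: ler_sum => i _; apply: ler_wpM2l => //.
rewrite -!(big_mkord xpredT A) (big_cat_nat (n := N - i) (p := N))//= ?leq_subr//.
by rewrite lerDl sumr_ge0.
Qed.

Lemma cvg_geo (D q : R) : 1 < q -> (fun n : nat => D / q ^+ n) @ \oo --> 0.
Proof.
move=> q1; rewrite -[X in _ --> X](mulr0 D); apply: cvgM; first exact: cvg_cst.
under eq_fun do rewrite -exprVn.
apply: cvg_expr; rewrite ger0_norm ?invr_ge0 ?(le_trans ler01 (ltW q1))//.
by rewrite invf_lt1// (lt_trans ltr01).
Qed.

Lemma geo_part (h : nat -> R) (D : R) : (forall n, `|h n| <= D / 4 ^+ n) ->
  forall m n, (n <= m)%N -> `|\sum_(i < m) h i - \sum_(i < n) h i| <= 2 * D / 4 ^+ n.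
Proof.
move=> H m n nm.
have D0 : 0 <= D by have := le_trans (normr_ge0 _) (H 0%N); rewrite expr0 divr1.
have p k : 0 < (4 : R) ^+ k by rewrite exprn_gt0.
suff : `|\sum_(i < m) h i - \sum_(i < n) h i| <= 2 * D / 4 ^+ n - 2 * D / 4 ^+ m.
  move=> /le_trans; apply; rewrite gerBl divr_ge0 ?mulr_ge0//; exact: ltW.
rewrite -(subnK nm) addnC; elim: (m - n)%N => [|k IH]; first by rewrite addn0 !subrr normr0.
rewrite addnS big_ord_recr /= addrAC (le_trans (ler_normD _ _))//.
have := H (n + k)%N; rewrite exprS invfM.
have : 0 <= D / 4 ^+ (n + k) by rewrite divr_ge0// ltW.
move: IH; move: `|h _| `|_ - _| ((4 ^+ n)^-1) ((4 ^+ (n + k))^-1) => u v y z; lra.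
Qed.

(** The mean value theorem for each [F N], with an error that tends to zero. *)
Lemma is_derive_lim (F G : nat -> R -> R) (f g : R -> R) (t d : R) (e : nat -> R) :
  0 < d -> e @ \oo --> 0 ->
  (forall N s, `|s - t| < d -> is_derive s 1 (F N) (G N s)) ->
  (forall N s, `|s - t| < d -> `|f s - F N s| <= e N) ->
  (forall N s, `|s - t| < d -> `|g s - G N s| <= e N) ->
  (forall N, {for t, continuous (G N)}) ->
  is_derive t 1 f (g t).
Proof.
move=> d0 e0 dF hF hG cG; apply: is_derive_eps => r r0.
have r3 : 0 < r / 3 by rewrite divr_gt0.
have [N Ne] : exists N, e N <= r / 3.
  move/cvgrPdist_le : e0 => /(_ _ r3)[N _ /(_ N (leqnn N))]; rewrite sub0r normrN => h.
  by exists N; apply: le_trans h; exact: ler_norm.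
have [d1 d10 H1] : exists2 d1 : R, 0 < d1 & forall s, `|s - t| < d1 -> `|G N s - G N t| <= r / 3.
  have /cvgrPdist_le /(_ _ r3) /nbhs_ballP[d1 /= d10 H] := cG N.
  by exists d1 => // s; rewrite distrC => /H; rewrite distrC.
have tt : `|t - t| < d by rewrite subrr normr0.
have gr s : `|s - t| < Num.min d d1 -> `|g s - g t| <= r.
  rewrite lt_min => /andP[sd sd1].
  have := norm_tri (hG N s sd) (hG N t tt) (H1 s sd1); move=> /le_trans; apply; lra.
exists (Num.min d d1); first by rewrite lt_min d0.
move=> h hd; have hd' : `|h| < d by move: hd; rewrite lt_min => /andP[].
have th : `|t + h - t| < d by rewrite addrAC subrr add0r.
apply: (@cvg_le_lim _ (fun n => `|h| * e n + 2 * e n)).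
  have -> : 0 = `|h| * 0 + 2 * 0 :> R by rewrite !mulr0 addr0.
  by apply: cvgD; apply: cvgM => //; exact: cvg_cst.
move=> n.
have M : `|F n (t + h) - F n t - h * g t| <= `|h| * (r + e n).
  apply: (mvt_diff (d := Num.min d d1) (u' := G n)) => // s.
    by rewrite lt_min => /andP[sd _]; exact: dF.
  move=> sd; have sd' : `|s - t| < d by move: sd; rewrite lt_min => /andP[].
  have := hG n s sd'; rewrite distrC => h1.
  by apply: le_trans (ler_distD (g s) _ _) _; rewrite addrC lerD// gr.
have h1 := hF n _ th; have h2 := hF n _ tt.
have -> : f (t + h) - f t - h * g t =
  (f (t + h) - F n (t + h)) + (F n (t + h) - F n t - h * g t) - (f t - F n t) by ring.
rewrite (le_trans (ler_normB _ _))//; have := ler_normD (f (t + h) - F n (t + h)) (F n (t + h) - F n t - h * g t).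
move: M h1 h2; set a := `|_ - _ - _|; set b := `|_|; set c := `|_|; set z := `|_ + _|.
rewrite mulrDr; lra.
Qed.

End GeomSeries.

Section FunSeries.
Context {R : realType} {T : topologicalType}.
Implicit Types (h A B : nat -> T -> R).

Definition gs h (x : T) : R := lim (\sum_(n < N) h n x @[N --> \oo]).

Definition geo h (D : R) := forall n x, `|h n x| <= D / 4 ^+ n.

Lemma gs_uniq h (r : R) (e : nat -> R) x : e @ \oo --> 0 ->
  (forall N, `|r - \sum_(n < N) h n x| <= e N) -> gs h x = r.
Proof.
move=> e0 H; apply: cvg_lim => //; apply/cvgrPdist_le => d d0.
move/cvgrPdist_le : e0 => /(_ _ d0); apply: filterS => N; rewrite sub0r normrN.
by move=> h1; apply: le_trans (H N) _; apply: le_trans h1; exact: ler_norm.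
Qed.

Section bounded.
Variables (h : nat -> T -> R) (D : R).
Hypothesis hD : geo h D.

Lemma gs_rate N x : `|gs h x - \sum_(n < N) h n x| <= 2 * D / 4 ^+ N.
Proof.
have c : (fun N : nat => 2 * D / 4 ^+ N) @ \oo --> (0 : R) by apply: cvg_geo; rewrite ltr1n.
have [_] := seq_cvg_rate (u := fun N => \sum_(n < N) h n x) c (geo_part (fun n => hD n x)).
exact.
Qed.

Lemma gs_continuous : (forall n, continuous (h n)) -> continuous (gs h).
Proof.
move=> ch; have c : (fun N : nat => 2 * D / 4 ^+ N) @ \oo --> (0 : R) by apply: cvg_geo; rewrite ltr1n.
apply: (unif_lim_continuous c); last exact: gs_rate.
by move=> N; apply: ct_sum => n; exact: ch.
Qed.

Lemma gs_norm x : `|gs h x| <= 2 * D.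
Proof. by have := gs_rate 0 x; rewrite big_ord0 subr0 expr0 divr1. Qed.

End bounded.

(** The terms left out have total degree at least [N]. *)
Lemma gs_mul_rate A B D D' x N : geo A D -> geo B D' ->
  `|gs A x * gs B x - \sum_(n < N) \sum_(i < n.+1) A i x * B (n - i)%N x| <=
  6 * (D * D') / 2 ^+ N.
Proof.
move=> hA hB.
have D0 : 0 <= D by have := le_trans (normr_ge0 _) (hA 0%N x); rewrite expr0 divr1.
have D'0 : 0 <= D' by have := le_trans (normr_ge0 _) (hB 0%N x); rewrite expr0 divr1.
have DD : 0 <= D * D' by rewrite mulr_ge0.
rewrite (sum_tri (A ^~ x) (B ^~ x)).
have -> : gs A x * gs B x - \sum_(i < N) A i x * \sum_(j < N - i) B j x =
    (gs A x - \sum_(i < N) A i x) * gs B x +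
    \sum_(i < N) A i x * (gs B x - \sum_(j < N - i) B j x).
  under [X in _ = _ + X]eq_bigr do rewrite mulrBr.
  by rewrite sumrB -mulr_suml; ring.
apply: le_trans (ler_normD _ _) _.
have t1 : `|(gs A x - \sum_(i < N) A i x) * gs B x| <= 2 * D / 4 ^+ N * (2 * D').
  by rewrite normrM ler_pM//; [exact: gs_rate|exact: gs_norm hB _].
have t2 : `|\sum_(i < N) A i x * (gs B x - \sum_(j < N - i) B j x)| <= N%:R * (2 * (D * D') / 4 ^+ N).
  apply: le_trans (ler_norm_sum _ _ _) _.
  apply: (@le_trans _ _ (\sum_(i < N) (2 * (D * D') / 4 ^+ N))); last first.
    by rewrite sumr_const card_ord -[leLHS]mulr_natl.
  apply: ler_sum => i _; rewrite normrM.
  apply: (@le_trans _ _ (D / 4 ^+ i * (2 * D' / 4 ^+ (N - i)))).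
    by apply: ler_pM => //; exact: gs_rate.
  have -> : (4 : R) ^+ N = 4 ^+ i * 4 ^+ (N - i) by rewrite -exprD subnKC// ltnW.
  rewrite (invfM (4 ^+ i)); move: ((4 ^+ i)^-1) ((4 ^+ (N - i))^-1) => u v.
  by rewrite le_eqVlt; apply/orP; left; apply/eqP; ring.
apply: le_trans (lerD t1 t2) _.
have -> : 2 * D / 4 ^+ N * (2 * D') + N%:R * (2 * (D * D') / 4 ^+ N) =
  (D * D') * ((4 + 2 * N%:R) / 4 ^+ N) by move: ((4 ^+ N)^-1) => u; ring.
rewrite (mulrC 6) -[leRHS]mulrA; apply: ler_wpM2l => //.
have -> : (4 : R) ^+ N = 2 ^+ N * 2 ^+ N by rewrite -exprMn; congr (_ ^+ _); ring.
have N2 : (N%:R : R) <= 2 ^+ N by rewrite -natrX ler_nat ltnW// ltn_expl.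
have p1 : 1 <= (2 : R) ^+ N by rewrite exprn_ege1// ler1n.
have p0 : 0 < (2 : R) ^+ N by rewrite exprn_gt0.
rewrite invfM mulrA; apply: ler_wpM2r; first by rewrite invr_ge0 ltW.
by rewrite ler_pdivrMr//; lra.
Qed.

End FunSeries.

(** * Taylor coefficients in time *)

Section Bilinear.
Context {R : realType}.
Local Notation X := (R * R)%type.
Local Notation Z2 := (int * int)%type.
Implicit Types (k l m : Z2) (p q : Z2 -> R).
Local Notation il k := (inv_sqrt_laplacian_symbol k : R).

Definition supp (M : nat) p := forall k, k \notin box M -> p k = 0.

Lemma sum_ext (s t : seq Z2) (F : Z2 -> R) : uniq s -> uniq t -> {subset s <= t} ->
  (forall k, k \in t -> k \notin s -> F k = 0) -> \sum_(k <- t) F k = \sum_(k <- s) F k.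
Proof.
move=> us ut st F0; rewrite (perm_big _ (perm_sub_cat us ut st)) big_cat /=.
rewrite [X in _ + X]big_seq [X in _ + X]big1 ?addr0// => k.
by rewrite mem_filter => /andP[ks kt]; exact: F0.
Qed.

Lemma sum_supp M L p : supp M p -> (M <= L)%N -> \sum_(k <- box L) p k = \sum_(k <- box M) p k.
Proof.
move=> sp ML; apply: sum_ext; [exact: box_uniq|exact: box_uniq|exact: box_sub|].
by move=> k _; exact: sp.
Qed.

Lemma box_add M N k l : k \in box M -> l \in box N -> k + l \in box (M + N).
Proof.
by case: k l => [a b] [c d]; rewrite !mem_box /=; lia.
Qed.

Lemma sum_shift M N L l p : supp M p -> l \in box N -> (M + N <= L)%N ->
  \sum_(k <- box L) p (k - l) = \sum_(k <- box M) p k.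
Proof.
move=> sp lN ML; rewrite (@sum_ext [seq m + l | m <- box M]).
- by rewrite big_map; apply: eq_bigr => m _; rewrite addrK.
- by rewrite map_inj_uniq ?box_uniq//; exact: addIr.
- exact: box_uniq.
- by move=> k /mapP[m mM ->]; apply: (box_sub ML); exact: box_add.
- move=> k _ kn; apply: sp; apply: contra kn => kM.
  by apply/mapP; exists (k - l); rewrite ?subrK.
Qed.

Definition wedge l m : R := l.1%:~R * m.2%:~R - l.2%:~R * m.1%:~R.

Lemma wedgeB l k : wedge l (k - l) = wedge l k.
Proof. by rewrite /wedge /= !intrB; ring. Qed.

(** The Fourier coefficients of the transport of [q] by the stream function with
    coefficients [il k * p k]. *)
Definition bilin L p q k : R := \sum_(l <- box L) wedge l k * il l * p l * q (k - l).

Lemma bilin_term_eq0 M N p q k l : supp M p -> supp N q -> k \notin box (M + N) -> p l * q (k - l) = 0.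
Proof.
move=> sp sq kn; have [lM|/sp->] := boolP (l \in box M); last by rewrite mul0r.
have [kN|/sq->] := boolP (k - l \in box N); last by rewrite mulr0.
by move: kn; rewrite -(subrK l k) addrC (box_add lM kN).
Qed.

Lemma bilin_supp L M N p q : supp M p -> supp N q -> supp (M + N) (bilin L p q).
Proof.
move=> sp sq k kn; rewrite /bilin big1// => l _.
by rewrite -mulrA (bilin_term_eq0 l sp sq kn) mulr0.
Qed.

Lemma bilin_even L p q : (forall k, p (- k) = p k) -> (forall k, q (- k) = q k) ->
  forall k, bilin L p q (- k) = bilin L p q k.
Proof.
move=> ep eq k; rewrite /bilin -box_opp; apply: eq_bigr => l _.
rewrite ilN ep -opprD eq; congr (_ * _ * _ * _); rewrite /wedge /= !intrN; ring.
Qed.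

(** The stream function has one more derivative than its velocity uses, so only
    the size of [m] counts. *)
Lemma wedge_il_le l m M : m \in box M -> `|wedge l m * il l| <= 2 * M%:R.
Proof.
rewrite mem_box => /andP[m1 m2].
have h (x : int) : (`|x| <= M)%N -> `|x%:~R : R| <= M%:R.
  by move=> xM; rewrite -intr_norm -abszE -pmulrn ler_nat.
have i1 : `|l.1%:~R * il l| <= 1 by apply: il_k_le; rewrite /sqnormk lerDl sqr_ge0.
have i2 : `|l.2%:~R * il l| <= 1 by apply: il_k_le; rewrite /sqnormk lerDr sqr_ge0.
have -> : wedge l m * il l = (l.1%:~R * il l) * m.2%:~R - (l.2%:~R * il l) * m.1%:~R.
  by rewrite /wedge; ring.
rewrite (le_trans (ler_normB _ _))// mulr2n mulrDl mul1r.
by rewrite (normrM (l.1%:~R * _)) (normrM (l.2%:~R * _)) lerD// -[leRHS]mul1r ler_pM// h.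
Qed.

(** Young's inequality for the convolution; the derivative of [q] costs the
    factor [N]. *)
Lemma bilin_norm L M N p q : supp M p -> supp N q -> (M <= L)%N ->
  \sum_(k <- box (M + N)) `|bilin L p q k| <=
  2 * N%:R * ((\sum_(k <- box M) `|p k|) * (\sum_(k <- box N) `|q k|)).
Proof.
move=> sp sq ML.
have sq' : supp N (fun k => `|q k|) by move=> k /sq ->; rewrite normr0.
apply: (@le_trans _ _ (\sum_(k <- box (M + N)) \sum_(l <- box M) `|p l| * (2 * N%:R * `|q (k - l)|))).
  apply: ler_sum => k _; rewrite /bilin (@sum_supp M L _ _ ML); last first.
    by move=> l /sp ->; rewrite mulr0 mul0r.
  apply: (le_trans (ler_norm_sum _ _ _)); apply: ler_sum => l _.
  have -> : wedge l k * il l * p l * q (k - l) = p l * (wedge l (k - l) * il l * q (k - l)).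
    by rewrite wedgeB; ring.
  rewrite (normrM (p l)); apply: ler_wpM2l => //.
  have [kN|/sq->] := boolP (k - l \in box N); last by rewrite !mulr0 normr0 mulr0.
  by rewrite (normrM (wedge _ _ * _)); apply: ler_wpM2r => //; exact: wedge_il_le.
rewrite exchange_big /= mulrA (mulrC (2 * _)) -mulrA mulr_suml.
rewrite big_seq [leRHS]big_seq; apply: ler_sum => l lM.
by rewrite -mulr_sumr -mulr_sumr (sum_shift sq' lM)// addnC.
Qed.

End Bilinear.

Section Recursion.
Context {R : realType}.
Local Notation X := (R * R)%type.
Local Notation Z2 := (int * int)%type.
Implicit Types (k l m : Z2) (p q : Z2 -> R).
Local Notation il k := (inv_sqrt_laplacian_symbol k : R).
Variable (a0 : Z2 -> R).

(** Course-of-values recursion: [hist n] contains the coefficients up to [n]. *)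
Fixpoint hist (n : nat) : nat -> Z2 -> R :=
  match n with
  | 0 => fun _ => a0
  | n1.+1 => fun i => if (i <= n1)%N then hist n1 i else
      fun k => n1.+1%:R^-1 * \sum_(j < n1.+1) bilin (2 * n1.+1) (hist n1 j) (hist n1 (n1 - j)) k
  end.

(** The coefficients of [t^n], obtained by identification in the equation. *)
Definition tcoef n := hist n n.

Lemma histE (m i : nat) : (i <= m)%N -> hist m i = tcoef i.
Proof.
elim: m i => [|m IH] i; first by rewrite leqn0 => /eqP ->.
rewrite leq_eqVlt => /orP[/eqP ->//|]; rewrite ltnS => im.
by rewrite /= im IH.
Qed.

Lemma tcoefS n k : tcoef n.+1 k =
  n.+1%:R^-1 * \sum_(j < n.+1) bilin (2 * n.+1) (tcoef j) (tcoef (n - j)) k.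
Proof.
rewrite {1}/tcoef /= ltnn; congr (_ * _); apply: eq_bigr => j _.
by rewrite !histE// ?leq_subr// -ltnS.
Qed.

Hypothesis a0_even : forall k, a0 (- k) = a0 k.
Hypothesis a0_supp : supp 2 a0.

(** The supports of the factors add up. *)
Lemma tcoef_supp n : supp (2 * n.+1) (tcoef n).
Proof.
elim/ltn_ind: n => -[|n] IH; first by rewrite muln1.
move=> k kn; rewrite tcoefS big1 ?mulr0// => j _.
have jn : (j < n.+1)%N by [].
apply: (@bilin_supp _ _ (2 * j.+1) (2 * (n - j).+1)).
- exact: IH.
- by apply: IH; rewrite ltnS leq_subr.
- by rewrite -mulnDr addSn addnS subnKC.
Qed.

Lemma tcoef_even n k : tcoef n (- k) = tcoef n k.
Proof.
elim/ltn_ind: n k => -[|n] IH k; first exact: a0_even.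
rewrite !tcoefS; congr (_ * _); apply: eq_bigr => j _.
apply: bilin_even => l; apply: IH; first exact: ltn_ord.
by rewrite ltnS leq_subr.
Qed.

Definition tnorm n : R := \sum_(k <- box (2 * n.+1)) `|tcoef n k|.

Lemma tnorm_ge0 n : 0 <= tnorm n. Proof. exact: sumr_ge0. Qed.

(** The derivative costs a factor of order [n + 1], which the division in
    [tcoefS] returns. *)
Lemma tnormS n : tnorm n.+1 <= 4 * \sum_(j < n.+1) tnorm j * tnorm (n - j).
Proof.
rewrite /tnorm; under eq_bigr do rewrite tcoefS normrM.
rewrite -mulr_sumr ger0_norm ?invr_ge0// ler_pdivrMl// mulrA (mulrC _ 4) mulr_sumr.
apply: (@le_trans _ _ (\sum_(k <- box (2 * n.+2)) \sum_(j < n.+1)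
    `|bilin (2 * n.+1) (tcoef j) (tcoef (n - j)) k|)).
  by apply: ler_sum => k _; exact: ler_norm_sum.
rewrite exchange_big /=; apply: ler_sum => j _.
have jn : (j <= n)%N by rewrite -ltnS.
have -> : (2 * n.+2 = 2 * j.+1 + 2 * (n - j).+1)%N by rewrite -mulnDr addSn addnS subnKC.
apply: le_trans (bilin_norm (@tcoef_supp j) (@tcoef_supp (n - j)) _) _.
  by rewrite leq_mul2l ltnS.
apply: ler_wpM2r; first by rewrite mulr_ge0 ?sumr_ge0.
rewrite natrM mulrA -natrM ler_wpM2l// ler_nat ltnS leq_subr//.
Qed.

Variable b : R.
Hypotheses (b0 : 0 < b) (a0_norm : \sum_(k <- box 2) `|a0 k| <= b).
Let T := (16 * b)^-1.

(** The partial sums satisfy [S_(N+1) <= b + 4 T S_N^2], and [b + 4 T (2 b)^2 =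
    2 b] for this [T]. *)
Lemma tnorm_sum N : \sum_(n < N) T ^+ n * tnorm n <= 2 * b.
Proof.
have T0 : 0 <= T by rewrite invr_ge0 mulr_ge0// ltW.
have u0 n : 0 <= T ^+ n * tnorm n by rewrite mulr_ge0 ?exprn_ge0// tnorm_ge0.
elim: N => [|N IH]; first by rewrite big_ord0 mulr_ge0// ltW.
rewrite big_ord_recl expr0 mul1r.
have -> : 2 * b = b + b by ring.
apply: lerD; first by rewrite /tnorm muln1.
apply: (@le_trans _ _ (4 * T * \sum_(n < N) \sum_(j < n.+1) (T ^+ j * tnorm j) * (T ^+ (n - j) * tnorm (n - j)))).
  rewrite mulr_sumr; apply: ler_sum => n _; rewrite lift0 exprS -mulrA.
  rewrite (mulrC 4) -[leRHS]mulrA; apply: ler_wpM2l => //.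
  have -> : \sum_(j < n.+1) (T ^+ j * tnorm j) * (T ^+ (n - j) * tnorm (n - j)) =
      T ^+ n * \sum_(j < n.+1) tnorm j * tnorm (n - j).
    rewrite mulr_sumr; apply: eq_bigr => j _; have jn : (j <= n)%N by rewrite -ltnS.
    by rewrite mulrACA -exprD subnKC.
  by rewrite mulrCA; apply: ler_wpM2l; [exact: exprn_ge0|exact: tnormS].
have h : (\sum_(n < N) T ^+ n * tnorm n) ^+ 2 <= (2 * b) ^+ 2.
  rewrite lerXn2r ?nnegrE//; last by rewrite mulr_ge0// ltW.
  exact: sumr_ge0.
have := le_trans (sum_tri_le N u0) h; move=> {}h.
apply: (@le_trans _ _ (4 * T * (2 * b) ^+ 2)); first by apply: ler_wpM2l => //; exact: mulr_ge0.
by rewrite /T le_eqVlt; apply/orP; left; apply/eqP; field; rewrite gt_eqF.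
Qed.

Lemma tnorm_le n : T ^+ n * tnorm n <= 2 * b.
Proof.
have T0 : 0 <= T by rewrite invr_ge0 mulr_ge0// ltW.
apply: le_trans (tnorm_sum n.+1); rewrite big_ord_recr /= lerDr.
by apply: sumr_ge0 => j _; rewrite mulr_ge0 ?exprn_ge0// tnorm_ge0.
Qed.

Lemma bin_le_exp (n m : nat) : ('C(n, m) <= 2 ^ n)%N.
Proof.
elim: n m => [|n IH] [|m]; rewrite ?bin0 ?bin0n ?expn_gt0//.
by rewrite binS expnS mul2n -addnn leq_add.
Qed.

(** The power is at most a falling factorial, that is a binomial coefficient up
    to [p!]. *)
Lemma pow_le_exp (p : nat) : exists2 C : R, 0 <= C & forall n : nat, n.+1%:R ^+ p <= C * 2 ^+ n.
Proof.
exists (2 ^+ p * p`!%:R); first by rewrite mulr_ge0// exprn_ge0.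
move=> n; have h : (n.+1 ^ p <= (n + p) ^_ p)%N.
  elim: p => [|p IH]; first by rewrite ffactn0.
  by rewrite addnS ffactnS /= expnS leq_mul// ltnS leq_addr.
rewrite -bin_ffact in h.
have h2 : ('C(n + p, p) <= 2 ^ (n + p))%N.
  exact: bin_le_exp.
have : (n.+1 ^ p <= 2 ^ (n + p) * p`!)%N by apply: leq_trans h _; rewrite leq_mul2r h2 orbT.
by rewrite -(ler_nat R) natrX natrM natrX exprD; move: (2 ^+ n) (2 ^+ p) (p`!%:R) => x y z; lra.
Qed.

Lemma sq_in_box n k : k \in box (2 * n.+1) -> sq k <= 9 * n.+1%:R ^+ 2 :> R.
Proof.
rewrite mem_box => /andP[h1 h2].
have h (x : int) : (`|x| <= 2 * n.+1)%N -> (x%:~R : R) ^+ 2 <= 4 * n.+1%:R ^+ 2.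
  move=> xM; rewrite -real_normK ?num_real//.
  have -> : 4 * n.+1%:R ^+ 2 = (2 * n.+1)%:R ^+ 2 :> R by rewrite natrM; ring.
  by rewrite lerXn2r ?nnegrE// -intr_norm -abszE -pmulrn ler_nat.
have : 1 <= n.+1%:R ^+ 2 :> R by rewrite exprn_ege1// ler1n.
have := h _ h1; have := h _ h2; rewrite /sq /sqnormk; lra.
Qed.

(** The weight is polynomial in [n] on the support, which a shorter time
    absorbs. *)
Lemma tcoef_decay (p : nat) : exists2 D : R, 0 <= D & forall n : nat,
  (128 * b)^-1 ^+ n * (n.+1%:R * \sum_(k <- box (2 * n.+1)) sq k ^+ p * `|tcoef n k|) <= D / 4 ^+ n.
Proof.
have [C C0 HC] := pow_le_exp (2 * p).+1.
exists (9 ^+ p * C * (2 * b)) => [|n]; first by rewrite !mulr_ge0// ?exprn_ge0// ltW.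
have h : \sum_(k <- box (2 * n.+1)) sq k ^+ p * `|tcoef n k| <= (9 * n.+1%:R ^+ 2) ^+ p * tnorm n.
  rewrite /tnorm mulr_sumr big_seq [leRHS]big_seq; apply: ler_sum => k kn.
  apply: ler_wpM2r => //; rewrite lerXn2r ?nnegrE ?(ltW (sq_gt0 _)) ?sq_in_box//.
have n1 : 0 <= n.+1%:R :> R by [].
have T0 : 0 <= T ^+ n by rewrite exprn_ge0// invr_ge0 mulr_ge0// ltW.
have -> : (128 * b)^-1 ^+ n = T ^+ n / 8 ^+ n.
  by rewrite /T -exprVn -exprMn -invfM; congr ((_)^-1 ^+ _); ring.
have -> : (8 : R) ^+ n = 2 ^+ n * 4 ^+ n by rewrite -exprMn; congr (_ ^+ _); ring.
have e2 : 0 < (2 : R) ^+ n by rewrite exprn_gt0.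
have e4 : 0 < (4 : R) ^+ n by rewrite exprn_gt0.
set Y := n.+1%:R * _.
have -> : T ^+ n / (2 ^+ n * 4 ^+ n) * Y = (T ^+ n * Y / 2 ^+ n) / 4 ^+ n.
  by rewrite (invfM (2 ^+ n)); move: (T ^+ n) Y ((2 ^+ n)^-1) ((4 ^+ n)^-1) => *; ring.
apply: ler_wpM2r; first by rewrite invr_ge0 ltW.
rewrite ler_pdivrMr// /Y.
apply: (@le_trans _ _ (T ^+ n * (n.+1%:R * ((9 * n.+1%:R ^+ 2) ^+ p * tnorm n)))).
  by apply: ler_wpM2l => //; exact: ler_wpM2l.
have -> : T ^+ n * (n.+1%:R * ((9 * n.+1%:R ^+ 2) ^+ p * tnorm n)) =
  9 ^+ p * n.+1%:R ^+ (2 * p).+1 * (T ^+ n * tnorm n).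
  by rewrite exprMn -exprM exprS; ring.
have -> : 9 ^+ p * C * (2 * b) * 2 ^+ n = 9 ^+ p * (C * 2 ^+ n) * (2 * b) by ring.
apply: ler_pM; last exact: tnorm_le.
- by rewrite mulr_ge0// exprn_ge0.
- by rewrite mulr_ge0// tnorm_ge0.
- by apply: ler_wpM2l; [exact: exprn_ge0|exact: HC].
Qed.

End Recursion.

(** * Transport of cosine polynomials *)

Section TrigProduct.
Context {R : realType}.
Local Notation X := (R * R)%type.
Local Notation Z2 := (int * int)%type.
Implicit Types (k l m : Z2) (p q : Z2 -> R).
Local Notation il k := (inv_sqrt_laplacian_symbol k : R).

Definition cosp (M : nat) p : X -> R := trigp (box M) p (fun=> 0).
Definition dcosp1 (M : nat) p : X -> R := trigp (box M) (fun=> 0) (fun k => - k.1%:~R * p k).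
Definition dcosp2 (M : nat) p : X -> R := trigp (box M) (fun=> 0) (fun k => - k.2%:~R * p k).

Lemma cosp_derive1 M p (x : X) :
  is_derive x.1 1 (fun y : R => cosp M p (y, x.2)) (dcosp1 M p x).
Proof.
apply: is_derive_bigsum => k; have h1 := is_derive_cs1 k x; have h2 := is_derive_sn1 k x.
by apply: is_derive_eq; rewrite /GRing.scale/=; ring.
Qed.

Lemma cosp_derive2 M p (x : X) :
  is_derive x.2 1 (fun y : R => cosp M p (x.1, y)) (dcosp2 M p x).
Proof.
apply: is_derive_bigsum => k; have h1 := is_derive_cs2 k x; have h2 := is_derive_sn2 k x.
by apply: is_derive_eq; rewrite /GRing.scale/=; ring.
Qed.

(** A product of sines is a difference of cosines at [l + m] and [l - m]; the
    sums of both are equal up to sign by [m |-> - m]. *)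
Lemma cosp_transport M N L p q x : (forall k, q (- k) = q k) ->
  supp M p -> supp N q -> (M <= L)%N ->
  dcosp2 M (fun k => il k * p k) x * dcosp1 N q x -
  dcosp1 M (fun k => il k * p k) x * dcosp2 N q x = cosp (M + N) (bilin L p q) x.
Proof.
move=> eq sp sq ML.
pose W l m := wedge l m * il l * p l * q m : R.
have E : dcosp2 M (fun k => il k * p k) x * dcosp1 N q x -
    dcosp1 M (fun k => il k * p k) x * dcosp2 N q x =
    \sum_(l <- box M) \sum_(m <- box N) - (W l m * (sn l x * sn m x)).
  rewrite /dcosp1 /dcosp2 /trigp !mulr_suml -sumrB; apply: eq_bigr => l _.
  rewrite !mulr_sumr -sumrB; apply: eq_bigr => m _.
  rewrite /W /wedge; ring.
have H : \sum_(l <- box M) \sum_(m <- box N) W l m * cs (l - m) x =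
    - \sum_(l <- box M) \sum_(m <- box N) W l m * cs (l + m) x.
  rewrite -sumrN; apply: eq_bigr => l _; rewrite -box_opp -sumrN; apply: eq_bigr => m _.
  by rewrite /W eq opprK /wedge /= !intrN; ring.
have -> : dcosp2 M (fun k => il k * p k) x * dcosp1 N q x -
    dcosp1 M (fun k => il k * p k) x * dcosp2 N q x =
    \sum_(l <- box M) \sum_(m <- box N) W l m * cs (l + m) x.
  (* Product to sum. *)
  have F : \sum_(l <- box M) \sum_(m <- box N) - (W l m * (sn l x * sn m x)) =
      2^-1 * (\sum_(l <- box M) \sum_(m <- box N) W l m * cs (l + m) x -
              \sum_(l <- box M) \sum_(m <- box N) W l m * cs (l - m) x).
    rewrite -sumrB mulr_sumr; apply: eq_bigr => l _.
    rewrite -sumrB mulr_sumr; apply: eq_bigr => m _.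
    by rewrite /cs /sn !phaseD phaseN cosB cosD; field.
  rewrite E F H opprK.
  by set z := \sum_(_ <- _) _; field.
rewrite /cosp /trigp.
under [RHS]eq_bigr do rewrite mul0r addr0.
transitivity (\sum_(k <- box (M + N)) \sum_(l <- box M) W l (k - l) * cs k x); last first.
  apply: eq_bigr => k _; rewrite /bilin (@sum_supp _ M L _ _ ML); last first.
    by move=> l /sp ->; rewrite mulr0 mul0r.
  by rewrite mulr_suml; apply: eq_bigr => l _; rewrite /W wedgeB.
rewrite [RHS]exchange_big /= big_seq [RHS]big_seq; apply: eq_bigr => l lM.
rewrite -(@sum_shift _ N M (M + N) l (fun m => W l m * cs (l + m) x)) ?(addnC N)//.
  by apply: eq_bigr => k _; rewrite [l + _]addrC subrK.
by move=> m /sq h; rewrite /W h mulr0 mul0r.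
Qed.

Lemma is_derive_scale (u : R -> R) (r s du : R) : is_derive s 1 u du ->
  is_derive s 1 (fun y => r * u y) (r * du).
Proof. by move=> h; apply: is_derive_eq; rewrite /GRing.scale/=; ring. Qed.

Lemma ct_slice1 (f : X -> R) (r : R) : continuous f -> continuous (fun y : R => f (y, r)).
Proof.
move=> cf y; apply: (@continuous_comp _ _ _ (fun y : R => (y, r)) f); last exact: cf.
exact: pair_continuousl.
Qed.

Lemma ct_slice2 (f : X -> R) (r : R) : continuous f -> continuous (fun y : R => f (r, y)).
Proof.
move=> cf y; apply: (@continuous_comp _ _ _ (fun y : R => (r, y)) f); last exact: cf.
exact: pair_continuousr.
Qed.

Lemma coef_cosp M p k : (forall k, p (- k) = p k) -> supp M p ->
  al (cosp M p) k = p k /\ be (cosp M p) k = 0.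
Proof.
move=> ep sp.
pose L := maxn M (maxn (absz k.1) (absz k.2)).
have kL : k \in box L by rewrite mem_box !leq_max !leqnn !orbT.
have -> : cosp M p = trigp (box L) p (fun=> 0).
  apply/funext => x; rewrite /cosp /trigp; apply/esym.
  apply: sum_supp; last exact: leq_maxl.
  by move=> l /sp ->; rewrite !mul0r addr0.
by rewrite al_trigp// be_trigp// => l; rewrite oppr0.
Qed.

End TrigProduct.

Section Norms.
Context {R : realType}.
Local Notation X := (R * R)%type.
Local Notation Z2 := (int * int)%type.

Lemma sum_sqr_le (s : seq Z2) (x : Z2 -> R) : (forall k, 0 <= x k) ->
  \sum_(k <- s) x k ^+ 2 <= (\sum_(k <- s) x k) ^+ 2.
Proof.
move=> x0; elim: s => [|k s IH]; first by rewrite !big_nil expr0n.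
rewrite !big_cons; have : 0 <= \sum_(k <- s) x k by exact: sumr_ge0.
by move: IH (x0 k); set u := \sum_(_ <- _) _; set v := \sum_(_ <- _) _; nra.
Qed.

(** The sum of squares of nonnegative numbers is at most the square of their
    sum. *)
Lemma Hs_norm_l1 (s : R) (p : nat) f (B : R) : s <= (p.*2)%:R -> 0 <= B ->
  (forall k, be f k = 0) ->
  (forall K, \sum_(k <- box K) sq k ^+ p * `|al f k| <= B) -> (Hs_norm s f <= B%:E)%E.
Proof.
move=> sp B0 bf H; apply: Hs_norm_le => // K.
apply: (@le_trans _ _ (\sum_(k <- box K) (sq k ^+ p * `|al f k|) ^+ 2)).
  apply: ler_sum => k _; rewrite bf expr0n addr0 (exprMn 2 (sq k ^+ p)) real_normK ?num_real//.
  by rewrite -exprM muln2 ler_wpM2r ?sqr_ge0// powR_le_exp.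
have x0 (k : Z2) : 0 <= sq k ^+ p * `|al f k| by rewrite mulr_ge0// exprn_ge0// ltW// sq_gt0.
apply: (le_trans (sum_sqr_le _ x0)); rewrite lerXn2r ?nnegrE//.
by apply: sumr_ge0 => k _; exact: x0.
Qed.

End Norms.

(** * Power series in time *)

Section Analytic.
Context {R : realType}.
Local Notation X := (R * R)%type.
Local Notation Z2 := (int * int)%type.
Implicit Types (k l m : Z2) (t : R).
Local Notation il k := (inv_sqrt_laplacian_symbol k : R).
Variables (c : nat -> Z2 -> R) (T D : R) (p : nat).
Hypotheses (T0 : 0 < T) (p1 : (0 < p)%N).
Hypothesis c_supp : forall n, supp (2 * n.+1) (c n).
Hypothesis c_even : forall n k, c n (- k) = c n k.
Hypothesis c_decay : forall n,
  T ^+ n * (n.+1%:R * \sum_(k <- box (2 * n.+1)) sq k ^+ p * `|c n k|) <= D / 4 ^+ n.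

Let wt n := \sum_(k <- box (2 * n.+1)) sq k ^+ p * `|c n k|.
Let wt0 n : 0 <= wt n.
Proof. by apply: sumr_ge0 => k _; rewrite mulr_ge0// exprn_ge0// ltW// sq_gt0. Qed.

Lemma trig_term_le a b n t x : (forall k, `|a k| + `|b k| <= sq k ^+ p * `|c n k|) ->
  `|t| <= T -> `|t ^+ n * (n.+1%:R * trigp (box (2 * n.+1)) a b x)| <= D / 4 ^+ n.
Proof.
move=> ab tT; apply: le_trans (c_decay n); rewrite normrM normrX; apply: ler_pM => //.
  by rewrite lerXn2r ?nnegrE// ltW.
rewrite normrM ger0_norm//; apply: ler_wpM2l => //.
by apply: (le_trans (trigp_le _ _ _ _)); apply: ler_sum.
Qed.

Lemma trig_term_le1 a b n t x : (forall k, `|a k| + `|b k| <= sq k ^+ p * `|c n k|) ->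
  `|t| <= T -> `|t ^+ n * trigp (box (2 * n.+1)) a b x| <= D / 4 ^+ n.
Proof.
move=> ab tT; apply: le_trans (trig_term_le x ab tT).
by rewrite !normrM ler_wpM2l// ler_peMl// ger0_norm// ler1n.
Qed.

Lemma D_ge0 : 0 <= D.
Proof.
have := c_decay 0; rewrite !expr0 mul1r divr1 => /(le_trans _); apply.
by rewrite mul1r; exact: wt0.
Qed.

Section multiplier.
Variable (w : Z2 -> R).
Hypotheses (w0 : forall k, 0 <= w k) (w1 : forall k, w k <= 1) (wN : forall k, w (- k) = w k).

Definition fw n : X -> R := cosp (2 * n.+1) (fun k => w k * c n k).
Definition dfw1 n : X -> R := dcosp1 (2 * n.+1) (fun k => w k * c n k).
Definition dfw2 n : X -> R := dcosp2 (2 * n.+1) (fun k => w k * c n k).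

(** With [w = 1] this is the solution, with [w = il] its stream function. *)
Definition thw t : X -> R := gs (fun n x => t ^+ n * fw n x).

Let wc_le n k : `|w k * c n k| <= sq k ^+ p * `|c n k|.
Proof.
by rewrite normrM ger0_norm// ler_wpM2r// (le_trans (w1 k))// exprn_ege1// sq_ge1.
Qed.

Let wck_le n k (z : R) : `|z| <= sq k -> `|- z * (w k * c n k)| <= sq k ^+ p * `|c n k|.
Proof.
move=> h; rewrite mulNr normrN !normrM (ger0_norm (w0 k)) mulrA ler_wpM2r//.
apply: (@le_trans _ _ (sq k * 1)); first by apply: ler_pM.
by rewrite mulr1 -[leLHS]expr1 ler_weXn2l// sq_ge1.
Qed.

Lemma fw_geo t : `|t| <= T -> geo (fun n x => t ^+ n * fw n x) D.
Proof.
by move=> tT n x; apply: trig_term_le1 => // k; rewrite normr0 addr0.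
Qed.

Lemma dfw1_geo t : `|t| <= T -> geo (fun n x => t ^+ n * dfw1 n x) D.
Proof.
by move=> tT n x; apply: trig_term_le1 => // k; rewrite normr0 add0r wck_le// norm_k1_le.
Qed.

Lemma dfw2_geo t : `|t| <= T -> geo (fun n x => t ^+ n * dfw2 n x) D.
Proof.
by move=> tT n x; apply: trig_term_le1 => // k; rewrite normr0 add0r wck_le// norm_k2_le.
Qed.

Lemma ct_fw n : continuous (fw n). Proof. exact: ct_trigp. Qed.
Lemma ct_dfw1 n : continuous (dfw1 n). Proof. exact: ct_trigp. Qed.
Lemma ct_dfw2 n : continuous (dfw2 n). Proof. exact: ct_trigp. Qed.

Let cvg_rate : (fun N : nat => 2 * D / 4 ^+ N) @ \oo --> (0 : R).
Proof. by apply: cvg_geo; rewrite ltr1n. Qed.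

Lemma thw_derive1 t (x : X) : `|t| <= T ->
  is_derive x.1 1 (fun y : R => thw t (y, x.2)) (gs (fun n x => t ^+ n * dfw1 n x) x).
Proof.
move=> tT; pose g (y : R) := gs (fun n x => t ^+ n * dfw1 n x) (y, x.2).
have -> : gs (fun n x => t ^+ n * dfw1 n x) x = g x.1 by rewrite /g; case: (x).
apply: (@is_derive_lim _ (fun N y => \sum_(n < N) t ^+ n * fw n (y, x.2))
  (fun N y => \sum_(n < N) t ^+ n * dfw1 n (y, x.2)) (fun y => thw t (y, x.2)) g x.1 1 _ ltr01 cvg_rate).
- move=> N s _; apply: is_derive_bigsum => n.
  apply: is_derive_scale; exact: cosp_derive1 (2 * n.+1) (fun k => w k * c n k) (s, x.2).
- by move=> N s _; exact: gs_rate (fw_geo tT) _ _.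
- by move=> N s _; exact: gs_rate (dfw1_geo tT) _ _.
- move=> N; apply: ct_sum => n; have h := ct_slice1 (r := x.2) (@ct_dfw1 n); by ct.
Qed.

Lemma thw_derive2 t (x : X) : `|t| <= T ->
  is_derive x.2 1 (fun y : R => thw t (x.1, y)) (gs (fun n x => t ^+ n * dfw2 n x) x).
Proof.
move=> tT; pose g (y : R) := gs (fun n x => t ^+ n * dfw2 n x) (x.1, y).
have -> : gs (fun n x => t ^+ n * dfw2 n x) x = g x.2 by rewrite /g; case: (x).
apply: (@is_derive_lim _ (fun N y => \sum_(n < N) t ^+ n * fw n (x.1, y))
  (fun N y => \sum_(n < N) t ^+ n * dfw2 n (x.1, y)) (fun y => thw t (x.1, y)) g x.2 1 _ ltr01 cvg_rate).
- move=> N s _; apply: is_derive_bigsum => n.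
  apply: is_derive_scale; exact: cosp_derive2 (2 * n.+1) (fun k => w k * c n k) (x.1, s).
- by move=> N s _; exact: gs_rate (fw_geo tT) _ _.
- by move=> N s _; exact: gs_rate (dfw2_geo tT) _ _.
- move=> N; apply: ct_sum => n; have h := ct_slice2 (r := x.1) (@ct_dfw2 n); by ct.
Qed.

Lemma partial_thw t x : `|t| <= T ->
  partial1 (thw t) x = gs (fun n x => t ^+ n * dfw1 n x) x /\
  partial2 (thw t) x = gs (fun n x => t ^+ n * dfw2 n x) x.
Proof.
move=> tT; split.
  by rewrite /partial1 derive1E; have h := thw_derive1 x tT; apply: derive_val.
by rewrite /partial2 derive1E; have h := thw_derive2 x tT; apply: derive_val.
Qed.

Lemma C1per_thw t : `|t| <= T -> C1per (thw t).
Proof.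
move=> tT; split.
  by move=> x; split; congr (lim (_ @ \oo)); apply/funext => N; apply: eq_bigr => n _;
    have [h1 h2] := trigp_periodic (box (2 * n.+1)) (fun k => w k * c n k) (fun=> 0) x;
    rewrite /fw /cosp ?h1 ?h2.
split.
- by apply: (gs_continuous (fw_geo tT)) => n; have h := @ct_fw n; ct.
- by move=> x; have h := thw_derive1 x tT; exact: ex_derive.
- by move=> x; have h := thw_derive2 x tT; exact: ex_derive.
- rewrite (_ : partial1 _ = gs (fun n x => t ^+ n * dfw1 n x)); last first.
    by apply/funext => x; have [-> _] := partial_thw x tT.
  by apply: (gs_continuous (dfw1_geo tT)) => n; have h := @ct_dfw1 n; ct.
- rewrite (_ : partial2 _ = gs (fun n x => t ^+ n * dfw2 n x)); last first.
    by apply/funext => x; have [_ ->] := partial_thw x tT.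
  by apply: (gs_continuous (dfw2_geo tT)) => n; have h := @ct_dfw2 n; ct.
Qed.

Lemma coef_thw_rate t k N : `|t| <= T ->
  `|al (thw t) k - \sum_(n < N) t ^+ n * (w k * c n k)| <= 2 * D / 4 ^+ N /\
  `|be (thw t) k| <= 2 * D / 4 ^+ N.
Proof.
move=> tT; have [_ ct'] := C1per_cper (C1per_thw tT).
pose g (x : X) := \sum_(n < N) t ^+ n * fw n x.
have cg : continuous g by apply: ct_sum => n; have h := @ct_fw n; ct.
have coef n : al (fw n) k = w k * c n k /\ be (fw n) k = 0.
  apply: coef_cosp => l; first by rewrite wN c_even.
  by move=> /c_supp ->; rewrite mulr0.
have ag : al g k = \sum_(n < N) t ^+ n * (w k * c n k).
  rewrite /al (_ : (fun x => _) = fun x => \sum_(n < N) (t ^+ n * (fw n x * cs k x))); last first.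
    by apply/funext => x; rewrite mulr_suml; apply: eq_bigr => n _; rewrite mulrA.
  rewrite (mean_sum _ _).1; last by move=> n; have h := @ct_fw n; ct.
  apply: eq_bigr => n _; rewrite meanZ; last by have h := @ct_fw n; ct.
  by congr (_ * _); have [h _] := coef n.
have bg : be g k = 0.
  rewrite /be (_ : (fun x => _) = fun x => \sum_(n < N) (t ^+ n * (fw n x * sn k x))); last first.
    by apply/funext => x; rewrite mulr_suml; apply: eq_bigr => n _; rewrite mulrA.
  rewrite (mean_sum _ _).1; last by move=> n; have h := @ct_fw n; ct.
  rewrite big1// => n _; rewrite meanZ; last by have h := @ct_fw n; ct.
  by have [_ h] := coef n; rewrite -/(be (fw n) k) h mulr0.
have r x : `|thw t x - g x| <= 2 * D / 4 ^+ N by exact: gs_rate (fw_geo tT) _ _.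
rewrite -ag -[be (thw t) k]subr0 -bg -alB// -beB//; split.
  by apply: al_norm_le => //; ct.
by apply: be_norm_le => //; ct.
Qed.

Lemma be_thw t k : `|t| <= T -> be (thw t) k = 0.
Proof.
move=> tT; apply/eqP; rewrite -normr_le0; apply: (cvg_le0 (N := 0%N) cvg_rate) => N _.
by have [_] := coef_thw_rate k N tT.
Qed.

End multiplier.
End Analytic.

(** * Local existence *)

Section LocalSolution.
Context {R : realType}.
Local Notation X := (R * R)%type.
Local Notation Z2 := (int * int)%type.
Implicit Types (k l m : Z2) (t : R).
Local Notation il k := (inv_sqrt_laplacian_symbol k : R).
Variables (c : nat -> Z2 -> R) (T D : R) (p : nat).
Hypotheses (T0 : 0 < T) (p1 : (0 < p)%N).
Hypothesis c_supp : forall n, supp (2 * n.+1) (c n).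
Hypothesis c_even : forall n k, c n (- k) = c n k.
Hypothesis c_decay : forall n,
  T ^+ n * (n.+1%:R * \sum_(k <- box (2 * n.+1)) sq k ^+ p * `|c n k|) <= D / 4 ^+ n.
Hypothesis c_eq : forall n k,
  n.+1%:R * c n.+1 k = \sum_(j < n.+1) bilin (2 * n.+1) (c j) (c (n - j)) k.

Let one (k : Z2) : R := 1.
Let ill (k : Z2) : R := il k.
Let one0 k : 0 <= one k. Proof. exact: ler01. Qed.
Let one1 k : one k <= 1. Proof. exact: lexx. Qed.
Let oneN k : one (- k) = one k. Proof. by []. Qed.
Let il0 k : 0 <= ill k. Proof. exact: il_ge0. Qed.
Let il1 k : ill k <= 1. Proof. exact: il_le1. Qed.
Let illN k : ill (- k) = ill k. Proof. exact: ilN. Qed.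

Definition lsol (t : R) : X -> R := thw c (fun=> 1) t.
Definition lpsi (t : R) : X -> R := thw c (fun k => inv_sqrt_laplacian_symbol k) t.

Let D0 : 0 <= D. Proof. exact: D_ge0 c_decay. Qed.
Let C1t t : `|t| <= T -> C1per (lsol t). Proof. exact: (C1per_thw T0 p1 c_decay one0 one1). Qed.
Let C1p t : `|t| <= T -> C1per (lpsi t). Proof. exact: (C1per_thw T0 p1 c_decay il0 il1). Qed.

Lemma lsol_multiplier t : `|t| <= T -> is_inv_sqrt_laplacian (lsol t) (lpsi t).
Proof.
move=> tT; have [pp _] := C1p tT; have [_ cp] := C1per_cper (C1p tT).
split => // k; rewrite !fourier_coefE.
have bt : be (lsol t) k = 0 := be_thw T0 p1 c_supp c_even c_decay one0 one1 oneN k tT.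
have bp : be (lpsi t) k = 0 := be_thw T0 p1 c_supp c_even c_decay il0 il1 illN k tT.
have E : al (lpsi t) k = il k * al (lsol t) k.
  have cr : (fun N : nat => 4 * D / 4 ^+ N) @ \oo --> (0 : R) by apply: cvg_geo; rewrite ltr1n.
  apply/eqP; rewrite -subr_eq0 -normr_le0; apply: (cvg_le0 (N := 0%N) cr) => N _.
  have [h1 _] := coef_thw_rate T0 p1 c_supp c_even c_decay one0 one1 oneN k N tT.
  have [h2 _] := coef_thw_rate T0 p1 c_supp c_even c_decay il0 il1 illN k N tT.
  rewrite -/(lsol t) in h1; rewrite -/(lpsi t) in h2.
  set s1 := \sum_(_ < _) _ in h1; set s2 := \sum_(_ < _) _ in h2.
  have e : s2 = il k * s1.
    by rewrite /s1 /s2 mulr_sumr; apply: eq_bigr => n _; rewrite /one /ill mul1r mulrCA.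
  have -> : al (lpsi t) k - il k * al (lsol t) k =
    (al (lpsi t) k - s2) - il k * (al (lsol t) k - s1) by rewrite e; move: (al _ _) (al _ _) => *; ring.
  rewrite (le_trans (ler_normB _ _))//.
  have -> : 4 * D / 4 ^+ N = 2 * D / 4 ^+ N + 2 * D / 4 ^+ N by move: (4 ^+ N)^-1 => z; ring.
  apply: lerD => //; rewrite (normrM (il k)); apply: le_trans h1.
  by rewrite ger0_norm ?il_ge0// ler_piMl// il_le1.
rewrite bt bp E oppr0; apply/eqP; rewrite eq_complex /= !mul0r !mulr0 subr0 addr0.
by rewrite !eqxx.
Qed.

Lemma sum_supp_le (n K : nat) :
  \sum_(k <- box K) sq k ^+ p * `|c n k| <= \sum_(k <- box (2 * n.+1)) sq k ^+ p * `|c n k|.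
Proof.
have pos (k : Z2) : 0 <= sq k ^+ p * `|c n k| by rewrite mulr_ge0// exprn_ge0// ltW// sq_gt0.
have [h|h] := leqP K (2 * n.+1).
  by apply: sumr_sub; [exact: box_uniq|exact: box_uniq|exact: box_sub|exact: pos].
rewrite (sum_supp _ (ltnW h))// => k /c_supp ->; by rewrite normr0 mulr0.
Qed.

Lemma geo_sum_le N (E : R) : 0 <= E -> \sum_(n < N) E / 4 ^+ n <= 2 * E.
Proof.
move=> E0; have := @geo_part _ (fun n => E / 4 ^+ n) E _ N 0%N (leq0n N).
rewrite big_ord0 subr0 expr0 divr1 => h; apply: (le_trans (ler_norm _)); apply: h => n.
by rewrite ger0_norm// divr_ge0// exprn_ge0.
Qed.

(** The partial sums obey the bound up to an error that is summed over a fixed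
    box. *)
Lemma l1_limit (z : Z2 -> R) (tau : nat -> R) (E D' : R) K : 0 <= D' ->
  (forall k N, `|z k - \sum_(n < N) tau n * c n k| <= E / 4 ^+ N) ->
  (forall n, `|tau n| * \sum_(k <- box (2 * n.+1)) sq k ^+ p * `|c n k| <= D' / 4 ^+ n) ->
  \sum_(k <- box K) sq k ^+ p * `|z k| <= 2 * D'.
Proof.
move=> D'0 Hz Ht; pose S : R := \sum_(k <- box K) sq k ^+ p.
have cr : (fun N : nat => S * E / 4 ^+ N) @ \oo --> (0 : R) by apply: cvg_geo; rewrite ltr1n.
apply: (cvg_le_lim cr) => N.
apply: (@le_trans _ _ (\sum_(k <- box K) sq k ^+ p * (\sum_(n < N) `|tau n| * `|c n k| + E / 4 ^+ N))).
  apply: ler_sum => k _; apply: ler_wpM2l; first by rewrite exprn_ge0// ltW// sq_gt0.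
  have -> : z k = \sum_(n < N) tau n * c n k + (z k - \sum_(n < N) tau n * c n k) by ring.
  rewrite (le_trans (ler_normD _ _))// lerD//.
  apply: (le_trans (ler_norm_sum _ _ _)); apply: ler_sum => n _; by rewrite normrM.
under eq_bigr do rewrite mulrDr; rewrite big_split /= -mulr_suml -mulrA lerD2r.
under eq_bigr do rewrite mulr_sumr; rewrite exchange_big /=.
apply: le_trans (geo_sum_le N D'0); apply: ler_sum => n _.
apply: le_trans (Ht n).
rewrite (eq_bigr (fun k => `|tau n| * (sq k ^+ p * `|c n k|))); last by move=> k _; rewrite mulrCA.
by rewrite -mulr_sumr; apply: ler_wpM2l => //; exact: sum_supp_le.
Qed.

Let coef_rate t k N : `|t| <= T -> `|al (lsol t) k - \sum_(n < N) t ^+ n * c n k| <= 2 * D / 4 ^+ N.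
Proof.
move=> tT; have [h1 _] := coef_thw_rate T0 p1 c_supp c_even c_decay one0 one1 oneN k N tT.
move: h1; rewrite -/(lsol t) (eq_bigr (fun n : 'I_N => t ^+ n * c n k))//.
by move=> n _; rewrite mul1r.
Qed.

Let wt n := \sum_(k <- box (2 * n.+1)) sq k ^+ p * `|c n k|.
Let wt0 n : 0 <= wt n.
Proof. by apply: sumr_ge0 => k _; rewrite mulr_ge0// exprn_ge0// ltW// sq_gt0. Qed.

Variable (s : R).
Hypothesis sp : s <= (p.*2)%:R.

Let be0 t k : `|t| <= T -> be (lsol t) k = 0.
Proof. by move=> tT; exact: (be_thw T0 p1 c_supp c_even c_decay one0 one1 oneN k tT). Qed.

Lemma Hs_lsol t : `|t| <= T -> Hs s (lsol t).
Proof.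
move=> tT; have [pf Cf] := C1t tT; have [_ cf] := C1per_cper (C1t tT).
split => //.
- exact: continuous_measurable2.
- by apply: (@continuous_cell_integrable _ (fun x => lsol t x ^+ 2)); ct.
apply: (@le_lt_trans _ _ (2 * D)%:E); last exact: ltry.
apply: (@Hs_norm_l1 _ _ p) => //; first by rewrite mulr_ge0.
- by move=> k; exact: be0.
- move=> K; apply: (@l1_limit _ (fun n => t ^+ n) (2 * D)) => //.
    by move=> k N; exact: coef_rate.
  move=> n; apply: le_trans (c_decay n); rewrite normrX -/(wt n); apply: ler_pM => //.
    by rewrite lerXn2r ?nnegrE// ltW.
  by rewrite ler_peMl// ler1n.
Qed.

Lemma expr_diff n t t' : `|t| <= T -> `|t'| <= T ->
  T * `|t ^+ n - t' ^+ n| <= n%:R * T ^+ n * `|t - t'|.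
Proof.
move=> tT tT'; elim: n => [|n IH]; first by rewrite !expr0 subrr normr0 mulr0 !mul0r.
have -> : t ^+ n.+1 - t' ^+ n.+1 = t * (t ^+ n - t' ^+ n) + (t - t') * t' ^+ n.
  by rewrite !exprS; ring.
apply: (@le_trans _ _ (T * (`|t ^+ n - t' ^+ n| * T + `|t - t'| * T ^+ n))).
  apply: ler_wpM2l; first exact: ltW.
  rewrite (le_trans (ler_normD _ _))// !normrM lerD//; first by rewrite mulrC ler_wpM2l.
  by rewrite ler_wpM2l// normrX lerXn2r ?nnegrE// ltW.
have := ler_wpM2r (ltW T0) IH.
rewrite -natr1 exprS; move: (n%:R) (T ^+ n) `|t - t'| `|t ^+ n - _| => a b' d e h; lra.
Qed.

(** Gives the continuity in time, which is even Lipschitz. *)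
Lemma Hs_lsol_diff t t' : `|t| <= T -> `|t'| <= T ->
  (Hs_norm s (fun x => (lsol t x - lsol t' x)%R) <= (2 * (`|t - t'| * D / T))%:E)%E.
Proof.
move=> tT tT'; have [_ cf] := C1per_cper (C1t tT); have [_ cf'] := C1per_cper (C1t tT').
have D'0 : 0 <= `|t - t'| * D / T by rewrite divr_ge0 ?mulr_ge0// ltW.
apply: (@Hs_norm_l1 _ _ p) => //; first by rewrite mulr_ge0.
- by move=> k; rewrite beB// !be0// subrr.
- move=> K; apply: (@l1_limit _ (fun n => t ^+ n - t' ^+ n) (4 * D)) => //.
    move=> k N; rewrite alB//.
    have h1 := coef_rate k N tT; have h2 := coef_rate k N tT'.
    rewrite (eq_bigr (fun n : 'I_N => t ^+ n * c n k - t' ^+ n * c n k)); last first.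
      by move=> n _; rewrite mulrBl.
    rewrite sumrB; move: h1 h2; set a := al _ _; set a' := al _ _.
    set u := \sum_(_ < _) _; set v := \sum_(_ < _) _ => h1 h2.
    have -> : a - a' - (u - v) = (a - u) - (a' - v) by ring.
    rewrite (le_trans (ler_normB _ _))//.
    have -> : 4 * D / 4 ^+ N = 2 * D / 4 ^+ N + 2 * D / 4 ^+ N by move: (4 ^+ N)^-1 => z; ring.
    exact: lerD.
  move=> n; rewrite -/(wt n).
  apply: (@le_trans _ _ (`|t - t'| / T * (T ^+ n * (n.+1%:R * wt n)))); last first.
    have -> : `|t - t'| * D / T / 4 ^+ n = `|t - t'| / T * (D / 4 ^+ n) by move: (4 ^+ n)^-1 T^-1 => *; ring.
    by apply: ler_wpM2l; [apply: divr_ge0 => //; exact: ltW|exact: c_decay].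
  have -> : `|t - t'| / T * (T ^+ n * (n.+1%:R * wt n)) = (n.+1%:R * T ^+ n * `|t - t'|) / T * wt n.
    by move: T^-1 => *; ring.
  apply: ler_wpM2r => //; rewrite ler_pdivlMr// mulrC.
  apply: (le_trans (expr_diff n tT tT')); apply: ler_wpM2r => //; apply: ler_wpM2r.
    by rewrite exprn_ge0// ltW.
  by rewrite ler_nat.
Qed.

Let rate_term t n x : `|t| <= T ->
  `|t ^+ n * (n.+1%:R * fw c (fun=> 1) n.+1 x)| <= D / T / 4 ^+ n.
Proof.
move=> tT; have H k : `|(fun k => 1 * c n.+1 k) k| + `|(fun=> 0 : R) k| <= sq k ^+ p * `|c n.+1 k|.
  by rewrite normr0 addr0 mul1r ler_peMl// exprn_ege1// sq_ge1.
have TT : `|T| <= T by rewrite gtr0_norm.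
have := trig_term_le T0 c_decay x H TT; rewrite -/(cosp _ _) -/(fw c (fun=> 1) n.+1 x).
set u := fw _ _ _ _ => h.
rewrite normrM normrX; apply: (@le_trans _ _ (T ^+ n * (n.+2%:R * `|u|))).
  apply: ler_pM => //; first by rewrite lerXn2r ?nnegrE// ltW.
  by rewrite normrM ger0_norm// ler_wpM2r// ler_nat.
have {}h : T ^+ n.+1 * (n.+2%:R * `|u|) <= D / 4 ^+ n.+1.
  by move: h; rewrite normrM normrX (gtr0_norm T0) normrM ger0_norm.
rewrite mulrAC ler_pdivlMr// mulrAC -exprSr; apply: (le_trans h).
by rewrite ler_wpM2l// lef_pV2 ?posrE ?exprn_gt0// ler_weXn2l// ler1n.
Qed.

Lemma is_derive_pow (n : nat) (r : R) :
  is_derive r 1 (fun y : R => y ^+ n.+1) (n.+1%:R * r ^+ n).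
Proof.
elim: n => [|n IH].
  under eq_fun do rewrite expr1; rewrite expr0 mulr1; exact: is_derive_id.
under eq_fun do rewrite exprS.
apply: is_derive_eq; rewrite /GRing.scale/= -[n.+2%:R]natr1 exprS; ring.
Qed.

Lemma is_derive_cadd (u : R -> R) (r du a : R) : is_derive r 1 u du ->
  is_derive r 1 (fun y => a + u y) du.
Proof. by move=> h; rewrite -[du]add0r; exact: (is_deriveD (is_derive_cst a r 1) h). Qed.

Lemma lsol_derive t x : `|t| < T ->
  is_derive t 1 (fun r => lsol r x) (gs (fun n x => t ^+ n * (n.+1%:R * fw c (fun=> 1) n.+1 x)) x).
Proof.
move=> tT; pose g r := gs (fun n x => r ^+ n * (n.+1%:R * fw c (fun=> 1) n.+1 x)) x.
rewrite -/(g t).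
have d0 : 0 < T - `|t| by rewrite subr_gt0.
have near r : `|r - t| < T - `|t| -> `|r| <= T.
  move=> h; have := ler_normD (r - t) t; rewrite subrK; move: h; move: `|r - t| => y; lra.
have DT : 0 <= D / T by rewrite divr_ge0// ltW.
have cr : (fun N : nat => 2 * (D + D / T) / 4 ^+ N) @ \oo --> (0 : R) by apply: cvg_geo; rewrite ltr1n.
apply: (@is_derive_lim _ (fun N r => \sum_(n < N.+1) r ^+ n * fw c (fun=> 1) n x)
  (fun N r => \sum_(n < N) r ^+ n * (n.+1%:R * fw c (fun=> 1) n.+1 x))
  (fun r => lsol r x) g t (T - `|t|) _ d0 cr).
- move=> N r _; under eq_fun do rewrite big_ord_recl expr0 mul1r.
  have h : is_derive r 1 (fun r : R => \sum_(n < N) r ^+ n.+1 * fw c (fun=> 1) n.+1 x)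
     (\sum_(n < N) r ^+ n * (n.+1%:R * fw c (fun=> 1) n.+1 x)).
    apply: is_derive_bigsum => n; move: (fw c _ _ _) => u.
    have h := is_derive_pow n r.
    by apply: is_derive_eq; rewrite /GRing.scale/=; ring.
  exact: is_derive_cadd h.
- move=> N r /near rT.
  have := gs_rate (fw_geo T0 c_decay one0 one1 rT) N.+1 x.
  move=> /le_trans; apply; have p0 : 0 < (4 : R) ^+ N by rewrite exprn_gt0.
  rewrite exprS invfM mulrA ler_wpM2r ?invr_ge0 ?(ltW p0)//; have := D0; move: (D / T) DT => y; lra.
- move=> N r /near rT.
  have G : geo (fun n x => r ^+ n * (n.+1%:R * fw c (fun=> 1) n.+1 x)) (D / T).
    by move=> n y; exact: rate_term.
  apply: (le_trans (gs_rate G N x)).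
  by rewrite ler_wpM2r ?invr_ge0 ?exprn_ge0// ler_wpM2l// lerDr.
- move=> N; apply: ct_sum => n; move: (fw c _ _ _) => u.
  apply: ctM; [exact: exprn_continuous|exact: ctC].
Qed.

(** Cauchy product of the series of the two gradients; each coefficient is
    computed by [cosp_transport] and the recursion. *)
Lemma lsol_transport t x : `|t| <= T ->
  gs (fun n x => t ^+ n * (n.+1%:R * fw c (fun=> 1) n.+1 x)) x = transport (lpsi t) (lsol t) x.
Proof.
move=> tT.
have [p1t p2t] := partial_thw T0 p1 c_decay one0 one1 x tT.
have [p1p p2p] := partial_thw T0 p1 c_decay il0 il1 x tT.
rewrite /transport /lsol /lpsi p1t p2t p1p p2p.
have A1 := dfw1_geo T0 p1 c_decay one0 one1 tT; have A2 := dfw2_geo T0 p1 c_decay one0 one1 tT.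
have B1 := dfw1_geo T0 p1 c_decay il0 il1 tT; have B2 := dfw2_geo T0 p1 c_decay il0 il1 tT.
have cr : (fun N : nat => 12 * (D * D) / 2 ^+ N) @ \oo --> (0 : R) by apply: cvg_geo; rewrite ltr1n.
apply: (gs_uniq cr) => N.
have h1 := gs_mul_rate x N B2 A1; have h2 := gs_mul_rate x N B1 A2.
have E : \sum_(n < N) t ^+ n * (n.+1%:R * fw c (fun=> 1) n.+1 x) =
  \sum_(n < N) \sum_(i < n.+1) (t ^+ i * dfw2 c ill i x) * (t ^+ (n - i) * dfw1 c one (n - i) x) -
  \sum_(n < N) \sum_(i < n.+1) (t ^+ i * dfw1 c ill i x) * (t ^+ (n - i) * dfw2 c one (n - i) x).
  rewrite -sumrB; apply: eq_bigr => n _; rewrite -sumrB.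
  rewrite (eq_bigr (fun i : 'I_n.+1 => t ^+ n * cosp (2 * n.+2) (bilin (2 * n.+1) (c i) (c (n - i))) x)).
    rewrite -mulr_sumr; congr (_ * _).
    rewrite /fw /cosp /trigp mulr_sumr exchange_big /=; apply: eq_bigr => k _.
    rewrite !mul0r addr0 mul1r mulrA c_eq mulr_suml; apply: eq_bigr => i _; by rewrite addr0.
  move=> i _; have iN : (i <= n)%N by rewrite -ltnS.
  have -> : (2 * n.+2 = 2 * i.+1 + 2 * (n - i).+1)%N by rewrite -mulnDr addSn addnS subnKC.
  rewrite -(@cosp_transport _ _ _ (2 * n.+1)); last 4 first.
  - exact: c_even.
  - exact: c_supp.
  - exact: c_supp.
  - by rewrite leq_mul2l ltnS.
  rewrite -[in t ^+ n](subnKC iN) exprD /dfw1 /dfw2 /one /ill.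
  have e : (fun k => 1 * c (n - i)%N k) = c (n - i)%N by apply/funext => k; rewrite mul1r.
  rewrite e; move: (t ^+ i) (t ^+ (n - i)) => u v.
  by move: (dcosp1 _ _ _) (dcosp2 _ _ _) (dcosp1 _ _ _) (dcosp2 _ _ _) => *; ring.
rewrite E; move: h1 h2; rewrite -/one -/ill.
move: (gs _ x * gs _ x) (gs _ x * gs _ x) (\sum_(_ < _) _) (\sum_(_ < _) _) => a1 a2 s1 s2 h1 h2.
have -> : a2 - a1 - (s2 - s1) = (a2 - s2) - (a1 - s1) by ring.
rewrite (le_trans (ler_normB _ _))//.
have -> : 12 * (D * D) / 2 ^+ N = 6 * (D * D) / 2 ^+ N + 6 * (D * D) / 2 ^+ N by move: (2 ^+ N)^-1 => z; ring.
exact: lerD.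
Qed.

Lemma lsol_solution : sqg_solution s (lsol 0) T%:E lsol.
Proof.
have lt t : lifespan T%:E t -> `|t| < T by move=> [t0]; rewrite lte_fin ger0_norm.
split => //.
- by move=> t /lt/ltW tT; exact: Hs_lsol.
- by move=> t /lt/ltW /C1t[].
- move=> t0 /lt/ltW h0.
  have C0 : 0 < 2 * D / T + 1 by rewrite ltr_wpDl// divr_ge0 ?mulr_ge0// ltW.
  have fine_lim : (fun t => (2 * (`|t - t0| * D / T))%:E) @ within (lifespan T%:E) (nbhs t0) --> (0 : R)%:E.
    apply: cvg_EFin; first by apply: nearW => t.
    apply/cvgrPdist_le => e e0; rewrite /within /=.
    apply/nbhs_ballP; exists (e / (2 * D / T + 1)); first by rewrite /= divr_gt0.
    move=> t /=; rewrite /ball /= distrC => td _.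
    rewrite sub0r normrN ger0_norm; last by rewrite !mulr_ge0// invr_ge0 ltW.
    have -> : 2 * (`|t - t0| * D / T) = `|t - t0| * (2 * D / T) by ring.
    move: td; rewrite ltr_pdivlMr// => /ltW; apply: le_trans.
    by rewrite ler_wpM2l// lerDl.
  apply: squeeze_cvge (cvg_cst _) fine_lim.
  rewrite /prop_near1 /within /=; apply: nearW => t /lt/ltW tT; apply/andP; split; first exact: poweR_ge0.
  exact: Hs_lsol_diff.
- move=> t t0 /lt tT; exists (lpsi t); split.
  + exact/lsol_multiplier/ltW.
  + by have [] := C1p (ltW tT).
  + move=> x; have := lsol_derive x tT; rewrite (lsol_transport x (ltW tT)).
    by rewrite /transport /dot /grad /grad_perp /= mulNr.
Qed.

End LocalSolution.

(** * The theorem *)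

Section Final.
Context {R : realType}.
Local Notation X := (R * R)%type.
Local Notation Z2 := (int * int)%type.
Implicit Types (k l : Z2).

Section datum.
Variables (al0 tau : R).

Lemma datum_coef_supp : supp 2 (datum_coef al0 tau).
Proof.
move=> k kn; rewrite /datum_coef.
have H l : l \in box 2 -> (k == l) = false.
  by move=> lb; apply/eqP => kl; move: kn; rewrite kl lb.
by rewrite !H ?mem_box//= !addr0 !mulr0 !addr0.
Qed.

Lemma datum_coef_even k : datum_coef al0 tau (- k) = datum_coef al0 tau k.
Proof. by have [<- _] := coef_datum al0 tau k; have [<- _] := coef_datum al0 tau (- k); rewrite alN. Qed.

Lemma cosp_datum : cosp 2 (datum_coef al0 tau) = datum al0 tau.
Proof.
apply/funext => x; rewrite datum_cs /cosp /trigp.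
rewrite (eq_bigr (fun k => al0 * cs k x * (k == e1)%:R + al0 * cs k x * (k == - e1)%:R +
    (tau * cs k x * (k == kp)%:R + tau * cs k x * (k == - kp)%:R) +
    (tau * cs k x * (k == km)%:R + tau * cs k x * (k == - km)%:R))).
  by rewrite !big_split /= !sum_box_delta ?mem_box// !csN; ring.
by move=> k _; rewrite /datum_coef; ring.
Qed.

Lemma Hs_norm_datum (s : R) :
  2 * (al0 ^+ 2 * 2 `^ s + tau ^+ 2 * 6 `^ s + tau ^+ 2 * 6 `^ s) <= 1 ->
  (Hs_norm s (datum al0 tau) <= 1)%E.
Proof.
move=> h; apply: Hs_norm_le => // K; rewrite expr1n; apply: le_trans h.
have e : 2 * (al0 ^+ 2 * 2 `^ s + tau ^+ 2 * 6 `^ s + tau ^+ 2 * 6 `^ s) =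
    \sum_(k <- box (maxn K 2)) sq k `^ s * datum_coef al0 tau k ^+ 2.
  rewrite (@sum_datum _ al0 tau _ (fun k => sq k `^ s)) ?leq_maxr//; last by move=> k; rewrite sqN.
  have -> : sq e1 = 2 :> R by rewrite /sq /sqnormk /= expr1n expr0n addr0.
  have -> : sq kp = 6 :> R by rewrite /sq /sqnormk /=; ring.
  by have -> : sq km = 6 :> R by rewrite /sq /sqnormk /=; ring.
rewrite e (eq_bigr (fun k => sq k `^ s * datum_coef al0 tau k ^+ 2)); last first.
  by move=> k _; have [-> ->] := coef_datum al0 tau k; rewrite expr0n addr0.
apply: sumr_sub; [exact: box_uniq|exact: box_uniq|apply: box_sub; exact: leq_maxl|].
by move=> k; rewrite mulr_ge0 ?powR_ge0 ?sqr_ge0.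
Qed.

Lemma datum_local (s : R) : exists (T : R) (theta : R -> X -> R),
  0 < T /\ sqg_solution s (datum al0 tau) T%:E theta.
Proof.
pose a0 := datum_coef al0 tau; pose b : R := 1 + \sum_(k <- box 2) `|a0 k|.
have b0 : 0 < b by rewrite ltr_wpDr// sumr_ge0.
have ab : \sum_(k <- box 2) `|a0 k| <= b by rewrite lerDr.
pose p := (Num.truncn s).+1.
have sp : s <= (p.*2)%:R.
  by rewrite (le_trans (ltW (truncnS_gt s)))// ler_nat -addnn leq_addr.
have [D D0 HD] := tcoef_decay datum_coef_supp b0 ab p.
have T0 : 0 < (128 * b)^-1 by rewrite invr_gt0 mulr_gt0.
exists (128 * b)^-1, (lsol (tcoef a0)); split => //.
have c_eq n k : n.+1%:R * tcoef a0 n.+1 k =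
    \sum_(j < n.+1) bilin (2 * n.+1) (tcoef a0 j) (tcoef a0 (n - j)) k.
  by rewrite tcoefS mulrA divff ?mul1r.
have := lsol_solution T0 (isT : (0 < p)%N) (fun n => @tcoef_supp _ _ datum_coef_supp n)
  (fun n k => tcoef_even datum_coef_even n k) HD c_eq sp.
suff -> : lsol (tcoef a0) 0 = datum al0 tau by [].
apply/funext => x; rewrite -cosp_datum.
have cr : (fun N : nat => 2 * D / 4 ^+ N) @ \oo --> (0 : R) by apply: cvg_geo; rewrite ltr1n.
apply/eqP; rewrite -subr_eq0 -normr_le0; apply: (cvg_le0 (N := 1%N) cr) => -[//|N] _.
have TT : `|0 : R| <= (128 * b)^-1 by rewrite normr0 ltW.
have := gs_rate (@fw_geo _ _ _ _ _ T0 HD (fun=> 1) (fun=> ler01) (fun=> lexx 1) _ TT) N.+1 x.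
rewrite big_ord_recl expr0 mul1r big1; last by move=> i _; rewrite exprS !mul0r.
rewrite addr0 /fw muln1 (_ : (fun k => 1 * tcoef a0 0 k) = datum_coef al0 tau)//.
by apply/funext => k; rewrite mul1r.
Qed.

End datum.

(** Otherwise the norm would stay below [A] from some time on. *)
Lemma limsup_ge (s A : R) (th : R -> X -> R) : 11 <= s -> 0 < A ->
  (forall t0 : R, 0 < t0 -> ~ (forall t : R, t0 <= t -> L2w 11 (th t) A)) ->
  (A%:E <= limf_esup (fun t : R => Hs_norm s (th t)) +oo%R)%E.
Proof.
move=> s11 A0 H; rewrite leNgt; apply/negP => /ereal_inf_lt[_ /= [V [M [_ HM]] <-] hV].
apply: (H (Num.max 1 (M + 1))); first by rewrite lt_max ltr01.
move=> t; rewrite ge_max => /andP[_ Mt].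
apply: (Hs_L2w (s := s)) => //; first exact: ltW.
apply: le_trans (ltW hV); apply: ereal_sup_ubound; exists t => //.
by apply: HM; rewrite (lt_le_trans _ Mt)// ltrDl.
Qed.

End Final.

Unset Implicit Arguments.

Theorem theorem1p1 (R : realType) (s A : R) (hs : 11 <= s) (hA : 0 < A) :
  exists theta0 : R * R -> R,
    [/\ Hs s theta0,
        (Hs_norm s theta0 <= 1)%E,
        exists (T : R) (theta : R -> R * R -> R),
          0 < T /\ sqg_solution s theta0 T%:E theta &
        forall theta : R -> R * R -> R,
          sqg_solution s theta0 +oo%E theta ->
          (A%:E <= limf_esup (fun t : R => Hs_norm s (theta t)) +oo%R)%E].
Proof.
have A2 := sqr_ge0 A; have A0 := ltW hA.
pose b : R := 25 * (8 + A ^+ 2).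
(* The shear contributes [2 al0^2 2^s = al0] to the square of the norm of the
   datum. *)
pose al0 : R := (2 `^ s)^-1 / 2.
have s0 : 0 <= s by rewrite (le_trans _ hs).
have p2 : 1 <= 2 `^ s by rewrite -[leLHS](powRr0 2) ler_powR// ler1n.
have p6 : 0 < 6 `^ s by rewrite powR_gt0.
have p20 : 0 < 2 `^ s by rewrite powR_gt0.
have al00 : 0 < al0 by rewrite divr_gt0// invr_gt0.
have i0 : 0 < al0^-1 by rewrite invr_gt0.
have b0 : 0 < b by rewrite /b; lra.
(* [N] dominates every constant that the small parameter [nu] has to beat. *)
pose N : R := 1 + (4 / al0 + b) + 8 * 29 * b / al0 + 64 * b ^+ 5 / al0 + 8 * 6 `^ s.
have x1 : 0 < 4 / al0 + b by rewrite addr_gt0// mulr_gt0.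
have x2 : 0 < 8 * 29 * b / al0 by rewrite mulr_gt0// mulr_gt0.
have x3 : 0 < 64 * b ^+ 5 / al0 by rewrite mulr_gt0// mulr_gt0// exprn_gt0.
have x4 : 0 < 8 * 6 `^ s by rewrite mulr_gt0.
have N0 : 0 < N by rewrite /N; lra.
pose nu := N^-1.
have nu0 : 0 < nu by rewrite invr_gt0.
have small z : z <= N -> nu * z <= 1 by move=> zN; rewrite mulrC ler_pdivrMr// mul1r.
have nu1 : nu <= 1 by rewrite -[nu]mulr1; apply: small; rewrite /N; lra.
have small1 : nu * (4 / al0 + b) <= 1 by apply: small; rewrite /N; lra.
have small2 : nu * (8 * 29 * b / al0) <= 1 by apply: small; rewrite /N; lra.
have small3 : nu * (64 * b ^+ 5 / al0) <= 1 by apply: small; rewrite /N; lra.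
have small4 : nu * (8 * 6 `^ s) <= 1 by apply: small; rewrite /N; lra.
have [T [th [T0 sol]]] := datum_local al0 (nu ^+ 11) s.
exists (datum al0 (nu ^+ 11)); split.
- have := sqg_Hs sol (t := 0); rewrite (sqg_initial sol); apply.
  by split; rewrite ?lte_fin.
- apply: Hs_norm_datum.
  have t2 : (nu ^+ 11) ^+ 2 <= nu by rewrite -exprM -[leRHS]expr1 ler_wiXn2l// ltW.
  have h1 : al0 ^+ 2 * 2 `^ s = al0 / 2 by rewrite /al0; field; rewrite gt_eqF.
  have h2 : al0 <= 2^-1 by rewrite /al0 ler_piMl// invf_le1.
  have h3 : (nu ^+ 11) ^+ 2 * 6 `^ s <= nu * 6 `^ s by rewrite ler_wpM2r// ltW.
  rewrite h1; move: h3 small4; set y := _ ^+ 2 * _; set z := 6 `^ s; lra.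
- by exists T, th.
- move=> theta sol'; have [ps F] := sqg_flow hs sol'.
  apply: limsup_ge => // t0 t00.
  exact: (norm_unbounded F al00 A0 nu0 nu1 (sqg_initial sol') small1 small2 small3 t00).
Qed.
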